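(* Let $p\in\{2,3,5,7\}$, $q=p-1$, $r=48/(q(p+1))$. The character $\chi_V=\sum_{\Lambda\in M}\operatorname{mult}(\Lambda)\,\chi_\Lambda$ of $V$ as $\hat{A}_q^r$-module can be written as $$\chi_V=\sum_{\lambda\in N'/N}\tilde{F}_\lambda\,\vartheta_\lambda ,$$ where $N=\sqrt{p}\,(A_q^r,G)$, $\vartheta_\lambda$ is the theta function of the coset $\lambda+N$ and $$\tilde{F}_\lambda=\sum_{\Lambda\in G\backslash M}\ \sum_{g\in G}\frac{\operatorname{mult}(\Lambda)}{|G_\Lambda|}\prod_{i=1}^r c^{\Lambda_i}_{g_i.\sqrt{p}\lambda_i},$$ with $G_\Lambda$ the stabilizer of $\Lambda$ in $G$.
   Context: Write $e(x)=e^{2\pi i x}$. Affine algebra and string functions. $A_q=\mathfrak{sl}_p(\mathbb{C})$ with Cartan subalgebra $h$ and form normalized so that roots have norm $2$; $A_q$ also denotes the root lattice, $A_q'$ its dual. $\hat{A}_q$ is the untwisted affine Kac-Moody algebra with Cartan subalgebra $h\oplus\mathbb{C}K\oplus\mathbb{C}d$ and $\hat{h}^*=h^*\oplus\mathbb{C}\Lambda_0\oplus\mathbb{C}\delta$ ($\Lambda_0(K)=1$, $\Lambda_0(h\oplus \mathbb{C}d)=0$, $\delta(d)=1$, $\delta(h\oplus\mathbb{C}K)=0$), with form extended by $(\Lambda_0,\delta)=1$, $(\Lambda_0,\Lambda_0)=(\delta,\delta)=0$, $\Lambda_0,\delta\perp h^*$. Fundamental weights: $\Lambda_0$ and $\Lambda_i=\overline{\Lambda_i}+\Lambda_0$,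 $1\le i\le q$, with $\overline{\Lambda_i}$ those of $A_q$ (and $\overline{\Lambda_0}=0$). Weights are taken modulo $\mathbb{C}\delta$ and written $(n_0,\dots,n_q)=\sum n_i\Lambda_i$, of level $\sum n_i$. $P^p$ = integral weights of level $p$, $P^p_+$ = those with all $n_i\ge0$. The projection $\lambda\mapsto\overline\lambda=\sum_{i\ge1}n_i\overline{\Lambda_i}$ identifies $P^p$ with $A_q'$. For $\Lambda\in P^p_+$, $\lambda\in P^p$ (representatives with $\Lambda(d)=\lambda(d)=0$), with $\rho=\sum_{i=0}^q\Lambda_i$, $k=h^\vee=p$, $m_\Lambda=\frac{(\Lambda+\rho)^2}{2(k+h^\vee)}-\frac{\rho^2}{2h^\vee}$, $m_{\Lambda,\lambda}=m_\Lambda-\frac{\lambda^2}{2k}$, the string function is $c^\Lambda_\lambda(\tau)=\sum_{n\in\mathbb{Z}}\operatorname{mult}_{L(\Lambda)}(\lambda-n\delta)\,e((m_{\Lambda,\lambda}+n)\tau)$; it depends only on $\overline\lambda \bmod pA_q$. Put $\theta_\lambda(\tau,z,u)=e(pu)\sum_{\nu\in\overline\lambda+pA_q}e(\tau\nu^2/2p+(\nu,z))$. For $\Lambda=(\Lambda_1,\dots,\Lambda_r)\in(P^p_+)^r$ the normalized character of $L(\Lambda_1)\otimes\dots\otimes L(\Lambda_r)$ is $\chi_\Lambda=\prod_{i=1}^r\sum_{\lambda_i\in A_q'/pA_q}c^{\Lambda_i}_{\lambda_i}(\tau)\theta_{\lambda_i}(\tau,z_i,u_i)$. Simple currents: the weights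 $p\Lambda_i$ ($0\le i\le q$), acting on level $p$ weights by $(p\Lambda_i).(n_0,\dots,n_q)=(n_{q+1-i},\dots,n_q,n_0,\dots,n_{q-i})$. Identify $\mathbb{F}_p$ with $A_q'/A_q$ via $i\mapsto\overline{\Lambda_i}+A_q$ and with the group of simple currents via $i\mapsto p\Lambda_i$; $\mathbb{F}_p^r$ acts componentwise on $r$-tuples of level $p$ weights. The code $G\subset\mathbb{F}_p^r$, the set $M\subset(P^p_+)^r$ of highest weights and the multiplicities are as follows ($V$ is the prospective central charge 24 vertex operator algebra in Schellekens' list with spin-1 algebra $\hat{A}_{q,p}^r$). $M$ is the union of the $G$-orbits of the following representatives, $\operatorname{mult}$ is constant on orbits, equal to the indicated factor (1 if none); exponents denote repeated components. $G\backslash M$ stands for a set of orbit representatives. - $p=2$ ($r=16$): $G$ is the binary (extended) Hamming code of length 16 (dimension 11). Representatives: $(2,0)^{16}$; $8\times(1,1)^{16}$; and for each weight 8 codeword of the dual code $G^\perp$: $(1,1)$ in the 1-components of the codeword and, in the 0-components, any combination of $(2,0)$ and $(0,2)$ with both occurring an odd number of times (for a given codeword all these combinations form a single $G$-orbit, so each codeword contributes one orbit). - $p=3$ ($r=6$): $G$ is the ternary zero sum code of length 6. Representatives: $(3,0,0)^6$; $(1,1,1)^4(3,0,0)^2$ and all permutations of the components; $(2,0,1)^5(0,1,2)$; $(2,1,0)^5(0,2,1)$; $6\times(1,1,1)^6$. - $p=5$ ($r=2$): $G=\mathbb{F}_5^2$. Representatives: $(5,0,0,0,0)^2$; $(2,0,1,0,2)^2$;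 $(2,0,0,2,1)(3,0,1,1,0)$; $(3,0,1,1,0)(2,0,0,2,1)$; $(1,1,1,1,1)(1,0,0,1,3)$; $(1,0,0,1,3)(1,1,1,1,1)$; $4\times(1,1,1,1,1)^2$. - $p=7$ ($r=1$): $G=\mathbb{F}_7$. Representatives: $(7,0,0,0,0,0,0)$; $(2,0,0,1,3,0,1)$; $(2,1,0,3,1,0,0)$; $(2,0,0,2,0,3,0)$; $(1,0,1,0,1,2,2)$; $3\times(1,1,1,1,1,1,1)$. $(A_q^r,G)$ is the rational lattice of all vectors of ${A_q^r}'$ whose class in ${A_q^r}'/A_q^r=\mathbb{F}_p^r$ lies in $G$; $(A_q^r,G^\perp)$ is defined in the same way with the orthogonal complement $G^\perp$ for the discriminant bilinear form, and is the dual lattice of $(A_q^r,G)$. $N'$ is the dual of $N$, so $N'=\frac{1}{\sqrt{p}}(A_q^r,G^\perp)$; for $\lambda\in N'$, $\sqrt{p}\lambda_i\in A_q'$ is regarded as a weight of level $p$. The theta function is $$\vartheta_\lambda(\tau,z,u)=\sum_{\mu\in\lambda+N}\ \prod_{i=1}^r e(pu_i)\,e\big(\tau\mu_i^2/2+(\mu_i,\sqrt{p}z_i)\big).$$ *)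

(* Defs.v *)
From HB Require Import structures.
From mathcomp Require Import all_boot all_order all_algebra.
From mathcomp Require Import all_classical all_reals all_analysis.
From mathcomp.analysis.showcase Require summability.
From mathcomp Require Import complex.

Set Implicit Arguments.
Unset Strict Implicit.
Unset Printing Implicit Defensive.
Import Order.TTheory GRing.Theory Num.Theory.
Import numFieldNormedType.Exports.
Local Open Scope classical_set_scope.
Local Open Scope ring_scope.
Local Open Scope complex_scope.

(* Throughout, the affine algebra is the one of sl_p, and the level is k = p. *)

Definition representatives (T : Type) (A : set T) (e : T -> T -> Prop)
    (S : set T) : Prop :=
  S `<=` A /\ forall x, A x -> exists! y, S y /\ e x y.

Definition dot (F : comNzRingType) (m n : nat) (x y : 'M[F]_(m, n)) : F :=
  \tr (x *m y^T).

(* Representations of the affine algebra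
     sl_p (x) F[t, t^-1] (+) F K (+) F d,
   with loop a m the action of a (x) t^m; loop is only meaningful on
   traceless matrices.  The trace form is the one for which roots have
   norm 2.                                                              *)

Record affine_rep (F : fieldType) (p : nat) (V : lmodType F) := AffineRep {
  loop : 'M[F]_p -> int -> {linear V -> V};
  actK : {linear V -> V};
  actd : {linear V -> V};
  loop_linear : forall (x : F) (a b : 'M[F]_p) (m : int) (v : V),
    \tr a = 0 -> \tr b = 0 ->
    loop (x *: a + b) m v = x *: loop a m v + loop b m v;
  loop_bracket : forall (a b : 'M[F]_p) (m n : int) (v : V),
    \tr a = 0 -> \tr b = 0 ->
    loop a m (loop b n v) - loop b n (loop a m v) =
      loop (a *m b - b *m a) (m + n) v
      + (if m + n == 0 then m%:~R * \tr (a *m b) else 0) *: actK v;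
  loop_actK : forall (a : 'M[F]_p) (m : int) (v : V),
    \tr a = 0 -> actK (loop a m v) = loop a m (actK v);
  actd_actK : forall v : V, actK (actd v) = actd (actK v);
  actd_loop : forall (a : 'M[F]_p) (m : int) (v : V),
    \tr a = 0 -> actd (loop a m v) - loop a m (actd v) = m%:~R *: loop a m v
}.

Definition irreducible_rep (F : fieldType) (p : nat) (V : lmodType F)
    (M : affine_rep p V) : Prop :=
  (exists v : V, v <> 0) /\
  forall W : set V,
    W 0 -> (forall (x : F) v w, W v -> W w -> W (x *: v + w)) ->
    (forall a m v, \tr a = 0 -> W v -> W (loop M a m v)) ->
    (forall v, W v -> W (actK M v)) -> (forall v, W v -> W (actd M v)) ->
    W = [set 0] \/ W = setT.

(* The weight mu + k Lambda_0 + n delta.  The Cartan subalgebra of sl_p is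
   that of the traceless diagonal matrices, and its dual is identified with
   the vectors of coordinate sum 0.                                      *)
Definition weight_space (F : fieldType) (p : nat) (V : lmodType F)
    (M : affine_rep p V) (mu : 'rV[F]_p) (k n : int) : set V :=
  [set v | [/\ forall h : 'rV[F]_p, \sum_j h 0 j = 0 ->
                 loop M (diag_mx h) 0 v = dot mu h *: v,
               actK M v = k%:~R *: v
             & actd M v = n%:~R *: v]].

Definition highest_weight_vector (F : fieldType) (p : nat) (V : lmodType F)
    (M : affine_rep p V) (mu : 'rV[F]_p) (k n : int) (v : V) : Prop :=
  [/\ v <> 0,
      weight_space M mu k n v,
      forall a m, \tr a = 0 -> 0 < m -> loop M a m v = 0
    & forall a : 'M[F]_p, (forall i j : 'I_p, (j <= i)%N -> a i j = 0) ->
        loop M a 0 v = 0].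

Definition has_dim (F : fieldType) (V : lmodType F) (W : set V) (n : nat) :
    Prop :=
  exists b : 'I_n -> V, (forall i, W (b i)) /\
    forall v, W v -> exists! c : 'rV[F]_n, v = \sum_i c 0 i *: b i.

Section Lattices.
Variable R : realType.

Definition traceless_rows (F : nmodType) (r p : nat) : set 'M[F]_(r, p) :=
  [set x | forall i, \sum_j x i j = 0].

Definition dual_lattice (r p : nat) (L : set 'M[R]_(r, p)) : set 'M[R]_(r, p) :=
  [set x | traceless_rows x /\ forall y, L y -> dot x y \is a Num.int].

Definition root_lattice (p : nat) : set 'rV[R]_p :=
  [set x | traceless_rows x /\ forall j, x 0 j \is a Num.int].

(* For 0 <= i < p; in the basis dual to the simple (co)roots e_(i-1) - e_i,
   where coordinates are indexed from 0. *)
Definition fundamental_weight (p i : nat) : 'rV[R]_p :=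
  \row_j ((j < i)%N%:R - i%:R / p%:R).

Definition code_lattice (r p : nat) (G : {set 'rV['F_p]_r}) : set 'M[R]_(r, p) :=
  [set x | (forall i, dual_lattice (@root_lattice p) (row i x)) /\
           exists2 g, g \in G &
             forall i, root_lattice (row i x - fundamental_weight p (g 0 i))].

(* Integral affine weights modulo delta are given by their Dynkin labels
   (n_0, ..., n_q), q = p - 1. *)

Definition level (p : nat) (n : 'rV[int]_p) : int := \sum_j n 0 j.

Definition bar (p : nat) (n : 'rV[int]_p) : 'rV[R]_p :=
  \sum_(j < p) (n 0 j)%:~R *: fundamental_weight p j.

Definition weight_of (p : nat) (x : 'rV[R]_p) : 'rV[int]_p :=
  xget 0 [set n | level n = p%:Z /\ bar n = x].

Definition rho (p : nat) : 'rV[int]_p := const_mx 1.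

(* The representatives vanishing on d have no delta-component, and Lambda_0
   is isotropic and orthogonal to the finite weights. *)
Definition sqnorm (p : nat) (n : 'rV[int]_p) : R := dot (bar n) (bar n).

Definition anomaly (p : nat) (Lam lam : 'rV[int]_p) : R :=
  sqnorm (Lam + rho p) / (2 * (p + p))%:R - sqnorm (rho p) / (2 * p)%:R
  - sqnorm lam / (2 * p)%:R.

(* exp (2 pi i x) *)
Definition e (x : R[i]) : R[i] :=
  (expR (- (2 * pi * complex.Im x)))%:C *
  (cos (2 * pi * complex.Re x) +i* sin (2 * pi * complex.Re x)).

(* Unconditional sum: limit over the directed set of finite subsets. *)
Definition csum (T : choiceType) (D : set T) (f : T -> R[i]) : R[i] :=
  @summability.sum T R[i] R[i]^o (fun x => if x \in D then f x else 0).

Definition toC (m n : nat) (x : 'M[R]_(m, n)) : 'M[R[i]]_(m, n) :=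
  map_mx (real_complex R) x.

Definition is_L (p : nat) (V : lmodType R[i]) (M : affine_rep p V)
    (Lam : 'rV[int]_p) : Prop :=
  irreducible_rep M /\
  exists v, highest_weight_vector M (toC (bar Lam)) (level Lam) 0 v.

(* mult_{L(Lam)}(lam - n delta); L(Lam) exists and is unique up to
   isomorphism, and its weight spaces are finite-dimensional. *)
Definition mult (p : nat) (Lam lam : 'rV[int]_p) (n : int) : nat :=
  xget 0%N [set k | exists (V : lmodType R[i]) (M : affine_rep p V),
    is_L M Lam /\
    has_dim (weight_space M (toC (bar lam)) (level lam) (- n)) k].

Definition string_function (p : nat) (Lam lam : 'rV[int]_p) (tau : R[i]) :
    R[i] :=
  csum setT (fun n : int =>
    (mult Lam lam n)%:R * e (((anomaly Lam lam)%:C + n%:~R) * tau)).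

Definition scaled (m n : nat) (x : R) (L : set 'M[R]_(m, n)) :
    set 'M[R]_(m, n) :=
  [set x *: y | y in L].

Definition coset (m n : nat) (x : 'M[R]_(m, n)) (L : set 'M[R]_(m, n)) :
    set 'M[R]_(m, n) :=
  [set x + y | y in L].

Definition theta (p : nat) (lam : 'rV[R]_p) (tau : R[i]) (z : 'rV[R[i]]_p)
    (u : R[i]) : R[i] :=
  e (p%:R * u) *
  csum (coset lam (scaled p%:R (@root_lattice p))) (fun nu =>
    e (tau * (dot nu nu / (2 * p)%:R)%:C + dot (toC nu) z)).

(* Q is a set of representatives of A_q'/pA_q. *)
Definition chi (r p : nat) (Q : set 'rV[R]_p) (Lam : 'M[int]_(r, p))
    (tau : R[i]) (z : 'M[R[i]]_(r, p)) (u : 'rV[R[i]]_r) : R[i] :=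
  \prod_(i < r) \sum_(lam \in Q)
    (string_function (row i Lam) (weight_of lam) tau
     * theta lam tau (row i z) (u 0 i)).

Definition vartheta (r p : nat) (N : set 'M[R]_(r, p)) (lam : 'M[R]_(r, p))
    (tau : R[i]) (z : 'M[R[i]]_(r, p)) (u : 'rV[R[i]]_r) : R[i] :=
  csum (coset lam N) (fun mu =>
    \prod_(i < r) (e (p%:R * u 0 i) *
      e (tau * (dot (row i mu) (row i mu) / 2)%:C
         + dot (toC (row i mu)) ((Num.sqrt p%:R)%:C *: row i z)))).

End Lattices.
Arguments root_lattice : clear implicits.
Arguments code_lattice R {r p} G.

(* (p Lambda_i).(n_0, ..., n_q): the label in position j is n_(j-i). *)
Definition current (p : nat) (i : nat) (n : 'rV[int]_p) : 'rV[int]_p :=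
  \row_j n 0 (iter i (@ord_pred p) j).

Definition currents (r p : nat) (g : 'rV['F_p]_r) (Lam : 'M[int]_(r, p)) :
    'M[int]_(r, p) :=
  \matrix_(i, j) current (g 0 i) (row i Lam) 0 j.

(* For p = 2 the coordinates of the extended Hamming code are indexed by the
   binary expansions of 0, ..., 15: its checks are the overall parity and the
   four bits. *)
Definition glue_code (r p : nat) : {set 'rV['F_p]_r} :=
  if (p == 2)%N then
    [set g : 'rV['F_p]_r | (\sum_i g 0 i == 0) &&
      [forall k : 'I_4, \sum_(i < r | odd (i %/ 2 ^ k)) g 0 i == 0]]%SET
  else if (p == 3)%N then [set g : 'rV['F_p]_r | \sum_i g 0 i == 0]%SET
  else [set: _]%SET.

(* The discriminant form is (i, j) |-> - ij/p mod 1, so this is also the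
   orthogonal complement for it. *)
Definition dual_code (r p : nat) (G : {set 'rV['F_p]_r}) :
    {set 'rV['F_p]_r} :=
  [set h : 'rV['F_p]_r | [forall g in G, \sum_i g 0 i * h 0 i == 0]]%SET.

Definition weights_of_seq (r p : nat) (s : seq (seq nat)) : 'M[int]_(r, p) :=
  \matrix_(i, j) (nth 0%N (nth [::] s i) j)%:Z.

(* representative r p m s: s is a listed representative, with factor m. *)
Definition representative (r p : nat) (m : nat) (s : seq (seq nat)) : Prop :=
  (match p with
  | 2 =>
      (m, s) \in [:: (1, nseq 16 [:: 2; 0]); (8, nseq 16 [:: 1; 1])] \/
      m = 1 /\ exists h : 'rV['F_2]_r,
        [/\ h \in dual_code (glue_code r 2),
            #|[set i : 'I_r | (h 0 i != 0)%R]%SET| = 8,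
            size s = r,
            forall i : 'I_r,
              if (h 0 i == 0)%R
              then nth [::] s i \in [:: [:: 2; 0]; [:: 0; 2]]
              else nth [::] s i == [:: 1; 1]
          & odd (count_mem [:: 2; 0] s) && odd (count_mem [:: 0; 2] s)]
  | 3 =>
      (m, s) \in [:: (1, nseq 6 [:: 3; 0; 0]);
                     (1, rcons (nseq 5 [:: 2; 0; 1]) [:: 0; 1; 2]);
                     (1, rcons (nseq 5 [:: 2; 1; 0]) [:: 0; 2; 1]);
                     (6, nseq 6 [:: 1; 1; 1])] \/
      m = 1 /\ perm_eq s (nseq 4 [:: 1; 1; 1] ++ nseq 2 [:: 3; 0; 0])
  | 5 =>
      (m, s) \in [:: (1, nseq 2 [:: 5; 0; 0; 0; 0]);
                     (1, nseq 2 [:: 2; 0; 1; 0; 2]);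
                     (1, [:: [:: 2; 0; 0; 2; 1]; [:: 3; 0; 1; 1; 0]]);
                     (1, [:: [:: 3; 0; 1; 1; 0]; [:: 2; 0; 0; 2; 1]]);
                     (1, [:: [:: 1; 1; 1; 1; 1]; [:: 1; 0; 0; 1; 3]]);
                     (1, [:: [:: 1; 0; 0; 1; 3]; [:: 1; 1; 1; 1; 1]]);
                     (4, nseq 2 [:: 1; 1; 1; 1; 1])]
  | 7 =>
      (m, s) \in [:: (1, [:: [:: 7; 0; 0; 0; 0; 0; 0]]);
                     (1, [:: [:: 2; 0; 0; 1; 3; 0; 1]]);
                     (1, [:: [:: 2; 1; 0; 3; 1; 0; 0]]);
                     (1, [:: [:: 2; 0; 0; 2; 0; 3; 0]]);
                     (1, [:: [:: 1; 0; 1; 0; 1; 2; 2]]);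
                     (3, [:: [:: 1; 1; 1; 1; 1; 1; 1]])]
  | _ => False
  end)%N.

Definition occurs_with (r p : nat) (m : nat) (Lam : 'M[int]_(r, p)) : Prop :=
  exists s, representative r p m s /\
    exists2 g, g \in glue_code r p & Lam = currents g (weights_of_seq r p s).

Definition highest_weights (r p : nat) : set 'M[int]_(r, p) :=
  [set Lam | exists m, occurs_with m Lam].

Arguments highest_weights : clear implicits.

Definition multiplicity (r p : nat) (Lam : 'M[int]_(r, p)) : nat :=
  xget 0%N [set m | occurs_with m Lam].

Definition same_orbit (r p : nat) (Lam Lam' : 'M[int]_(r, p)) : Prop :=
  exists2 g, g \in glue_code r p & Lam' = currents g Lam.

Arguments same_orbit : clear implicits.

Definition stabilizer (r p : nat) (Lam : 'M[int]_(r, p)) :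
    {set 'rV['F_p]_r} :=
  [set g in glue_code r p | currents g Lam == Lam]%SET.

(* O is a set of representatives of the orbits of the code on
   highest_weights. *)
Definition Ftilde (R : realType) (r p : nat) (O : set 'M[int]_(r, p))
    (lam : 'M[R]_(r, p)) (tau : R[i]) : R[i] :=
  \sum_(Lam \in O) \sum_(g in glue_code r p)
    ((multiplicity Lam)%:R / #|stabilizer Lam|%:R
     * \prod_(i < r) string_function (row i Lam)
         (current (g 0 i) (weight_of (Num.sqrt p%:R *: row i lam))) tau).

(* Main.v *)
Require Import Defs.
From HB Require Import structures.
From mathcomp Require Import all_boot all_order all_algebra.
From mathcomp Require Import fingroup perm.
From mathcomp Require Import finmap.
From mathcomp Require Import all_classical all_reals all_analysis.
From mathcomp.analysis.showcase Require summability.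
From mathcomp Require Import complex.
From mathcomp Require Import ring lra zify.
Set Implicit Arguments.
Unset Strict Implicit.
Unset Printing Implicit Defensive.
Import Order.TTheory GRing.Theory Num.Theory.
Local Open Scope classical_set_scope.
Local Open Scope ring_scope.

(** Write C(x) for the sum over the highest weights Lam in M of
    mult(Lam) prod_i c^(Lam_i)_(x_i), where x is an r-tuple of weights of
    A_q', and g(x) for the product of the i-th terms at x_i of the series
    defining the theta functions. Both sides of the theorem are the absolutely
    convergent sum of C(x) g(x) over all tuples x in (A_q')^r.

    For the left-hand side, string functions are periodic modulo p A_q, so the
    sum over A_q'/p A_q of a string function times a theta function is one sum
    over A_q' (has_sum_string_theta); the product over i of such sums is a sum
    over tuples (has_sum_prod, has_sum_chi), and the sum over M puts C in front
    (has_sum_character). For the right-hand side, the sum over N'/N of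
    coefficients times theta functions is one sum over N', which sqrt p maps
    into (A_q')^r (has_sum_expansion). It has the same terms because the
    coefficient at lam is C(sqrt p lam) (Ftilde_coef), because C is invariant
    under translation by sqrt p N (coef_shift), and because C vanishes outside
    sqrt p N' (coef_class).

    These three facts come from three properties of string functions. First,
    c^(J Lam)_(J lam) = c^Lam_lam for a simple current J
    (string_function_current), because J is induced by an automorphism of the
    affine algebra that permutes the positive root vectors: a representation is
    pulled back along a cyclic permutation of the coordinates followed by a
    spectral flow (perm_twist, flow). Second, c^Lam_lam is invariant under the
    Weyl group (string_at_perm), because L(Lam) is integrable
    (simple_f_vanishes, square0_locally_nilpotent) and strings of sl_2 are
    symmetric (simple_reflection_dim). Third, c^Lam_lam = 0 unless lam lies in
    Lam + A_q (weight_class).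

    A current acts on finite weights by a permutation of the coordinates
    followed by a translation by p times the projection eps_o of a coordinate
    vector (bar_current). So the first two properties together give
    c^(J Lam)_(x + p eps_i) = c^Lam_x for every i, and from this the effect of
    any translation by p y with y in A_q': it is that of the current
    corresponding to the class of y (shifts_by_class). In particular it is
    trivial for y in A_q. Hence coef_shift, where the currents of a code word
    permute M. The formula for the coefficients follows by counting orbits
    (orbit_sum). For coef_class, the classes of the components of a highest
    weight form a word of the dual code (highest_weight_class), so the third
    property confines the support of C to the dual of (A_q^r, G).

    The terms of the theta series are dominated by a product of Gaussians in
    the coordinates (theta_term_summable). *)


(** * Subspaces and strings of sl_2 *)

Definition linsub (F : fieldType) (V : lmodType F) (W : set V) : Prop :=
  W 0 /\ forall (x : F) v w, W v -> W w -> W (x *: v + w).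

Lemma linsubZ (F : fieldType) (V : lmodType F) (W : set V) (x : F) v :
  linsub W -> W v -> W (x *: v).
Proof. by case=> W0 Wl Wv; rewrite -[x *: v]addr0; exact: Wl. Qed.

Lemma linsubD (F : fieldType) (V : lmodType F) (W : set V) v w :
  linsub W -> W v -> W w -> W (v + w).
Proof. by case=> W0 Wl Wv Ww; rewrite -[v]scale1r; exact: Wl. Qed.

Lemma linsubB (F : fieldType) (V : lmodType F) (W : set V) v w :
  linsub W -> W v -> W w -> W (v - w).
Proof. by case=> W0 Wl Wv Ww; rewrite addrC -scaleN1r; exact: Wl. Qed.

Lemma iter_linearB (F : fieldType) (V : lmodType F) (g : {linear V -> V}) k v w :
  iter k g (v - w) = iter k g v - iter k g w.
Proof. by elim: k => //= k ->; rewrite linearB. Qed.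

Lemma iter_linearD (F : fieldType) (V : lmodType F) (g : {linear V -> V}) k v w :
  iter k g (v + w) = iter k g v + iter k g w.
Proof. by elim: k => //= k ->; rewrite linearD. Qed.

Lemma iter_linearZ (F : fieldType) (V : lmodType F) (g : {linear V -> V}) k
    (x : F) v : iter k g (x *: v) = x *: iter k g v.
Proof. by elim: k => //= k ->; rewrite linearZ. Qed.

Lemma iter_linear0 (F : fieldType) (V : lmodType F) (g : {linear V -> V}) k :
  iter k g 0 = 0.
Proof. by elim: k => //= k ->; rewrite linear0. Qed.

(** The operators e and f of an sl_2 acting on a string of weight spaces W j, of
    weight m + 2 j; exchanging e with f and W j with W (- m - j) gives again
    such a string. *)
Section Sl2.
Variables (F : numFieldType) (V : lmodType F) (e f : {linear V -> V}).
Variables (m : nat) (W : int -> set V).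
Hypothesis W_sub : forall j, linsub (W j).
Hypothesis W_e : forall j v, W j v -> W (j + 1) (e v).
Hypothesis W_f : forall j v, W j v -> W (j - 1) (f v).
Hypothesis W_h : forall j v, W j v ->
  e (f v) - f (e v) = (m%:R + 2 * j%:~R) *: v.

Lemma sl2_iter_e j k v : W j v -> W (j + k%:Z) (iter k e v).
Proof.
elim: k => [|k IH] Wv /=; first by rewrite addr0.
by rewrite -addn1 PoszD addrA; apply: W_e; exact: IH.
Qed.

Lemma sl2_iter_f j k v : W j v -> W (j - k%:Z) (iter k f v).
Proof.
elim: k => [|k IH] Wv /=; first by rewrite subr0.
by rewrite -addn1 PoszD opprD addrA; apply: W_f; exact: IH.
Qed.

Lemma sl2_e_iter_f j k v : W j v -> e v = 0 ->
  e (iter k.+1 f v) = (k.+1%:R * (m%:R + 2 * j%:~R - k%:R)) *: iter k f v.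
Proof.
move=> Wv ev0.
elim: k => [|k IH].
  rewrite /= -[e (f v)](subrK (f (e v))) (W_h Wv) ev0 linear0 addr0.
  by congr (_ *: _); rewrite mul1r subr0.
rewrite iterS -[e (f _)](subrK (f (e (iter k.+1 f v)))).
rewrite (W_h (sl2_iter_f k.+1 Wv)) IH linearZ /= -scalerDl; congr (_ *: _).
rewrite intrB -!natr1 -!pmulrn -natr1; ring.
Qed.

Lemma sl2_iter_ef j l k v : W j v -> e v = 0 ->
  (forall i, (i < l + k)%N -> m%:R + 2 * j%:~R != i%:R :> F) ->
  exists2 a : F, a != 0 & iter l e (iter (l + k) f v) = a *: iter k f v.
Proof.
move=> Wv ev0; elim: l k => [|l IH] k nz.
  by exists 1; rewrite ?oner_eq0 // scale1r.
have [|a a0 Ea] := IH k.+1; first by move=> i; rewrite addnS; exact: nz.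
exists (a * (k.+1%:R * (m%:R + 2 * j%:~R - k%:R))).
  rewrite !mulf_neq0 // ?pnatr_eq0 // subr_eq0; apply: nz.
  by rewrite addSn ltnS leq_addl.
by rewrite iterS addSnnS Ea linearZ /= (sl2_e_iter_f _ Wv ev0) scalerA.
Qed.

(** A vector x of weight m killed by e^(k+1) differs from a vector killed by
    e^k by a multiple of f^k z, where z = e^k x is a highest weight vector. Its
    weight m + 2 k is at least m + k, so that no f^j z with j <= m + k is lost.
    This is the induction step for both injectivity and surjectivity of the
    m-th powers. *)
Lemma sl2_reduce k x : W 0 x -> iter k.+1 e x = 0 ->
  exists z, [/\ W k%:Z z, e z = 0, iter k e x = z &
    exists a : F, W 0 (x - a *: iter k f z) /\
      iter k e (x - a *: iter k f z) = 0].
Proof.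
move=> Wx ex0; exists (iter k e x).
have Wz : W k%:Z (iter k e x) by rewrite -[_%:Z]add0r; exact: sl2_iter_e.
split=> //.
have nz i : (i < k + 0)%N -> m%:R + 2 * (k%:Z)%:~R != i%:R :> F.
  by move=> lt_ik; rewrite -pmulrn -natrM -natrD eqr_nat; lia.
have [a a0] := sl2_iter_ef Wz ex0 nz; rewrite addn0 /= => Ea.
exists a^-1; split.
  apply: linsubB => //; apply: linsubZ => //.
  by rewrite -(subrr k%:Z); exact: sl2_iter_f.
by rewrite iter_linearB iter_linearZ Ea scalerA mulVf // scale1r subrr.
Qed.

Lemma sl2_highest_nz k z : W k%:Z z -> e z = 0 ->
  exists2 a : F, a != 0 & iter (m + k) e (iter (m + k) f z) = a *: z.
Proof.
move=> Wz ez0.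
have [|a a0] := @sl2_iter_ef _ (m + k) 0 _ Wz ez0.
  by move=> i lt_i; rewrite -pmulrn -natrM -natrD eqr_nat; lia.
by rewrite addn0 => E; exists a.
Qed.

Lemma sl2_kill k x : W 0 x -> iter k e x = 0 ->
  iter (m + k) e (iter m f x) = 0.
Proof.
elim: k x => [|k IH] x Wx ex0.
  by move: ex0 => /= ->; rewrite iter_linear0 iter_linear0.
have [z [Wz ez0 _ [a [Wx' ex'0]]]] := sl2_reduce Wx ex0.
rewrite -[x](subrK (a *: iter k f z)) 2!iter_linearD addnS iterS.
rewrite (IH _ Wx' ex'0) linear0 add0r !iter_linearZ -iterD /=.
have [b _ ->] := sl2_highest_nz Wz ez0.
by rewrite !linearZ /= ez0 !scaler0.
Qed.

Lemma sl2_inj k x : W 0 x -> iter k e x = 0 -> iter m f x = 0 -> x = 0.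
Proof.
elim: k x => [//|k IH] x Wx ex0 fx0.
have [z [Wz ez0 Ez [a [Wx' ex'0]]]] := sl2_reduce Wx ex0.
suff z0 : z = 0 by apply: IH => //; rewrite Ez.
have [a0|a0] := eqVneq a 0.
  by move: ex'0; rewrite a0 scale0r subr0 Ez.
have := sl2_kill Wx' ex'0.
rewrite iter_linearB fx0 sub0r -scaleN1r !iter_linearZ -iterD.
have [b b0 ->] := sl2_highest_nz Wz ez0.
move/eqP; rewrite scaler_eq0 oppr_eq0 oner_eq0 /=.
by rewrite !scaler_eq0 (negPf a0) (negPf b0) => /eqP.
Qed.

Lemma sl2_surj k x : W 0 x -> iter k e x = 0 ->
  exists2 y, W (- m%:Z) y & iter m e y = x.
Proof.
elim: k x => [|k IH] x Wx ex0.
  by exists 0; [case: (W_sub (- m%:Z)) | rewrite iter_linear0 -ex0].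
have [z [Wz ez0 _ [a [Wx' ex'0]]]] := sl2_reduce Wx ex0.
have [y Wy Ey] := IH _ Wx' ex'0.
have [|b b0 Eb] := @sl2_iter_ef _ m k _ Wz ez0.
  by move=> i lt_i; rewrite -pmulrn -natrM -natrD eqr_nat; lia.
exists (y - (- a / b) *: iter (m + k) f z).
  apply: linsubB => //; apply: linsubZ => //.
  have -> : - m%:Z = k%:Z - (m + k)%:Z by lia.
  exact: sl2_iter_f.
rewrite iter_linearB iter_linearZ Eb Ey scalerA divfK //.
by rewrite scaleNr opprK subrK.
Qed.

End Sl2.

Lemma has_dim_bij (F : fieldType) (V : lmodType F) (W W' : set V)
    (phi : {linear V -> V}) (k : nat) :
  linsub W ->
  (forall v, W v -> W' (phi v)) -> (forall v, W v -> phi v = 0 -> v = 0) ->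
  (forall w, W' w -> exists2 v, W v & phi v = w) ->
  has_dim W k -> has_dim W' k.
Proof.
move=> subW phiW phi_inj phi_surj [b [Wb bP]].
exists (phi \o b); split=> [i|w /phi_surj[v Wv <-]]; first exact/phiW.
have [c [Ec uc]] := bP v Wv; exists c; split.
  by rewrite Ec linear_sum; apply: eq_bigr => i _; rewrite linearZ.
move=> c' Ec'; apply: uc; apply/eqP; rewrite -subr_eq0; apply/eqP/phi_inj.
  apply: linsubB => //.
  elim/big_ind: _ => [|x y Wx Wy|i _]; first by case: subW.
    exact: linsubD.
  exact: linsubZ.
rewrite linearB Ec' linear_sum -sumrB big1 // => i _.
by rewrite linearZ subrr.
Qed.

Lemma has_dim_eq0 (F : fieldType) (V : lmodType F) (W : set V) (k : nat) :
  (forall v, W v -> v = 0) -> has_dim W k -> k = 0%N.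
Proof.
move=> W0 [b [Wb bP]]; case: k b Wb bP => // k b Wb bP.
have [c [_ uc]] := bP _ (Wb 0).
have b0 i : b i = 0 by exact: W0.
have E (c' : 'rV_k.+1) : \sum_i c' 0 i *: b i = 0.
  by apply: big1 => i _; rewrite b0 scaler0.
have := etrans (esym (uc (const_mx 1) _)) (uc 0 _); rewrite !E b0 => /(_ erefl erefl).
by move/matrixP/(_ 0 0); rewrite !mxE => /eqP; rewrite oner_eq0.
Qed.

(** * Representations of the affine algebra *)

Lemma mx_diag_delta (F : fieldType) (p : nat) (a : 'M[F]_p) :
  a = diag_mx (\row_i a i i) +
      \sum_i \sum_(j | j != i) a i j *: delta_mx i j.
Proof.
rewrite {1}[a]matrix_sum_delta.
transitivity (\sum_i (a i i *: delta_mx i i +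
    \sum_(j | j != i) a i j *: delta_mx i j)).
  by apply: eq_bigr => i _; rewrite (bigD1 i).
rewrite big_split /=; congr (_ + _).
apply/matrixP=> i j; rewrite summxE (bigD1 i) //= big1 => [|k nki].
  rewrite addr0 !mxE eqxx [j == i]eq_sym.
  by case: (i =P j) => [->|_]; rewrite ?mulr1 ?mulr0.
by rewrite !mxE [i == k]eq_sym (negPf nki) mulr0.
Qed.

Lemma tr_diag_row (F : fieldType) (p : nat) (h : 'rV[F]_p) :
  \tr (diag_mx h) = \sum_j h 0 j.
Proof. exact: mxtrace_diag. Qed.

Lemma tr_delta (F : fieldType) (p : nat) (i j : 'I_p) :
  i != j -> \tr (delta_mx i j : 'M[F]_p) = 0.
Proof.
move=> nij; rewrite /mxtrace big1 // => k _; rewrite mxE.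
by case: eqP => // ->; rewrite (negPf nij).
Qed.

Lemma tr_comm (F : fieldType) (p : nat) (a b : 'M[F]_p) :
  \tr (a *m b - b *m a) = 0.
Proof. by rewrite linearB /= mxtrace_mulC subrr. Qed.

Lemma diag_delta (F : fieldType) (p : nat) (h : 'rV[F]_p) (i j : 'I_p) :
  diag_mx h *m delta_mx i j - delta_mx i j *m diag_mx h =
  (h 0 i - h 0 j) *: delta_mx i j.
Proof.
rewrite mul_diag_mx mul_mx_diag; apply/matrixP=> k l; rewrite !mxE.
case: eqP => [->|_]; case: eqP => [->|_] /=;
  by rewrite ?mulr1 ?mul1r ?mulr0 ?mul0r ?subr0.
Qed.

Lemma diag_comm (F : fieldType) (p : nat) (h k : 'rV[F]_p) :
  diag_mx h *m diag_mx k = diag_mx k *m diag_mx h.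
Proof. by rewrite !mulmx_diag; congr diag_mx; apply/rowP=> i; rewrite !mxE mulrC. Qed.

Section AffineRep.
Variables (F : numFieldType) (p : nat) (V : lmodType F) (M : affine_rep p V).
Implicit Types (a b : 'M[F]_p) (m n : int) (v : V) (W : set V).

Lemma loopD a b m v : \tr a = 0 -> \tr b = 0 ->
  loop M (a + b) m v = loop M a m v + loop M b m v.
Proof.
by move=> ta tb; have := loop_linear M 1 m v ta tb; rewrite !scale1r.
Qed.

Lemma loop0 m v : loop M 0 m v = 0.
Proof.
have t0 : \tr (0 : 'M[F]_p) = 0 by exact: mxtrace0.
have /eqP := loopD m v t0 t0.
by rewrite addr0 -subr_eq0 opprD addrA subrr sub0r oppr_eq0 => /eqP.
Qed.

Lemma loopZ a m v (x : F) : \tr a = 0 -> loop M (x *: a) m v = x *: loop M a m v.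
Proof.
move=> ta; have := loop_linear M x m v ta (mxtrace0 _ _).
by rewrite !addr0 loop0 addr0.
Qed.

Lemma loop0_bracket a b n v : \tr a = 0 -> \tr b = 0 ->
  loop M a 0 (loop M b n v) =
    loop M b n (loop M a 0 v) + loop M (a *m b - b *m a) n v.
Proof.
move=> ta tb; have := loop_bracket M 0 n v ta tb.
rewrite add0r mul0r if_same scale0r addr0 => <-.
by rewrite addrC subrK.
Qed.

Lemma actd_loop0 a v : \tr a = 0 -> actd M (loop M a 0 v) = loop M a 0 (actd M v).
Proof.
by move=> ta; apply/eqP; rewrite -subr_eq0 actd_loop // scale0r.
Qed.

(** Since a is the sum of its root components and its diagonal part, a t^m can
    be handled one eigenvector of the Cartan subalgebra at a time. *)
Lemma loop_decomp W a m v : linsub W -> \tr a = 0 ->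
  (forall i j, i != j -> a i j != 0 -> W (loop M (delta_mx i j) m v)) ->
  W (loop M (diag_mx (\row_i a i i)) m v) ->
  W (loop M a m v).
Proof.
move=> subW ta Woff Wdiag; rewrite [a]mx_diag_delta.
pose P b := \tr b = 0 /\ W (loop M b m v).
have PD b b' : P b -> P b' -> P (b + b').
  move=> [tb Wb] [tb' Wb']; split; first by rewrite linearD /= tb tb' addr0.
  by rewrite loopD //; exact: linsubD.
have P0 : P 0 by split; [exact: mxtrace0 | rewrite loop0; case: subW].
suff [] : P (diag_mx (\row_i a i i) +
             \sum_i \sum_(j | j != i) a i j *: delta_mx i j) by [].
apply: (PD).
  split=> //; rewrite tr_diag_row -[RHS]ta; apply: eq_bigr => i _.
  by rewrite mxE.
apply: (big_ind P P0 PD) => i _; apply: (big_ind P P0 PD) => j nji.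
have [->|aij] := eqVneq (a i j) 0; first by rewrite scale0r; exact: P0.
have tij : \tr (delta_mx i j : 'M[F]_p) = 0 by rewrite tr_delta // eq_sym.
split; first by rewrite linearZ /= tij mulr0.
by rewrite loopZ //; apply: linsubZ => //; apply: Woff => //; rewrite eq_sym.
Qed.

(** The adjoint action of a matrix of square zero has cube zero, so the vectors
    killed by a power of that matrix form a subrepresentation. *)
Lemma square0_locally_nilpotent a v0 k0 : irreducible_rep M ->
  \tr a = 0 -> a *m a = 0 -> v0 <> 0 -> iter k0 (loop M a 0) v0 = 0 ->
  forall v, exists k, iter k (loop M a 0) v = 0.
Proof.
move=> [_ irr] ta aa v0n0 k0P.
pose f := loop M a 0; pose W : set V := [set v | exists k, iter k f v = 0].
pose adj j b := iter j (fun c => a *m c - c *m a) b.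
have tadj j b : \tr b = 0 -> \tr (adj j b) = 0.
  by case: j => [//|j] tb; exact: tr_comm.
have key N : forall j k b m v, (j + k <= N)%N -> \tr b = 0 ->
    adj j b = 0 -> iter k f v = 0 -> iter (j + k) f (loop M b m v) = 0.
  elim: N => [|N IH] [|j] [|k] b m v //= le_N tb.
  - by move=> -> _; rewrite loop0.
  - by move=> -> _; rewrite loop0.
  - by move=> -> _; rewrite loop0 -iterS iter_linear0.
  - by move=> _ ->; rewrite linear0 -iterS iter_linear0.
  move=> adj0 fk0; rewrite -iterS iterSr {2}/f loop0_bracket //.
  rewrite iter_linearD -/f.
  have -> : iter (j + k.+1) f (loop M b m (f v)) = 0.
    rewrite addnS -addSn; apply: IH => //.
      by move: le_N; rewrite addnS ltnS.
    by rewrite -iterSr.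
  rewrite add0r; apply: IH => //; first exact: tr_comm.
  by rewrite /adj -iterSr.
have subW : linsub W.
  split=> [|x v w [k kP] [l lP]]; first by exists 0%N.
  exists (l + k)%N; rewrite iter_linearD iter_linearZ iterD kP iter_linear0.
  by rewrite scaler0 add0r addnC iterD lP iter_linear0.
have [WE|WE] : W = [set 0] \/ W = setT.
- apply: irr; [by case: subW | by case: subW | | | ].
  + move=> b m v tb [k kP]; exists (3 + k)%N; apply: (key _ _ _ _ _ _ (leqnn _)) => //.
    rewrite /adj /= !(mulmxBr, mulmxBl, mulmxA) aa !mul0mx.
    by rewrite -!mulmxA aa !mulmx0 !(subr0, sub0r, oppr0, subrr).
  + move=> v [k kP]; exists k.
    suff -> : iter k f (actK M v) = actK M (iter k f v) by rewrite kP linear0.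
    by elim: (k) => //= l ->; rewrite loop_actK.
  + move=> v [k kP]; exists k.
    suff -> : iter k f (actd M v) = actd M (iter k f v) by rewrite kP linear0.
    by elim: (k) => //= l ->; rewrite /f actd_loop0.
- have : W v0 by exists k0.
  by rewrite WE.
by move=> v; have : W v by rewrite WE.
Qed.

End AffineRep.

(** * Sums of generalised eigenspaces *)
Section Shifted.
Variables (F : numFieldType) (V : lmodType F).
Implicit Types (D : {linear V -> V}) (s t : seq F) (c k : F).

Definition ann D s (v : V) : V := foldr (fun c x => D x - c *: x) v s.

Lemma ann_cat D s t v : ann D (s ++ t) v = ann D s (ann D t v).
Proof. by rewrite /ann foldr_cat. Qed.

Lemma ann_lin D s x v w : ann D s (x *: v + w) = x *: ann D s v + ann D s w.
Proof.
elim: s => //= c s ->; rewrite linearP !scalerDr scalerN !scalerA [c * x]mulrC.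
by rewrite opprD addrACA.
Qed.

Lemma ann0 D s : ann D s 0 = 0.
Proof. by have := ann_lin D s (-1) 0 0; rewrite scaler0 add0r scaleN1r addNr. Qed.

Lemma ann_D D s v : ann D s (D v) = D (ann D s v).
Proof. by elim: s => //= c s ->; rewrite linearB [D (c *: _)]linearZ. Qed.

Lemma ann_step D c s v :
  ann D s (D v - c *: v) = D (ann D s v) - c *: ann D s v.
Proof. by rewrite addrC -scaleNr ann_lin ann_D scaleNr addrC. Qed.

Lemma annC D s t v : ann D s (ann D t v) = ann D t (ann D s v).
Proof. by elim: t => //= c t IH; rewrite ann_step IH. Qed.

Lemma ann_eigen D s c v : D v = c *: v ->
  ann D s v = \prod_(x <- s) (c - x) *: v.
Proof.
move=> Dv; elim: s => [|x s IH] /=; first by rewrite big_nil scale1r.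
rewrite IH linearZ /= Dv big_cons !scalerA -scalerBl; congr (_ *: _); ring.
Qed.

Lemma ann_shift D (b : {linear V -> V}) k s v :
  (forall v, D (b v) = b (D v) + k *: b v) ->
  ann D [seq x + k | x <- s] (b v) = b (ann D s v).
Proof.
move=> Db; elim: s => //= x s ->; rewrite Db linearB [b (x *: _)]linearZ /= scalerDl.
by rewrite opprD addrACA subrr addr0.
Qed.

(** The sum of the generalised eigenspaces of D with eigenvalues in P. Asking
    for an annihilating product of shifted operators, rather than for a
    decomposition into eigenvectors, makes stability a matter of shifting the
    factors. *)
Definition eig_sum D (P : set F) : set V :=
  [set v | exists s, (forall c, c \in s -> P c) /\ ann D s v = 0].

Lemma eig_sum_linsub D P : linsub (eig_sum D P).
Proof.
split=> [|x v w [s [Ps sv]] [t [Pt tw]]]; first by exists [::].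
exists (s ++ t); split=> [c|].
  by rewrite mem_cat => /orP[/Ps|/Pt].
by rewrite ann_lin ann_cat annC sv ann0 scaler0 add0r ann_cat tw ann0.
Qed.

Lemma eig_sum_shift D (P : set F) (b : {linear V -> V}) k v :
  (forall v, D (b v) = b (D v) + k *: b v) -> (forall c, P c -> P (c + k)) ->
  eig_sum D P v -> eig_sum D P (b v).
Proof.
move=> Db Pk [s [Ps sv]]; exists [seq x + k | x <- s]; split.
  by move=> _ /mapP[x /Ps Px ->]; exact: Pk.
by rewrite ann_shift // sv linear0.
Qed.

Lemma eig_sum_eigen D (P : set F) c v : D v = c *: v -> P c -> eig_sum D P v.
Proof.
move=> Dv Pc; exists [:: c]; split=> [x|]; first by rewrite inE => /eqP->.
by rewrite /= Dv subrr.
Qed.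

Lemma eig_sum_disjoint D (P : set F) c v :
  eig_sum D P v -> D v = c *: v -> ~ P c -> v = 0.
Proof.
move=> [s [Ps]] + Dv nPc; rewrite (ann_eigen _ Dv) => /eqP.
rewrite scaler_eq0 => /orP[|/eqP//]; rewrite prodf_seq_eq0 => /hasP[x xs] /=.
by rewrite subr_eq0 => /eqP cx; case: nPc; rewrite cx; exact: Ps.
Qed.

End Shifted.

(** * Highest weight representations *)

Lemma dotE (F : comNzRingType) (n : nat) (x y : 'rV[F]_n) :
  dot x y = \sum_j x 0 j * y 0 j.
Proof.
by rewrite /dot trace_mx11 mxE; apply: eq_bigr => j _; rewrite mxE.
Qed.

Lemma dotDl (F : comNzRingType) (m n : nat) (x y z : 'M[F]_(m, n)) :
  dot (x + y) z = dot x z + dot y z.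
Proof. by rewrite /dot mulmxDl linearD. Qed.

Lemma dot_delta (F : comNzRingType) (n : nat) (i : 'I_n) (y : 'rV[F]_n) :
  dot (delta_mx 0 i) y = y 0 i.
Proof. by rewrite /dot trace_mx11 -rowE !mxE. Qed.

Lemma dotNl (F : comNzRingType) (m n : nat) (x y : 'M[F]_(m, n)) :
  dot (- x) y = - dot x y.
Proof. by rewrite /dot mulNmx linearN. Qed.

Lemma dotC (F : comNzRingType) (n : nat) (x y : 'rV[F]_n) : dot x y = dot y x.
Proof. by rewrite !dotE; apply: eq_bigr => j _; rewrite mulrC. Qed.

(** The projection to the Cartan subalgebra of sl_p, or to its dual. *)
Definition traceless_part (F : fieldType) (p : nat) (x : 'rV[F]_p) : 'rV[F]_p :=
  \row_j (x 0 j - (\sum_i x 0 i) / p%:R).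

Lemma traceless_part_sum (F : numFieldType) (p : nat) (x : 'rV[F]_p) :
  \sum_j traceless_part x 0 j = 0.
Proof.
under eq_bigr => j _ do rewrite mxE.
rewrite sumrB sumr_const card_ord -[X in _ - X]mulr_natr.
case: p x => [|p] x; first by rewrite !big_ord0 !mul0r subr0.
by rewrite divfK ?subrr // pnatr_eq0.
Qed.

Lemma dot_traceless_part (F : fieldType) (p : nat) (x y : 'rV[F]_p) :
  \sum_j x 0 j = 0 -> dot x (traceless_part y) = dot x y.
Proof.
move=> sx; rewrite !dotE; under eq_bigr => j _ do rewrite mxE mulrBr.
by rewrite sumrB -mulr_suml sx mul0r subr0.
Qed.

Lemma dot_traceless_delta (F : fieldType) (p : nat) (x : 'rV[F]_p) (i : 'I_p) :
  \sum_j x 0 j = 0 -> dot x (traceless_part (delta_mx 0 i)) = x 0 i.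
Proof. by move=> sx; rewrite dot_traceless_part // dotC dot_delta. Qed.

Section HighestWeight.
Variables (F : numFieldType) (p : nat) (V : lmodType F) (M : affine_rep p V).
Implicit Types (a b : 'M[F]_p) (m n : int) (v w : V) (W : set V).
Implicit Types (mu h : 'rV[F]_p) (k : int).

Lemma weight_space_linsub mu k n : linsub (weight_space M mu k n).
Proof.
split=> [|x v w [Hv Kv dv] [Hw Kw dw]].
  by split=> [h _||]; rewrite linear0 scaler0.
by split=> [h h0||]; rewrite linearP ?Hv ?Hw // ?Kv ?Kw ?dv ?dw scalerDr !scalerA mulrC.
Qed.

Lemma loop_diag_bracket h a m v : \sum_j h 0 j = 0 -> \tr a = 0 ->
  loop M (diag_mx h) 0 (loop M a m v) =
  loop M a m (loop M (diag_mx h) 0 v) +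
  loop M (diag_mx h *m a - a *m diag_mx h) m v.
Proof. by move=> h0 ta; rewrite loop0_bracket // tr_diag_row. Qed.

Lemma loop_diag_delta h (i j : 'I_p) m v : \sum_j h 0 j = 0 -> i != j ->
  loop M (diag_mx h) 0 (loop M (delta_mx i j) m v) =
  loop M (delta_mx i j) m (loop M (diag_mx h) 0 v) +
  (h 0 i - h 0 j) *: loop M (delta_mx i j) m v.
Proof.
by move=> h0 nij; rewrite loop_diag_bracket ?tr_delta // diag_delta loopZ ?tr_delta.
Qed.

Lemma loop_diag_diag h h' m v : \sum_j h 0 j = 0 -> \sum_j h' 0 j = 0 ->
  loop M (diag_mx h) 0 (loop M (diag_mx h') m v) =
  loop M (diag_mx h') m (loop M (diag_mx h) 0 v).
Proof.
move=> h0 h'0; rewrite loop_diag_bracket ?tr_diag_row // diag_comm subrr.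
by rewrite loop0 addr0.
Qed.

Lemma actd_loopE a m v : \tr a = 0 ->
  actd M (loop M a m v) = loop M a m (actd M v) + m%:~R *: loop M a m v.
Proof. by move=> ta; rewrite -(actd_loop M m v ta) addrC subrK. Qed.

Lemma weight_space_delta mu k n (i j : 'I_p) m v : i != j ->
  weight_space M mu k n v ->
  weight_space M (mu + (delta_mx 0 i - delta_mx 0 j)) k (m + n)
    (loop M (delta_mx i j) m v).
Proof.
move=> nij [Hv Kv dv]; split=> [h h0||].
- rewrite loop_diag_delta // Hv // linearZ /= -scalerDl; congr (_ *: _).
  by rewrite !dotDl dotNl !dot_delta.
- by rewrite loop_actK ?tr_delta // Kv linearZ.
- by rewrite actd_loopE ?tr_delta // dv linearZ /= -scalerDl intrD addrC.
Qed.


(** The sum of the fundamental coweights. *)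
Definition principal_row : 'rV[F]_p := traceless_part (\row_j - j%:R).

(** The principal grading, for which the vectors of positive degree in the
    affine algebra are the positive root vectors: the matrix unit at (i, j)
    times t^m has degree p m + (j - i), and |j - i| < p. *)
Definition principal : {linear V -> V} :=
  p%:R \*: actd M \+ loop M (diag_mx principal_row) 0.

Lemma principalE v :
  principal v = p%:R *: actd M v + loop M (diag_mx principal_row) 0 v.
Proof. by []. Qed.

Lemma principal_delta (i j : 'I_p) m v : i != j ->
  principal (loop M (delta_mx i j) m v) =
  loop M (delta_mx i j) m (principal v) +
  (p%:Z * m + (j%:Z - i%:Z))%:~R *: loop M (delta_mx i j) m v.
Proof.
move=> nij; rewrite !principalE loop_diag_delta ?traceless_part_sum //.
rewrite actd_loopE ?tr_delta // scalerDr [loop M _ m (_ + _)]linearD [loop M _ m (_ *: _)]linearZ addrACA /=.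
congr (_ + _); rewrite scalerA -scalerDl; congr (_ *: _).
rewrite !mxE rmorphD rmorphM rmorphB /= -!pmulrn; ring.
Qed.

Lemma principal_diag h m v : \sum_j h 0 j = 0 ->
  principal (loop M (diag_mx h) m v) =
  loop M (diag_mx h) m (principal v) +
  (p%:Z * m)%:~R *: loop M (diag_mx h) m v.
Proof.
move=> h0; rewrite !principalE loop_diag_diag ?traceless_part_sum //.
rewrite actd_loopE ?tr_diag_row // scalerDr [loop M _ m (_ + _)]linearD [loop M _ m (_ *: _)]linearZ addrAC /=.
by rewrite rmorphM /= -scalerA -!pmulrn.
Qed.

Lemma principal_weight mu k n v : weight_space M mu k n v ->
  principal v = (p%:R * n%:~R + dot mu principal_row) *: v.
Proof.
move=> [Hv Kv dv]; rewrite principalE Hv ?traceless_part_sum // dv.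
by rewrite scalerA scalerDl.
Qed.

Inductive lower_span (w : V) : V -> Prop :=
| lower_span_top : lower_span w w
| lower_span0 : lower_span w 0
| lower_span_lin x u v : lower_span w u -> lower_span w v ->
    lower_span w (x *: u + v)
| lower_span_loop a m v : \tr a = 0 ->
    m < 0 \/ m = 0 /\ (forall i j : 'I_p, (i <= j)%N -> a i j = 0) ->
    lower_span w v -> lower_span w (loop M a m v).

Lemma lower_span_linsub w : linsub (lower_span w).
Proof. by split=> *; [exact: lower_span0 | exact: lower_span_lin]. Qed.

(** This replaces the Poincare-Birkhoff-Witt theorem: commuting any operator
    past a lowering one leaves a bracket, to which the same induction applies,
    and a highest weight vector absorbs the rest. *)
Lemma lower_span_stable mu k n w : highest_weight_vector M mu k n w ->
  forall u, lower_span w u ->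
  [/\ forall a m, \tr a = 0 -> lower_span w (loop M a m u),
      lower_span w (actK M u) & lower_span w (actd M u)].
Proof.
have sub := lower_span_linsub w.
move=> [_ [Hw Kw dw] wpos wup] u; elim=> {u}[||x u v _ [uL uK ud] _ [vL vK vd]|].
- split=> [a m ta||]; last 2 first.
  + by rewrite Kw; apply: linsubZ => //; exact: lower_span_top.
  + by rewrite dw; apply: linsubZ => //; exact: lower_span_top.
  have [m0|m0|->] := ltgtP m 0.
  + by apply: lower_span_loop => //; [left | exact: lower_span_top].
  + by rewrite wpos //; exact: lower_span0.
  apply: loop_decomp => // [i j nij _|].
    have [ij|ji|E] := ltngtP i j; last by move: nij; rewrite (ord_inj E) eqxx.
      rewrite wup; first exact: lower_span0.
      move=> i' j' le; rewrite mxE; case: eqP => //= E1; case: eqP => //= E2.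
      by move: le; rewrite E1 E2 leqNgt ij.
    apply: lower_span_loop; first exact: tr_delta; last exact: lower_span_top.
    right; split=> // i' j' le; rewrite mxE; case: eqP => //= E1.
    by case: eqP => //= E2; move: le; rewrite E1 E2 leqNgt ji.
  rewrite Hw; first by apply: linsubZ => //; exact: lower_span_top.
  by rewrite -[RHS]ta; apply: eq_bigr => i _; rewrite mxE.
- by split=> *; rewrite linear0; exact: lower_span0.
- split=> [a m ta||]; rewrite linearP; apply: lower_span_lin => //.
  + exact: uL.
  + exact: vL.
move=> a m v ta low_am _ [vL vK vd]; split=> [b n' tb||].
- rewrite -[loop M b _ _](subrK (loop M a m (loop M b n' v))).
  rewrite loop_bracket //; apply: linsubD => //; last first.
    by apply: lower_span_loop => //; exact: vL.
  apply: linsubD => //; first by apply: vL; exact: tr_comm.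
  exact: linsubZ.
- by rewrite loop_actK //; exact: lower_span_loop.
rewrite actd_loopE //; apply: linsubD => //; first exact: lower_span_loop.
by apply: linsubZ => //; exact: vL.
Qed.

Lemma lower_span_eig c w u : principal w = c *: w -> lower_span w u ->
  eig_sum principal [set x | exists k : nat, x = c - k%:R] u.
Proof.
move=> wc; set P := [set x | _]; have sub := eig_sum_linsub principal P.
elim=> {u}[||x u v _ Pu _ Pv|a m v ta low_am _ Pv].
- by apply: eig_sum_eigen wc _; exists 0%N; rewrite subr0.
- by case: sub.
- by case: sub => _; apply.
have shift (z : int) : z <= 0 -> forall x, P x -> P (x + z%:~R).
  case: z => [[|//]|z] _ x [k ->]; first by exists k; rewrite addr0.
  by exists (k + z.+1)%N; rewrite NegzE rmorphN /= natrD opprD addrA -pmulrn.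
apply: loop_decomp => // [i j nij aij|].
  have [] := (ltn_ord i, ltn_ord j) => lti ltj.
  apply: (eig_sum_shift (fun v => principal_delta m v nij)) => //.
  apply: shift; case: low_am => [m0|[-> low]]; first by nia.
  have [ij|ji|E] := ltngtP i j.
  - by move: aij; rewrite low ?eqxx // ltnW.
  - by lia.
  - by move: nij; rewrite (ord_inj E) eqxx.
case: low_am => [m0|[_ low]].
  have h0 : \sum_j (\row_i a i i) 0 j = 0.
    by rewrite -[RHS]ta; apply: eq_bigr => i _; rewrite mxE.
  apply: (eig_sum_shift (fun v => principal_diag m v h0)) => //.
  by apply: shift; nia.
suff -> : \row_i a i i = 0 by rewrite linear0 loop0; case: sub.
by apply/rowP=> i; rewrite !mxE low.
Qed.

(** Everything generated by a highest weight vector has at most its principal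
    degree, so in an irreducible representation no weight vector lies above. *)
Lemma no_vector_above mu k n w mu' k' n' v (l : nat) : irreducible_rep M ->
  highest_weight_vector M mu k n w -> weight_space M mu' k' n' v ->
  p%:R * n'%:~R + dot mu' principal_row =
    p%:R * n%:~R + dot mu principal_row + l.+1%:R ->
  v = 0.
Proof.
move=> [_ irr] hw vwt above.
have stab := lower_span_stable hw; have [w0 wwt _ _] := hw.
have := irr (lower_span w) (lower_span0 _) (@lower_span_lin w).
case=> [a m u ta /stab[+ _ _]|u /stab[_ + _]|u /stab[_ _ +]|E|E] //.
- by move/(_ a m ta).
- by have : lower_span w w by [exact: lower_span_top]; rewrite E.
have : lower_span w v by rewrite E.
move/(lower_span_eig (principal_weight wwt))/eig_sum_disjoint.
move/(_ _ (principal_weight vwt)); apply=> -[j] /eqP.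
rewrite above -subr_eq0 opprB [X in X == _](_ : _ = (l.+1 + j)%:R).
  by rewrite pnatr_eq0.
by rewrite natrD; ring.
Qed.

End HighestWeight.

(** * Integrability and simple reflections *)

Lemma diag_mx_delta (F : fieldType) (p : nat) (i : 'I_p) :
  diag_mx (delta_mx 0 i) = delta_mx i i :> 'M[F]_p.
Proof.
apply/matrixP=> x y; rewrite !mxE eqxx /=.
case: (x =P y) => [<-|nyx]; first by rewrite andbb mulr1n.
rewrite mulr0n.
by case: (x =P i) => // Ex; case: (y =P i) => // Ey; case: nyx; rewrite Ex Ey.
Qed.

Section Integrable.
Variables (F : numFieldType) (p : nat) (V : lmodType F) (M : affine_rep p V).
Implicit Types (a b : 'M[F]_p) (m n : int) (v w : V) (W : set V).
Implicit Types (mu h : 'rV[F]_p) (k : int).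
Variables (i j : 'I_p).
Hypothesis ij : j = i.+1 :> nat.

Let nij : i != j.
Proof. by apply/eqP=> E; move: ij; rewrite E => /n_Sn. Qed.
Let nji : j != i. Proof. by rewrite eq_sym nij. Qed.

Definition simple_root : 'rV[F]_p := delta_mx 0 i - delta_mx 0 j.

Let e := loop M (delta_mx i j) 0.
Let f := loop M (delta_mx j i) 0.

Lemma simple_e mu k n z v : weight_space M (mu + z%:~R *: simple_root) k n v ->
  weight_space M (mu + (z + 1)%:~R *: simple_root) k n (e v).
Proof.
move=> /(weight_space_delta 0 nij); rewrite add0r.
by rewrite intrD scalerDl scale1r [mu + (_ + _)]addrA.
Qed.

Lemma simple_f mu k n z v : weight_space M (mu + z%:~R *: simple_root) k n v ->
  weight_space M (mu + (z - 1)%:~R *: simple_root) k n (f v).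
Proof.
move=> /(weight_space_delta 0 nji); rewrite add0r.
by rewrite intrB scalerBl scale1r [mu + (_ + _)]addrA opprB.
Qed.

Lemma simple_h mu k n z v :
  weight_space M (mu + z%:~R *: simple_root) k n v ->
  e (f v) - f (e v) = ((mu 0 i - mu 0 j) + 2 * z%:~R) *: v.
Proof.
case=> Hv _ _; rewrite /e /f loop_bracket ?tr_delta // mul0r !scale0r ?if_same ?scale0r !addr0.
have -> : delta_mx i j *m delta_mx j i - delta_mx j i *m delta_mx i j =
    diag_mx (simple_root : 'rV[F]_p).
  by rewrite !mul_delta_mx linearB /= !diag_mx_delta.
have dotr : dot (simple_root : 'rV[F]_p) simple_root = 2.
  rewrite dotDl dotNl !dot_delta !mxE !eqxx (negPf nij) (negPf nji) /=; ring.
rewrite Hv.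
  rewrite dotDl; congr ((_ + _) *: _).
    rewrite /dot -[_ *m _]trmxK mxtrace_tr trmx_mul trmxK -/(dot _ _).
    by rewrite dotDl dotNl !dot_delta.
  by rewrite /dot -scalemxAl linearZ /= -/(dot _ _) dotr mulrC.
rewrite (bigD1 i) //= (bigD1 j) //= big1 ?addr0; last first.
  by move=> x /andP[xi xj]; rewrite !mxE (negPf xi) (negPf xj) subr0.
by rewrite !mxE !eqxx (negPf nij) (negPf nji) /= subr0 sub0r subrr.
Qed.

(** The vector f_i^(l+1) v0 is killed by e_i by the computation in sl_2, and by
    the other raising operators because brackets with f_i preserve their span.
    If it were nonzero it would be a second highest weight vector, with v0
    above it. *)
Lemma simple_f_vanishes mu k n v0 (l : nat) : irreducible_rep M ->
  highest_weight_vector M mu k n v0 -> mu 0 i - mu 0 j = l%:R ->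
  iter l.+1 f v0 = 0.
Proof.
move=> irr hw mul; have [v00 v0wt pos up] := hw.
have e0 : e v0 = 0.
  apply: up => i' j' le; rewrite mxE; case: eqP => //= E1; case: eqP => //= E2.
  by move: le; rewrite E1 E2 ij ltnn.
have v0wt' : weight_space M (mu + 0%:~R *: simple_root) k n v0.
  by rewrite scale0r addr0.
have W_h z v : weight_space M (mu + z%:~R *: simple_root) k n v ->
    e (f v) - f (e v) = (l%:R + 2 * z%:~R) *: v.
  by move/simple_h; rewrite mul.
have W_sub z : linsub (weight_space M (mu + z%:~R *: simple_root) k n).
  exact: weight_space_linsub.
have wwt := sl2_iter_f (@simple_f mu k n) l.+1 v0wt'.
have ew : e (iter l.+1 f v0) = 0.
  rewrite (sl2_e_iter_f (@simple_f mu k n) W_h _ v0wt' e0).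
  by rewrite mulr0 addr0 subrr mulr0 scale0r.
pose up_i a := forall i' j' : 'I_p, ((j' <= i')%N || (i' == i) && (j' == j)) ->
  a i' j' = 0.
have others N : forall a m, \tr a = 0 -> 0 < m \/ m = 0 /\ up_i a ->
    loop M a m (iter N f v0) = 0.
  elim: N => [|N IH] a m ta am /=.
    case: am => [m0|[-> ua]]; first exact: pos.
    by apply: up => i' j' le; apply: ua; rewrite le.
  have /eqP := loop_bracket M m 0 (iter N f v0) ta (tr_delta F nji).
  rewrite -/f addr0 IH // linear0 subr0 => /eqP ->.
  rewrite IH ?tr_comm // ?add0r.
    case: eqP => [->|_]; first by rewrite mul0r scale0r.
    by rewrite scale0r.
  case: am => [|[-> ua]]; [by left|right; split=> // i' j' H].
  rewrite !mxE (bigD1 j) //= big1 ?addr0; last first.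
    by move=> x xj; rewrite mxE (negPf xj) mulr0.
  rewrite (bigD1 i) //= big1 ?addr0; last first.
    by move=> x xi; rewrite mxE (negPf xi) andbF mul0r.
  rewrite !mxE !eqxx andbT /=.
  have -> : a i' j * (j' == i)%:R = 0.
    case: (j' =P i) => [E|_]; last by rewrite mulr0.
    rewrite mulr1; apply: ua; case/orP: H => [le|/andP[/eqP-> _]].
      by move: le; rewrite E leq_eqVlt => /orP[/eqP/ord_inj->|lt];
        rewrite ?eqxx ?orbT // ij lt.
    by rewrite !eqxx orbT.
  have -> : (i' == j)%:R * a i j' = 0.
    case: (i' =P j) => [E|_]; last by rewrite mul0r.
    rewrite mul1r; apply: ua; case/orP: H => [le|/andP[/eqP Ei _]].
      move: le; rewrite E leq_eqVlt => /orP[/eqP/ord_inj->|].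
        by rewrite !eqxx orbT.
      by rewrite ij ltnS => ->.
    by move: nij; rewrite -Ei E eqxx.
  by rewrite subrr.
apply: contrapT => /eqP w0.
suff hw' : highest_weight_vector M (mu + (0 - l.+1%:Z)%:~R *: simple_root) k n
    (iter l.+1 f v0).
  apply: v00; apply: (no_vector_above (l := l) irr hw' v0wt).
  rewrite dotDl -!addrA; congr (_ + _).
  rewrite -[LHS]addr0; congr (_ + _).
  rewrite /dot -scalemxAl linearZ /= -/(dot _ _) dotDl dotNl !dot_delta !mxE ij.
  rewrite sub0r rmorphN /= -pmulrn -!natr1; ring.
split=> //; first exact/eqP.
  by move=> a m ta m0; apply: others => //; left.
move=> a ua.
have ta : \tr a = 0 by rewrite /mxtrace big1 // => x _; exact: ua.
have td := tr_delta F nij.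
rewrite -[a](subrK (a i j *: delta_mx i j)).
have tad : \tr (a i j *: delta_mx i j : 'M[F]_p) = 0.
  by rewrite linearZ /= td mulr0.
rewrite loopD //; last by rewrite linearB /= ta tad subr0.
rewrite loopZ // -/e ew scaler0 addr0 others //.
  by rewrite linearB /= ta tad subr0.
right; split=> // i' j'; rewrite !mxE => /orP[le|/andP[/eqP-> /eqP->]].
  rewrite (ua _ _ le); case: (i' =P i) => [E|_]; case: (j' =P j) => [E'|_];
    rewrite ?mulr0 ?subr0 //.
  by move: le; rewrite E E' ij ltnn.
by rewrite !eqxx mulr1 subrr.
Qed.

Lemma iter_delta_nil (x y : 'I_p) : x != y ->
  (delta_mx x y : 'M[F]_p) *m delta_mx x y = 0.
Proof. by move=> nxy; rewrite mul_delta_mx_cond eq_sym (negPf nxy). Qed.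

(** Both e_i and f_i are locally nilpotent, so f_i^l maps the weight space
    isomorphically to the reflected one. *)
Lemma simple_reflection_dim mu0 k0 n0 v0 (l0 : nat) mu k n (l : nat) d :
  irreducible_rep M -> highest_weight_vector M mu0 k0 n0 v0 ->
  mu0 0 i - mu0 0 j = l0%:R -> mu 0 i - mu 0 j = l%:R ->
  has_dim (weight_space M mu k n) d <->
  has_dim (weight_space M (mu - l%:R *: simple_root) k n) d.
Proof.
move=> irr hw mu0l mul; have [v00 v0wt pos up] := hw.
have f_nil := square0_locally_nilpotent irr (tr_delta F nji)
  (iter_delta_nil nji) v00 (simple_f_vanishes irr hw mu0l).
have e_nil : forall v, exists N, iter N e v = 0.
  apply: (square0_locally_nilpotent (k0 := 1) irr (tr_delta F nij)
    (iter_delta_nil nij) v00).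
  apply: up => i' j' le; rewrite mxE; case: eqP => //= E1; case: eqP => //= E2.
  by move: le; rewrite E1 E2 ij ltnn.
pose W z := weight_space M (mu + z%:~R *: simple_root) k n.
pose W' z := weight_space M (mu + (- l%:Z - z)%:~R *: simple_root) k n.
have W_h z v : W z v -> e (f v) - f (e v) = (l%:R + 2 * z%:~R) *: v.
  by move/simple_h; rewrite mul.
have W'_h z v : W' z v -> f (e v) - e (f v) = (l%:R + 2 * z%:~R) *: v.
  move/simple_h; rewrite mul => /(congr1 -%R); rewrite opprB => ->.
  by rewrite -scaleNr; congr (_ *: _); rewrite rmorphB rmorphN /= -pmulrn; ring.
have W_sub z : linsub (W z) by exact: weight_space_linsub.
have W'_sub z : linsub (W' z) by exact: weight_space_linsub.
have W'_e z v : W' z v -> W' (z - 1) (e v).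
  by move/simple_e; rewrite /W' opprB addrA addrAC.
have W'_f z v : W' z v -> W' (z + 1) (f v).
  by move/simple_f; rewrite /W' opprD addrA.
have EW : weight_space M mu k n = W 0 by rewrite /W scale0r addr0.
have EW' : weight_space M (mu - l%:R *: simple_root) k n = W' 0.
  by rewrite /W' subr0 rmorphN /= -pmulrn scaleNr.
have EWl : W (- l%:Z) = W' 0 by rewrite /W' subr0.
have EWl' : W' (- l%:Z) = W 0 by rewrite /W' subrr.
have lin_iter (g : {linear V -> V}) N : exists g' : {linear V -> V},
    forall v, g' v = iter N g v.
  elim: N => [|N [g' IH]]; first by exists idfun.
  by exists (g \o g') => v /=; rewrite IH.
have [gf gfE] := lin_iter f l; have [ge geE] := lin_iter e l.
rewrite EW EW'; split.
  apply: (has_dim_bij (phi := gf)) => // [v Wv|v Wv|w Ww].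
  - by rewrite gfE -EWl -[- _]add0r; apply: sl2_iter_f Wv; exact: simple_f.
  - rewrite gfE; have [N eN] := e_nil v.
    by apply: (sl2_inj W_sub _ _ W_h Wv eN) => // z u; [exact: simple_e|exact: simple_f].
  have [N fN] := f_nil w.
  have [y Wy Ey] := sl2_surj W'_sub W'_f W'_e W'_h Ww fN.
  by exists y; rewrite -?EWl' // gfE.
apply: (has_dim_bij (phi := ge)) => // [v Wv|v Wv|w Ww].
- by rewrite geE -EWl' -[- _]add0r; apply: sl2_iter_f Wv; exact: W'_e.
- rewrite geE; have [N eN] := f_nil v.
  by apply: (sl2_inj W'_sub W'_f W'_e W'_h Wv eN).
have [N eN] := e_nil w.
have [y Wy Ey] := sl2_surj W_sub (@simple_e mu k n) (@simple_f mu k n) W_h Ww eN.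
by exists y; rewrite -?EWl // geE.
Qed.

End Integrable.

(** The root vectors change the o-th coordinate of a weight by an integer, so
    the weights for which this coordinate lies in a fixed class modulo 1 span a
    subrepresentation. *)
Lemma weight_class (F : numFieldType) (p : nat) (V : lmodType F)
    (M : affine_rep p V) (mu0 mu : 'rV[F]_p) (k0 n0 k n : int) (v0 v : V)
    (o : 'I_p) :
  irreducible_rep M -> highest_weight_vector M mu0 k0 n0 v0 ->
  \sum_j mu0 0 j = 0 -> \sum_j mu 0 j = 0 ->
  weight_space M mu k n v -> v <> 0 -> exists z : int, mu 0 o - mu0 0 o = z%:~R.
Proof.
move=> [_ irr] [v00 [Hv0 _ _] _ _] smu0 smu [Hv _ _] v_neq0.
pose h : 'rV[F]_p := traceless_part (delta_mx 0 o).
have h0 : \sum_j h 0 j = 0 by exact: traceless_part_sum.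
have doth (nu : 'rV[F]_p) : \sum_j nu 0 j = 0 -> dot nu h = nu 0 o.
  exact: dot_traceless_delta.
pose D := loop M (diag_mx h) 0.
pose P : set F := [set c | exists z : int, c = mu0 0 o + z%:~R].
have sub := eig_sum_linsub D P.
have shift (x : F) : (exists z : int, x = z%:~R) -> forall c, P c -> P (c + x).
  by move=> [z ->] c [z' ->]; exists (z' + z); rewrite rmorphD addrA.
have stable : eig_sum D P = [set 0] \/ eig_sum D P = setT.
  apply: irr; [by case: sub|by case: sub|move=> a m w ta Ww|move=> w|move=> w].
  - apply: loop_decomp => // [i j nij _|].
      apply: (eig_sum_shift (fun v => loop_diag_delta M m v h0 nij)) Ww.
      apply: shift; rewrite !mxE !eqxx /=; exists ((i == o)%:R - (j == o)%:R).
      by rewrite rmorphB /= !mulrz_nat; ring.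
    have s0 : \sum_j (\row_i a i i) 0 j = 0.
      by rewrite -[RHS]ta; apply: eq_bigr => i _; rewrite mxE.
    apply: (eig_sum_shift (k := 0)) Ww => [u|c]; last by rewrite addr0.
    by rewrite scale0r addr0; exact: loop_diag_diag.
  - apply: (eig_sum_shift (k := 0)) => [u|c]; last by rewrite addr0.
    by rewrite scale0r addr0 /D loop_actK // tr_diag_row.
  - apply: (eig_sum_shift (k := 0)) => [u|c]; last by rewrite addr0.
    by rewrite scale0r addr0 /D actd_loop0 // tr_diag_row.
have Wv0 : eig_sum D P v0.
  by apply: eig_sum_eigen (Hv0 _ h0) _; exists 0; rewrite doth // addr0.
case: stable => [E|E]; first by move: Wv0; rewrite E.
apply: contrapT => nz; apply: v_neq0.
have : eig_sum D P v by rewrite E.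
move/eig_sum_disjoint/(_ (Hv _ h0)); apply => -[z]; rewrite doth // => Ez.
by apply: nz; exists z; rewrite Ez addrC addKr.
Qed.

(** * Twisted representations *)

Section PermTwist.
Variables (F : numFieldType) (p : nat) (V : lmodType F) (M : affine_rep p V).
Variable g : {perm 'I_p}.
Implicit Types (a b : 'M[F]_p) (m n : int) (v : V).

Lemma mxsub_mul a b : mxsub g g (a *m b) = mxsub g g a *m mxsub g g b.
Proof.
apply/matrixP=> i j; rewrite !mxE (reindex_inj (@perm_inj _ g)) /=.
by apply: eq_bigr => x _; rewrite !mxE.
Qed.

Lemma mxsub_tr a : \tr (mxsub g g a) = \tr a.
Proof.
rewrite /mxtrace [RHS](reindex_inj (@perm_inj _ g)) /=.
by apply: eq_bigr => x _; rewrite !mxE.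
Qed.

Lemma mxsub_diag (h : 'rV[F]_p) :
  mxsub g g (diag_mx h) = diag_mx (\row_j h 0 (g j)).
Proof. by apply/matrixP=> i j; rewrite !mxE (inj_eq (@perm_inj _ g)). Qed.

Lemma perm_loop_linear x a b m v : \tr a = 0 -> \tr b = 0 ->
  loop M (mxsub g g (x *: a + b)) m v =
  x *: loop M (mxsub g g a) m v + loop M (mxsub g g b) m v.
Proof.
move=> ta tb; rewrite -loop_linear ?mxsub_tr //; congr (loop M _ m v).
by apply/matrixP=> i j; rewrite !mxE.
Qed.

Lemma perm_loop_bracket a b m n v : \tr a = 0 -> \tr b = 0 ->
  loop M (mxsub g g a) m (loop M (mxsub g g b) n v) -
    loop M (mxsub g g b) n (loop M (mxsub g g a) m v) =
  loop M (mxsub g g (a *m b - b *m a)) (m + n) v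
  + (if m + n == 0 then m%:~R * \tr (a *m b) else 0) *: actK M v.
Proof.
move=> ta tb; rewrite loop_bracket ?mxsub_tr // -!mxsub_mul mxsub_tr.
congr (loop M _ _ _ + _); by apply/matrixP=> i j; rewrite !mxE.
Qed.

Lemma perm_loop_actK a m v : \tr a = 0 ->
  actK M (loop M (mxsub g g a) m v) = loop M (mxsub g g a) m (actK M v).
Proof. by move=> ta; rewrite loop_actK ?mxsub_tr. Qed.

Lemma perm_actd_loop a m v : \tr a = 0 ->
  actd M (loop M (mxsub g g a) m v) - loop M (mxsub g g a) m (actd M v) =
  m%:~R *: loop M (mxsub g g a) m v.
Proof. by move=> ta; rewrite actd_loop ?mxsub_tr. Qed.

(** Conjugation by a permutation matrix realizes the permutations of the
    coordinates of the weights. *)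
Definition perm_twist : affine_rep p V :=
  AffineRep perm_loop_linear perm_loop_bracket perm_loop_actK
    (actd_actK M) perm_actd_loop.

Lemma perm_twist_weight (mu : 'rV[F]_p) k n :
  weight_space perm_twist mu k n =
  weight_space M (\row_j mu 0 (g j)) k n.
Proof.
have sum_g (h : 'rV[F]_p) : \sum_j (\row_j h 0 (g j)) 0 j = \sum_j h 0 j :> F.
  by rewrite [RHS](reindex_inj (@perm_inj _ g)); apply: eq_bigr => i _; rewrite mxE.
have dot_g (h : 'rV[F]_p) :
    dot (\row_j mu 0 (g j)) (\row_j h 0 (g j)) = dot mu h.
  rewrite !dotE [RHS](reindex_inj (@perm_inj _ g)); apply: eq_bigr => i _.
  by rewrite !mxE.
apply/seteqP; split=> v [/= Hv Kv dv]; split=> // h h0.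
  pose h' : 'rV[F]_p := \row_j h 0 (g^-1%g j).
  have Eh : h = \row_j h' 0 (g j) by apply/rowP=> j; rewrite !mxE permK.
  have h'0 : \sum_j h' 0 j = 0.
    by rewrite -sum_g -[RHS]h0; apply: eq_bigr => j _; rewrite !mxE permK.
  by rewrite Eh dot_g -(Hv h') // mxsub_diag.
by rewrite /= mxsub_diag Hv ?sum_g // dot_g.
Qed.

Lemma perm_twist_irreducible : irreducible_rep M -> irreducible_rep perm_twist.
Proof.
move=> [V0 irr]; split=> // W W0 Wl Wloop WK Wd; apply: irr => // a m v ta Wv.
have -> : a = mxsub g g (mxsub g^-1%g g^-1%g a).
  by apply/matrixP=> i j; rewrite !mxE !permK.
apply: Wloop => //; rewrite -[RHS]ta /mxtrace.
rewrite [RHS](reindex_inj (@perm_inj _ g^-1%g)) /=.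
by apply: eq_bigr => x _; rewrite !mxE.
Qed.

End PermTwist.

Section SpectralFlow.
Variables (F : numFieldType) (p : nat) (V : lmodType F) (M : affine_rep p V).
Variables (o : 'I_p) (c : F).
Implicit Types (a b : 'M[F]_p) (m n : int) (v : V) (k : nat).

(** The component of degree k - 1 of a for the grading by the minuscule coweight
    at o; the degrees -1, 0, 1 are shifted by one to be natural numbers. *)
Definition piece k a : 'M[F]_p :=
  \matrix_(i, j) if ((i == o) + 1 == (j == o) + k)%N then a i j else 0.

Lemma piece_linear k x a b : piece k (x *: a + b) = x *: piece k a + piece k b.
Proof.
by apply/matrixP=> i j; rewrite !mxE; case: eqP => _ //; rewrite mulr0 addr0.
Qed.

Lemma piece1_tr a : \tr (piece 1 a) = \tr a.
Proof. by apply: eq_bigr => i _; rewrite mxE eqxx. Qed.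

Lemma piece_tr k a : k != 1%N -> \tr (piece k a) = 0.
Proof.
move=> k1; apply: big1 => i _; rewrite mxE eqn_add2l eq_sym (negPf k1) //.
Qed.

Lemma sum_if (b0 : bool) (f : 'I_p -> F) :
  (if b0 then \sum_x f x else 0) = \sum_x if b0 then f x else 0.
Proof. by case: b0 => //; rewrite big1. Qed.

Ltac piece_solve :=
  apply/matrixP; let i := fresh "i" in let j := fresh "j" in
  let x := fresh "x" in intros i j; rewrite !mxE ?sum_if -?big_split /=;
  first [apply: eq_bigr | apply: big1]; intros x _; rewrite !mxE;
  case: (i == o); case: (j == o); case: (x == o);
  rewrite /= ?(mul0r, mulr0, addr0, add0r).

Lemma piece0_mul a b :
  piece 0 (a *m b) = piece 1 a *m piece 0 b + piece 0 a *m piece 1 b.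
Proof. by piece_solve. Qed.

Lemma piece2_mul a b :
  piece 2 (a *m b) = piece 1 a *m piece 2 b + piece 2 a *m piece 1 b.
Proof. by piece_solve. Qed.

Lemma piece1_mul a b :
  piece 1 (a *m b) = piece 1 a *m piece 1 b +
    (piece 2 a *m piece 0 b + piece 0 a *m piece 2 b).
Proof. by piece_solve. Qed.

Lemma piece00 a b : piece 0 a *m piece 0 b = 0.
Proof. by piece_solve. Qed.

Lemma piece22 a b : piece 2 a *m piece 2 b = 0.
Proof. by piece_solve. Qed.

(** The part of this trace that is not symmetric in a and b is the diagonal
    entry at o of their bracket, which is why that entry multiplies K in
    flow_loop. *)
Lemma tr_piece20 a b : \tr (piece 2 a *m piece 0 b) =
  (a *m b) o o - a o o * b o o.
Proof.
rewrite mxE [in RHS](bigD1 o) //= [X in _ = X - _]addrC addrK.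
rewrite /mxtrace (bigD1 o) //= [X in _ + X]big1 ?addr0 => [|i /negPf io].
  rewrite mxE (bigD1 o) //= !mxE eqxx /= mul0r add0r; apply: eq_bigr => i.
  by move=> /negPf io; rewrite !mxE io eqxx.
rewrite mxE big1 // => x _; rewrite !mxE io.
by case: (x == o); rewrite /= mul0r.
Qed.

Lemma tr_piece_mul k l a b : (k + l != 2)%N ->
  \tr (piece k a *m piece l b) = 0.
Proof.
move=> kl; apply: big1 => i _; rewrite mxE; apply: big1 => x _; rewrite !mxE.
case: eqP => [E|]; case: eqP => [E'|]; rewrite ?(mul0r, mulr0) // => *.
by case/eqP: kl; lia.
Qed.

(** The image of a t^m: the power of t is shifted by the degree, and the term
    in K corrects the central part of the brackets. *)
Definition flow_loop a m : {linear V -> V} :=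
  loop M (piece 0 a) (m - 1) \+ loop M (piece 1 a) m \+
  loop M (piece 2 a) (m + 1) \+ ((if m == 0 then a o o else 0) \*: actK M).

Lemma flow_loopE a m v : flow_loop a m v =
  \sum_(k < 3) loop M (piece k a) (m + k%:Z - 1) v +
  (if m == 0 then a o o else 0) *: actK M v.
Proof.
rewrite !big_ord_recl big_ord0 addr0 /= /bump /= !addr0 !addrA; congr (_ + _).
by congr (_ + loop M _ _ _ + loop M _ _ _); lia.
Qed.

Lemma piece_tr0 k a : \tr a = 0 -> \tr (piece k a) = 0.
Proof.
by move=> ta; have [->|/piece_tr->//] := eqVneq k 1%N; rewrite piece1_tr.
Qed.

Lemma flow_loop_linear x a b m v : \tr a = 0 -> \tr b = 0 ->
  flow_loop (x *: a + b) m v = x *: flow_loop a m v + flow_loop b m v.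
Proof.
move=> ta tb; rewrite !flow_loopE scalerDr scaler_sumr addrACA -big_split /=.
congr (_ + _).
  by apply: eq_bigr => k _; rewrite piece_linear loop_linear ?piece_tr0.
by case: eqP => _; rewrite ?scale0r ?scaler0 ?addr0 // !mxE scalerDl scalerA.
Qed.

Lemma flow_loop_actK a m v : \tr a = 0 ->
  actK M (flow_loop a m v) = flow_loop a m (actK M v).
Proof.
move=> ta; rewrite !flow_loopE linearD linear_sum linearZ /=; congr (_ + _).
by apply: eq_bigr => k _; rewrite loop_actK ?piece_tr0.
Qed.

Lemma flow_loop_bracket a b m n v : \tr a = 0 -> \tr b = 0 ->
  flow_loop a m (flow_loop b n v) - flow_loop b n (flow_loop a m v) =
  flow_loop (a *m b - b *m a) (m + n) v
  + (if m + n == 0 then m%:~R * \tr (a *m b) else 0) *: actK M v.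
Proof.
move=> ta tb.
pose X k := loop M (piece k a) (m + k%:Z - 1).
pose Y k := loop M (piece k b) (n + k%:Z - 1).
have -> : flow_loop a m (flow_loop b n v) - flow_loop b n (flow_loop a m v) =
    \sum_(k < 3) \sum_(l < 3) (X k (Y l v) - Y l (X k v)).
  set z := if m == 0 then a o o else 0; set w := if n == 0 then b o o else 0.
  have flow2 (A B : nat -> {linear V -> V}) x y :
      (forall k v, actK M (B k v) = B k (actK M v)) ->
      \sum_(k < 3) A k (\sum_(l < 3) B l v + y *: actK M v) +
      x *: actK M (\sum_(l < 3) B l v + y *: actK M v) =
      \sum_(k < 3) \sum_(l < 3) A k (B l v) +
      (y *: \sum_(k < 3) A k (actK M v) + x *: (\sum_(l < 3) B l (actK M v)) +
       (x * y) *: actK M (actK M v)).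
    move=> BK; rewrite [actK M (_ + _)]linearD [actK M (y *: _)]linearZ /=.
    rewrite linear_sum scalerDr scalerA !addrA; congr (_ + _ + _); last first.
      by congr (_ *: _); apply: eq_bigr => l _.
    rewrite scaler_sumr -big_split; apply: eq_bigr => k _ /=.
    by rewrite linearD linearZ linear_sum.
  rewrite !flow_loopE -/z -/w (flow2 X Y) => [|k u]; last first.
    by rewrite loop_actK ?piece_tr0.
  rewrite (flow2 Y X) => [|k u]; last by rewrite loop_actK ?piece_tr0.
  rewrite [w * z]mulrC [z *: _ + w *: _]addrC opprD addrACA subrr addr0.
  rewrite [X in _ - X]exchange_big -sumrB; apply: eq_bigr => k _.
  by rewrite -sumrB.
have comm k l z : m + k%:Z - 1 + (n + l%:Z - 1) = z ->
    X k (Y l v) - Y l (X k v) =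
    loop M (piece k a *m piece l b - piece l b *m piece k a) z v +
    (if z == 0 then (m + k%:Z - 1)%:~R * \tr (piece k a *m piece l b) else 0)
      *: actK M v.
  by move=> <-; rewrite loop_bracket ?piece_tr0.
(* Only components of opposite degrees have a product of nonzero trace. *)
have comm0 k l z : m + k%:Z - 1 + (n + l%:Z - 1) = z -> (k + l != 2)%N ->
    X k (Y l v) - Y l (X k v) =
    loop M (piece k a *m piece l b - piece l b *m piece k a) z v.
  by move=> /comm-> kl; rewrite tr_piece_mul // mulr0 if_same scale0r addr0.
rewrite /flow_loop !big_ord_recl !big_ord0 !addr0 /= /bump /=.
rewrite (comm0 0%N 0%N (m + n - 2)) //; last by lia.
rewrite (comm0 0%N 1%N (m + n - 1)) //; last by lia.
rewrite (comm 0%N 2%N (m + n)); last by lia.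
rewrite (comm0 1%N 0%N (m + n - 1)) //; last by lia.
rewrite (comm 1%N 1%N (m + n)); last by lia.
rewrite (comm0 1%N 2%N (m + n + 1)) //; last by lia.
rewrite (comm 2%N 0%N (m + n)); last by lia.
rewrite (comm0 2%N 1%N (m + n + 1)) //; last by lia.
rewrite (comm0 2%N 2%N (m + n + 2)) //; last by lia.
rewrite !piece00 !piece22 !subrr !loop0 add0r addr0.
have pieceB k x y : piece k (x - y) = piece k x - piece k y.
  by rewrite addrC -scaleN1r piece_linear scaleN1r addrC.
have -> : piece 0 (a *m b - b *m a) =
    (piece 0 a *m piece 1 b - piece 1 b *m piece 0 a) +
    (piece 1 a *m piece 0 b - piece 0 b *m piece 1 a).
  by rewrite pieceB !piece0_mul [X in X - _]addrC opprD addrACA.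
have -> : piece 2 (a *m b - b *m a) =
    (piece 1 a *m piece 2 b - piece 2 b *m piece 1 a) +
    (piece 2 a *m piece 1 b - piece 1 b *m piece 2 a).
  by rewrite pieceB !piece2_mul [X in _ - X]addrC opprD addrACA.
have -> : piece 1 (a *m b - b *m a) =
    (piece 1 a *m piece 1 b - piece 1 b *m piece 1 a) +
    ((piece 2 a *m piece 0 b - piece 0 b *m piece 2 a) +
     (piece 0 a *m piece 2 b - piece 2 b *m piece 0 a)).
  rewrite pieceB !piece1_mul [X in _ - (_ + X)]addrC !opprD.
  by rewrite addrACA; congr (_ + _); rewrite addrACA.
rewrite -[RHS]addrA -[X in _ = _ + X]scalerDl.
have <- : (if m + n == 0 then (m + 0%Z - 1)%:~R * \tr (piece 0 a *m piece 2 b)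
      else 0) +
    (if m + n == 0 then (m + 1%Z - 1)%:~R * \tr (piece 1 a *m piece 1 b)
      else 0) +
    (if m + n == 0 then (m + 2%Z - 1)%:~R * \tr (piece 2 a *m piece 0 b)
      else 0) =
    (if m + n == 0 then (a *m b - b *m a) o o else 0) +
    (if m + n == 0 then m%:~R * \tr (a *m b) else 0).
  case: eqP => _; last by rewrite !addr0.
  have E0 : m + 0%Z - 1 = m - 1 by rewrite addr0.
  have E1 : m + 1%Z - 1 = m by rewrite addrK.
  have E2 : m + 2%Z - 1 = m + 1 by lia.
  rewrite E0 E1 E2 -[\tr (a *m b)]piece1_tr piece1_mul !linearD /=.
  have -> : \tr (piece 0 a *m piece 2 b) = (b *m a) o o - b o o * a o o.
    by rewrite mxtrace_mulC tr_piece20.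
  by rewrite tr_piece20 !mxE rmorphB rmorphD /= rmorph1; ring.
rewrite !scalerDl.
move: (tr_comm (piece 0 a) (piece 1 b)).
move: (piece 0 a *m piece 1 b - piece 1 b *m piece 0 a) => C01 t01.
move: (tr_comm (piece 1 a) (piece 0 b)).
move: (piece 1 a *m piece 0 b - piece 0 b *m piece 1 a) => C10 t10.
move: (tr_comm (piece 0 a) (piece 2 b)).
move: (piece 0 a *m piece 2 b - piece 2 b *m piece 0 a) => C02 t02.
move: (tr_comm (piece 1 a) (piece 1 b)).
move: (piece 1 a *m piece 1 b - piece 1 b *m piece 1 a) => C11 t11.
move: (tr_comm (piece 2 a) (piece 0 b)).
move: (piece 2 a *m piece 0 b - piece 0 b *m piece 2 a) => C20 t20.
move: (tr_comm (piece 1 a) (piece 2 b)).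
move: (piece 1 a *m piece 2 b - piece 2 b *m piece 1 a) => C12 t12.
move: (tr_comm (piece 2 a) (piece 1 b)).
move: (piece 2 a *m piece 1 b - piece 1 b *m piece 2 a) => C21 t21.
rewrite !loopD //; last by rewrite linearD /= t20 t02 addr0.
move: (_ *: actK M v) (_ *: actK M v) (_ *: actK M v) => k02 k11 k20.
move: (loop M C01 _ v) (loop M C10 _ v) (loop M C02 _ v) (loop M C11 _ v).
move: (loop M C20 _ v) (loop M C12 _ v) (loop M C21 _ v).
move=> A01 A02 A10 A11 A12 A20 A21.
by rewrite !addrA [LHS](ACl (1*4*5*8*2*7*10*3*6*9))%AC.
Qed.

Let h_o : 'rV[F]_p := traceless_part (delta_mx 0 o).

Lemma flow_coweight k a : diag_mx h_o *m piece k a - piece k a *m diag_mx h_o =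
  (k%:R - 1) *: piece k a.
Proof.
rewrite mul_diag_mx mul_mx_diag; apply/matrixP=> i j; rewrite !mxE !eqxx /=.
case: ifP => [/eqP E|_]; last by rewrite !(mulr0, mul0r) subr0.
rewrite [a i j * _]mulrC -mulrBl opprB addrA; congr (_ * _).
have := congr1 (fun x : nat => x%:R : F) E; rewrite !natrD => Ei.
have -> : k%:R = (i == o)%:R + 1 - (j == o)%:R :> F by rewrite Ei addrC addKr.
by ring.
Qed.

(** The constant c normalizes the eigenvalue of d on a chosen vector. *)
Definition flow_actd : {linear V -> V} :=
  actd M \- loop M (diag_mx h_o) 0 \+ (c \*: idfun).

Lemma flow_actdE v :
  flow_actd v = actd M v - loop M (diag_mx h_o) 0 v + c *: v.
Proof. by []. Qed.

Lemma flow_actd_actK v : actK M (flow_actd v) = flow_actd (actK M v).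
Proof.
rewrite !flow_actdE linearD linearB linearZ /= actd_actK loop_actK //.
by rewrite tr_diag_row traceless_part_sum.
Qed.

Lemma flow_actd_loop a m v : \tr a = 0 ->
  flow_actd (flow_loop a m v) - flow_loop a m (flow_actd v) =
  m%:~R *: flow_loop a m v.
Proof.
move=> ta; set z := if m == 0 then a o o else 0.
have th : \tr (diag_mx h_o) = 0 by rewrite tr_diag_row traceless_part_sum.
have comm (g : {linear V -> V}) u :
    flow_actd (g u) - g (flow_actd u) = (actd M (g u) - g (actd M u)) -
      (loop M (diag_mx h_o) 0 (g u) - g (loop M (diag_mx h_o) 0 u)).
  rewrite !flow_actdE [g (_ + _)]linearD [g (_ - _)]linearB [g (c *: _)]linearZ /=.
  by rewrite opprD addrACA subrr addr0 !opprD addrACA.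
rewrite !flow_loopE linearD linear_sum linearZ /= opprD addrACA -sumrB.
rewrite -scalerBr comm actd_actK loop_actK // !subrr scaler0 addr0.
rewrite scalerDr scaler_sumr scalerA.
have -> : m%:~R * z = 0.
  by rewrite /z; case: eqP => [->|_]; rewrite ?mul0r ?mulr0.
rewrite scale0r addr0; apply: eq_bigr => k _; have tk := piece_tr0 k ta.
rewrite comm actd_loop // loop0_bracket //.
rewrite [loop M _ _ (loop M _ _ _) + _]addrC addrK.
rewrite flow_coweight loopZ // -scalerBl; congr (_ *: _).
by rewrite rmorphB rmorphD /= -pmulrn; ring.
Qed.

(** The spectral flow by the minuscule coweight at o. It does not preserve the
    positive root vectors, but it does after a cyclic permutation of the
    coordinates, and the two together give the rotation of the affine Dynkin
    diagram. *)
Definition flow : affine_rep p V :=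
  AffineRep flow_loop_linear flow_loop_bracket flow_loop_actK
    flow_actd_actK flow_actd_loop.

Lemma flow_diag h v : flow_loop (diag_mx h) 0 v =
  loop M (diag_mx h) 0 v + h 0 o *: actK M v.
Proof.
rewrite /flow_loop /= ?mxE ?eqxx ?mulr1n; congr (_ + _).
have piece_diag k : piece k (diag_mx h) = if k == 1%N then diag_mx h else 0.
  apply/matrixP=> i j; rewrite !mxE; case: (i =P j) => [->|nij].
    by rewrite eqn_add2l eq_sym; case: eqP => _; rewrite !mxE ?eqxx.
  by rewrite mulr0n if_same; case: eqP; rewrite !mxE // (introF eqP nij).
by rewrite !piece_diag /= !loop0 add0r addr0.
Qed.

Lemma flow_weight (mu : 'rV[F]_p) (k n n' : int) : \sum_j mu 0 j = 0 ->
  n'%:~R = n%:~R - mu 0 o + c ->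
  weight_space flow (mu + k%:~R *: h_o) k n' = weight_space M mu k n.
Proof.
move=> smu En; have th : \sum_j h_o 0 j = 0 by exact: traceless_part_sum.
have dot_h (h : 'rV[F]_p) : \sum_j h 0 j = 0 -> dot h h_o = h 0 o.
  exact: dot_traceless_delta.
have E (h : 'rV[F]_p) v : \sum_j h 0 j = 0 -> actK M v = k%:~R *: v ->
    flow_loop (diag_mx h) 0 v = dot (mu + k%:~R *: h_o) h *: v <->
    loop M (diag_mx h) 0 v = dot mu h *: v.
  move=> sh Kv; rewrite flow_diag Kv dotDl scalerDl scalerA.
  have -> : dot (k%:~R *: h_o) h = h 0 o * k%:~R.
    by rewrite /dot -scalemxAl linearZ /= -/(dot _ _) dotC dot_h // mulrC.
  by split=> [/addIr|->].
apply/seteqP; split=> v [/= Hv Kv dv].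
  have Hv' (h : 'rV[F]_p) : \sum_j h 0 j = 0 -> loop M (diag_mx h) 0 v = dot mu h *: v.
    by move=> sh; apply/E => //; exact: Hv.
  split=> //; have -> : n%:~R = n'%:~R + mu 0 o - c by rewrite En; ring.
  have : flow_actd v = n'%:~R *: v by [].
  rewrite flow_actdE Hv' // dot_h // scalerBl scalerDl => <-.
  by rewrite [_ + mu 0 o *: v]addrAC subrK addrK.
split=> // [h sh|]; first by apply/E => //; exact: Hv.
rewrite [actd flow v]flow_actdE Hv // dot_h // dv En.
by rewrite scalerDl scalerBl.
Qed.

Lemma flow_irreducible : irreducible_rep M -> irreducible_rep flow.
Proof.
move=> [V0 irr]; split=> // W W0 Wl Wloop WK Wd.
have subW : linsub W by [].
have Wloop' a m v : \tr a = 0 -> W v -> W (loop M a m v).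
  move=> ta Wv.
  have WP k : (k < 3)%N -> W (loop M (piece k a) m v).
    move=> lt3; have := Wloop (piece k a) (m + 1 - k%:Z) v (piece_tr0 k ta) Wv.
    have pp l : piece l (piece k a) = if l == k then piece k a else 0.
      apply/matrixP=> i j; rewrite !mxE.
      case: (l =P k) => [->|lk]; rewrite !mxE; first by case: eqP.
      case: eqP => // E; case: eqP => // E'; case: lk; lia.
    move/linsubB=> /(_ _ subW) WB.
    set z := if m + 1 - k%:Z == 0 then piece k a o o else 0.
    have := WB (z *: actK M v) (linsubZ _ subW (WK _ Wv)).
    rewrite [loop flow _ _]/(flow_loop _ _) flow_loopE -/z addrK.
    rewrite (bigD1 (Ordinal lt3)) //= pp eqxx big1 ?addr0.
      by congr (W (loop M _ _ _)); lia.
    by move=> l; rewrite pp -val_eqE /= => /negPf->; rewrite loop0.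
  have -> : a = piece 0 a + (piece 1 a + piece 2 a).
    apply/matrixP=> i j; rewrite !mxE.
    by case: (i == o); case: (j == o); rewrite /= ?addr0 ?add0r.
  rewrite !loopD ?piece_tr0 ?linearD /= ?piece_tr0 ?addr0 //.
  by do 2?[apply: linsubD => //]; apply: WP.
apply: irr => // v Wv.
have -> : actd M v = flow_actd v + loop M (diag_mx h_o) 0 v - c *: v.
  by rewrite flow_actdE addrAC addrK subrK.
apply: linsubB => //; last exact: linsubZ.
apply: linsubD => //; first exact: Wd.
by apply: Wloop' => //; rewrite tr_diag_row traceless_part_sum.
Qed.

End SpectralFlow.

(** * The weight lattice *)

Section WeightLattice.
Variables (R : realType) (p : nat) (o : 'I_p).
Hypothesis o0 : o = 0%N :> nat.
Implicit Types (n : 'rV[int]_p) (x y : 'rV[R]_p).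

Let p_gt0 : (0 < p)%N. Proof. by case: (p) o => [[]|]. Qed.
Let p_neq0 : p%:R != 0 :> R. Proof. by rewrite pnatr_eq0 -lt0n. Qed.

Local Notation weight_lattice := (dual_lattice (root_lattice R p)).
Local Notation bar := (@bar R p).
Local Notation eps i := (@traceless_part R p (delta_mx 0 i)).

Lemma epsE (i j : 'I_p) : eps i 0 j = (j == i)%:R - p%:R^-1.
Proof.
rewrite !mxE /= (bigD1 i) //= big1 ?addr0 => [|k /negPf ki].
  by rewrite !mxE !eqxx mul1r.
by rewrite mxE ki andbF.
Qed.

Lemma barE n (x : 'I_p) :
  bar n 0 x = \sum_j (n 0 j)%:~R * ((x < j)%N%:R - j%:R / p%:R).
Proof. by rewrite /Defs.bar summxE; apply: eq_bigr => j _; rewrite !mxE. Qed.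

Lemma bar_add n n' : bar (n + n') = bar n + bar n'.
Proof.
apply/rowP=> x; rewrite mxE !barE -big_split /=; apply: eq_bigr => j _.
by rewrite mxE rmorphD mulrDl.
Qed.

Lemma level_add n n' : level (n + n') = level n + level n'.
Proof. by rewrite /level -big_split; apply: eq_bigr => j _; rewrite mxE. Qed.

Lemma sum_fundamental (j : 'I_p) :
  \sum_(x < p) ((x < j)%N%:R - j%:R / p%:R) = 0 :> R.
Proof.
rewrite sumrB sumr_const card_ord -[X in _ - X]mulr_natr divfK //.
rewrite -natr_sum; apply/eqP; rewrite subr_eq0 eqr_nat -big_mkcond /=.
rewrite -(big_ord_widen p (fun=> 1%N)) ?sum1_card ?card_ord //.
exact: ltnW.
Qed.

Lemma bar_sum n : \sum_x bar n 0 x = 0.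
Proof.
under eq_bigr => x _ do rewrite barE.
rewrite exchange_big big1 //= => j _.
by rewrite -mulr_sumr sum_fundamental mulr0.
Qed.

Lemma bar_label n (i j : 'I_p) : j = i.+1 :> nat ->
  bar n 0 i - bar n 0 j = (n 0 j)%:~R.
Proof.
move=> ij; rewrite !barE -sumrB (bigD1 j) //= big1 ?addr0 => [|k kj].
  rewrite ij ltnSn -ij ltnn mulr1n mulr0n; ring.
have -> : (i < k)%N = (j < k)%N.
  by have : k != j :> nat by []; rewrite ij; lia.
by rewrite subrr.
Qed.

Lemma row_const x : (forall i j : 'I_p, j = i.+1 :> nat -> x 0 i = x 0 j) ->
  forall j, x 0 j = x 0 o.
Proof.
move=> xS j; case: j => k; elim: k => [|k IH] lt_kp.
  by congr (x 0 _); apply: val_inj; rewrite /= o0.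
by rewrite -(IH (ltnW lt_kp)); apply: esym; exact: xS.
Qed.

Lemma row_eq0 x : \sum_j x 0 j = 0 ->
  (forall i j : 'I_p, j = i.+1 :> nat -> x 0 i = x 0 j) -> x = 0.
Proof.
move=> sx /row_const xc; apply/rowP=> j; rewrite mxE xc.
move: sx; under eq_bigr => i _ do rewrite xc.
rewrite sumr_const card_ord -mulr_natr => /eqP.
by rewrite mulf_eq0 (negPf p_neq0) orbF => /eqP.
Qed.

Lemma bar_inj n n' : level n = level n' -> bar n = bar n' -> n = n'.
Proof.
move=> El Eb.
have E j : j != o -> n 0 j = n' 0 j.
  move=> jo; have j0 : (0 < j)%N.
    by rewrite lt0n; apply: contraNneq jo => j0; apply/eqP/val_inj; rewrite /= o0.
  have lt : (j.-1 < p)%N by rewrite (leq_ltn_trans (leq_pred _)).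
  have ij : j = (Ordinal lt).+1 :> nat by rewrite /= prednK.
  by apply: (@intr_inj R); rewrite -!(bar_label _ ij) Eb.
apply/rowP=> j; have [->|/E//] := eqVneq j o.
move: El; rewrite /level (bigD1 o) //= [RHS](bigD1 o) //=.
by rewrite (eq_bigr (fun j => n' 0 j)) // => /addIr.
Qed.

(** Pairing with the roots e_i - e_j tests all differences of coordinates. *)
Lemma weight_latticeP x : weight_lattice x <->
  \sum_j x 0 j = 0 /\ forall i j, x 0 i - x 0 j \is a Num.int.
Proof.
split=> [[tx dx]|[sx dx]].
  split=> [|i j]; first exact: tx.
  have -> : x 0 i - x 0 j = dot x (delta_mx 0 i - delta_mx 0 j).
    by rewrite dotC dotDl dotNl !dot_delta.
  apply: dx; split=> [k|k]; last first.
    by rewrite !mxE rpredB // ?natr_int.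
  under eq_bigr => l _ do rewrite !mxE.
  rewrite sumrB (bigD1 i) //= big1 => [|l /negPf->]; last by rewrite andbF.
  rewrite (bigD1 j) //= [X in _ - (_ + X)]big1 => [|l /negPf->]; last by rewrite andbF.
  by rewrite !eqxx ord1 eqxx /= !addr0 subrr.
split=> [i|y [ty iy]]; first by rewrite ord1.
rewrite dotE; have -> : \sum_j x 0 j * y 0 j = \sum_j (x 0 j - x 0 o) * y 0 j.
  under [RHS]eq_bigr => j _ do rewrite mulrBl.
  by rewrite sumrB -mulr_sumr ty mulr0 subr0.
by apply: rpred_sum => j _; rewrite rpredM.
Qed.

Lemma bar_weight n : weight_lattice (bar n).
Proof.
apply/weight_latticeP; split=> [|i j]; first exact: bar_sum.
rewrite !barE -sumrB; apply: rpred_sum => k _; rewrite -mulrBr.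
rewrite opprB addrA subrK rpredM ?intr_int // rpredB //;
  exact: natr_int.
Qed.

Lemma weight_exists (k : int) x : weight_lattice x ->
  exists n, level n = k /\ bar n = x.
Proof.
move=> /weight_latticeP[sx dx].
pose lab (j : 'I_p) : int := Num.floor (x 0 (ord_pred j) - x 0 j).
pose n : 'rV[int]_p := \row_j
  if j == o then k - \sum_(i | i != o) lab i else lab j.
exists n; split.
  rewrite /level (bigD1 o) //= mxE eqxx.
  rewrite (eq_bigr lab) ?subrK // => j /negPf jo; by rewrite mxE jo.
apply/eqP; rewrite -subr_eq0; apply/eqP/row_eq0 => [|i j ij].
  under eq_bigr => j _ do rewrite !mxE.
  rewrite sumrB sx subr0 -[RHS](bar_sum n); apply: eq_bigr => j _.
  by rewrite /Defs.bar summxE.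
apply/eqP; rewrite -subr_eq0 ![(bar n - x) 0 _]mxE ![(- x) 0 _]mxE opprD addrACA.
rewrite (bar_label n ij) mxE.
have /negPf-> : j != o by apply: contra_eqN o0 => /eqP <-; rewrite ij.
rewrite /lab; have -> : ord_pred j = i :> 'I_p.
  apply: val_inj; rewrite /= ij addSn /=.
  by rewrite modnDr modn_small.
suff -> : (Num.floor (x 0 i - x 0 j))%:~R = x 0 i - x 0 j :> R.
  by rewrite -opprD subrr.
by apply/eqP; rewrite -intrEfloor.
Qed.

Lemma weight_ofP x : weight_lattice x ->
  level (weight_of x) = p%:Z /\ bar (weight_of x) = x.
Proof.
move=> /(weight_exists p%:Z) [n nP]; rewrite /weight_of.
by case: xgetP => [y _ //|/(_ n)]; case.
Qed.

Lemma weight_of_bar n : level n = p%:Z -> weight_of (bar n) = n.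
Proof.
move=> ln; have [El Eb] := weight_ofP (bar_weight n).
by apply: bar_inj => //; rewrite ln.
Qed.

(** Rotating the labels rotates the simple roots, hence the differences of
    coordinates, except for the one across the affine node, where the level
    enters. *)
Lemma bar_current n :
  bar (current 1 n) = (\row_j bar n 0 (ord_pred j)) + (level n)%:~R *: eps o.
Proof.
apply/rowP=> x; rewrite [RHS]mxE [X in X + _]mxE [X in _ + X]mxE epsE !barE.
rewrite /level rmorph_sum mulr_suml -big_split (reindex_inj (@ordS_inj p)) /=.
apply: eq_bigr => i _; rewrite mxE /= ordSK -mulrDr; congr (_ * _).
have predx : ((x + p).-1 %% p)%N = if x == o then p.-1 else x.-1.
  have xo : (x == o) = (x == 0%N :> nat) by rewrite -val_eqE /= o0.
  rewrite xo; case: x {xo} => [[|x] ltx] /=.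
    by rewrite modn_small // prednK.
  by rewrite modnDr modn_small // ltnW.
have xo : (x == o) = (x == 0%N :> nat) by rewrite -val_eqE /= o0.
rewrite predx xo; have [lt|ge] := ltnP i.+1 p.
  rewrite modn_small // -natr1 mulrDl mul1r opprD.
  have -> : (x < i.+1)%N%:R = ((if x == 0%N :> nat then p.-1 else x.-1) < i)%N%:R +
     (x == 0%N :> nat)%:R :> R.
    rewrite -natrD; congr (_%:R); case: eqP => [->|x0]; first by lia.
    by rewrite addn0; congr nat_of_bool; lia.
  by rewrite addrACA.
have -> : i.+1 = p by apply/eqP; rewrite eqn_leq ge ltn_ord.
rewrite modnn mul0r subr0 ltn0.
have Ei : p.-1 = i by have := ltn_ord i; lia.
have Ep : p%:R = i%:R + 1 :> R by rewrite natr1; congr (_%:R); have := ltn_ord i; lia.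
have ip : i%:R / p%:R = 1 - p%:R^-1 :> R.
  by rewrite -[X in _ = X - _](divff p_neq0) -[X in _ = _ - X]mul1r -mulrBl Ep addrK.
rewrite Ei; have [_|x0] := eqVneq (x : nat) 0%N.
  by rewrite ltnn ip mulr0n mulr1n; ring.
have -> : (x.-1 < i)%N by have := ltn_ord x; lia.
by rewrite ip mulr0n mulr1n; ring.
Qed.

Lemma currentD (a b : nat) n : current a (current b n) = current (b + a) n.
Proof. by apply/rowP=> j; rewrite !mxE iterD. Qed.

Lemma iter_ord_pred a (j : 'I_p) :
  iter a (@ord_pred p) j = ((j + a * p.-1) %% p)%N :> nat.
Proof.
elim: a => [|a IH]; first by rewrite mul0n addn0 modn_small.
rewrite iterS /= IH -subn1 -addnBA // subn1 modnDml mulSn.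
by rewrite -addnA [(_ * _ + _)%N]addnC.
Qed.

Lemma current_modn (a : nat) n : current (a %% p) n = current a n.
Proof.
apply/rowP=> j; rewrite !mxE; congr (n 0 _); apply: val_inj.
rewrite /= !iter_ord_pred; apply/eqP; rewrite eqn_modDl; apply/eqP.
by rewrite modnMml.
Qed.

Lemma level_current (a : nat) n : level (current a n) = level n.
Proof.
elim: a n => [|a IH] n.
  by congr level; apply/rowP=> j; rewrite mxE.
rewrite -add1n -currentD IH [LHS](reindex_inj (@ordS_inj p)) /=.
by apply: eq_bigr => j _; rewrite mxE /= ordSK.
Qed.

Lemma weight_lattice_perm x (g : {perm 'I_p}) : weight_lattice x ->
  weight_lattice (\row_j x 0 (g j)).
Proof.
move=> /weight_latticeP[sx dx]; apply/weight_latticeP; split=> [|i j].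
  by rewrite -[RHS]sx [RHS](reindex_inj (@perm_inj _ g)); apply: eq_bigr => j _; rewrite mxE.
by rewrite !mxE.
Qed.

Lemma root_weight x : root_lattice R p x -> weight_lattice x.
Proof.
move=> [tx ix]; apply/weight_latticeP; split=> [|i j]; first exact: tx.
exact: rpredB.
Qed.

Lemma weight_latticeD x y : weight_lattice x -> weight_lattice y ->
  weight_lattice (x + y).
Proof.
move=> /weight_latticeP[sx dx] /weight_latticeP[sy dy].
apply/weight_latticeP; split=> [|i j].
  by under eq_bigr => j _ do rewrite mxE; rewrite big_split /= sx sy addr0.
by rewrite !mxE opprD addrACA rpredD.
Qed.

End WeightLattice.

(** * Unconditional sums *)

Section HasSum.
Variables (K : numFieldType).
Implicit Types T : choiceType.

(** Convergence along the directed set of finite subsets. *)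
Definition tends T (f : {fset T} -> K) (s : K) : Prop :=
  forall eps : K, 0 < eps -> exists A : {fset T}, forall B : {fset T},
    (A `<=` B)%fset -> `|f B - s| < eps.

Definition has_sum T (f : T -> K) (s : K) : Prop :=
  tends (fun B => \sum_(x <- B) f x) s.

Definition abs_summable T (f : T -> K) : Prop :=
  exists b : K, forall A : {fset T}, \sum_(x <- A) `|f x| <= b.

Lemma has_sum_ext T (f g : T -> K) s : f =1 g -> has_sum f s -> has_sum g s.
Proof. by move=> /funext ->. Qed.

Lemma has_sum_unique T (f : T -> K) s t : has_sum f s -> has_sum f t -> s = t.
Proof.
move=> fs ft; apply/eqP; rewrite -subr_eq0 -normr_eq0; apply: contraT => nst.
have e0 : 0 < `|s - t| / 2 by rewrite divr_gt0 // lt_def nst normr_ge0.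
have [A Af] := fs _ e0; have [B Bf] := ft _ e0.
have hA := Af (A `|` B)%fset (fsubsetUl _ _).
have hB := Bf (A `|` B)%fset (fsubsetUr _ _).
have := ltrD hA hB; rewrite -splitr [X in X + _]distrC => /(le_lt_trans (ler_normD _ _)).
by rewrite addrA subrK ltxx.
Qed.

Lemma has_sum0 T : has_sum (fun _ : T => 0) 0.
Proof. by move=> e e0; exists fset0 => B _; rewrite big1 // subr0 normr0. Qed.

Lemma has_sumD T (f g : T -> K) s t : has_sum f s -> has_sum g t ->
  has_sum (fun x => f x + g x) (s + t).
Proof.
move=> fs gt e e0; have e20 : 0 < e / 2 by rewrite divr_gt0.
have [A Af] := fs _ e20; have [B Bg] := gt _ e20.
exists (A `|` B)%fset => C; rewrite fsubUset => /andP[/Af hA /Bg hB].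
rewrite big_split /= opprD addrACA [e]splitr.
exact: le_lt_trans (ler_normD _ _) (ltrD hA hB).
Qed.

Lemma has_sumZ T (f : T -> K) s a : has_sum f s -> has_sum (fun x => a * f x) (a * s).
Proof.
move=> fs e e0; have a1 : 0 < `|a| + 1 by rewrite ltr_wpDl.
have [|A Af] := fs (e / (`|a| + 1)); first by rewrite divr_gt0.
exists A => B /Af; rewrite -mulr_sumr -mulrBr normrM ltr_pdivlMr // => h.
by apply: le_lt_trans h; rewrite mulrC ler_wpM2l // lerDl ler01.
Qed.

Lemma has_sum_sum T (I : eqType) (r : seq I) (f : I -> T -> K) (s : I -> K) :
  (forall i, i \in r -> has_sum (f i) (s i)) ->
  has_sum (fun x => \sum_(i <- r) f i x) (\sum_(i <- r) s i).
Proof.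
elim: r => [_|i r IH fs].
  rewrite big_nil; apply: has_sum_ext (has_sum0 T) => x; by rewrite big_nil.
have fr : has_sum (fun x => \sum_(j <- r) f j x) (\sum_(j <- r) s j).
  by apply: IH => j jr; apply: fs; rewrite inE jr orbT.
rewrite big_cons; apply: has_sum_ext (has_sumD (fs i (mem_head _ _)) fr) => x.
by rewrite big_cons.
Qed.

Lemma has_sum_reindex T T' (h : T -> T') (h' : T' -> T) (f : T' -> K) s :
  cancel h h' -> cancel h' h -> has_sum (f \o h) s -> has_sum f s.
Proof.
move=> hK h'K fs e /fs[A Af]; exists [fset h x | x in A]%fset => B AB.
have := Af [fset h' x | x in B]%fset; rewrite big_imfset /=; last first.
  by move=> x y _ _ /(can_inj h'K).
under eq_bigr => x _ do rewrite h'K.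
apply; apply/fsubsetP => x xA; apply/imfsetP; exists (h x) => //=.
by apply: (fsubsetP AB); apply/imfsetP; exists x.
Qed.

Lemma abs_summable_le T (f g : T -> K) : abs_summable g ->
  (forall x, `|f x| <= `|g x|) -> abs_summable f.
Proof.
move=> [b gb] fg; exists b => A; apply: le_trans (gb A).
by apply: ler_sum => x _.
Qed.

Lemma abs_summableZ T (f : T -> K) a : abs_summable f ->
  abs_summable (fun x => a * f x).
Proof.
move=> [b fb]; exists (`|a| * b) => A.
under eq_bigr => x _ do rewrite normrM.
by rewrite -mulr_sumr ler_wpM2l.
Qed.

Lemma abs_summable_inj T T' (h : T -> T') (f : T' -> K) :
  injective h -> abs_summable f -> abs_summable (f \o h).
Proof.
move=> hI [b fb]; exists b => A; apply: le_trans (fb [fset h x | x in A]%fset).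
by rewrite big_imfset //= => x y _ _ /hI.
Qed.

(** Rectangles are cofinal among the finite sets of tuples, and a sum over a
    rectangle is a product of sums. *)
Lemma box_sum T (X : choiceType) (I : finType) (pr : X -> I -> T)
    (mk : (I -> T) -> X) (F : I -> T -> K) (A : {fset T}) :
  (forall x, mk (pr x) = x) -> (forall f i, pr (mk f) i = f i) ->
  exists B : {fset X}, (forall x, (forall i, pr x i \in A) -> x \in B) /\
    \sum_(x <- B) \prod_i F i (pr x i) = \prod_i \sum_(t <- A) F i t.
Proof.
move=> mkpr prmk.
have mk_ext f g : f =1 g -> mk f = mk g by move=> /funext ->.
pose box (f : {ffun I -> A}) := mk (fun i => val (f i)).
exists [fset box f | f in {: {ffun I -> A}}]%fset; split.
  move=> x xA; apply/imfsetP; exists [ffun i => [` xA i]%fset] => //=.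
  by rewrite -[LHS]mkpr; apply: mk_ext => i; rewrite ffunE.
rewrite big_imfset /=; last first.
  move=> f g _ _ E; apply/ffunP => i; apply: val_inj.
  have := congr1 (fun x => pr x i) E.
  by rewrite /box !prmk.
under eq_bigr => f _ do under eq_bigr => i _ do rewrite prmk.
under [RHS]eq_bigr => i _ do rewrite big_seq_fsetE /=.
rewrite bigA_distr_bigA /=; by rewrite big_enum_cond.
Qed.

Lemma sum_fset_le T (A B : {fset T}) (f : T -> K) : (A `<=` B)%fset ->
  (forall x, 0 <= f x) -> \sum_(x <- A) f x <= \sum_(x <- B) f x.
Proof.
move=> AB f0; rewrite [leRHS](big_fsetID _ (mem A)) /= -[leLHS]addr0.
apply: lerD; last by apply: sumr_ge0.
suff -> : [fset x in B | x \in A]%fset = A by [].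
apply/fsetP=> x; rewrite !inE /=.
by apply/andP/idP => [[]//|xA]; rewrite xA (fsubsetP AB).
Qed.

Lemma tendsM T (f g : {fset T} -> K) s t : tends f s -> tends g t ->
  tends (fun A => f A * g A) (s * t).
Proof.
move=> fs gt e e0.
have s1 : 0 < `|s| + 1 by rewrite ltr_wpDl.
have t1 : 0 < `|t| + 1 by rewrite ltr_wpDl.
have [|A Af] := fs (e / 2 / (`|t| + 1)); first by rewrite !divr_gt0.
have [|B Bg] := gt (e / 2 / (`|s| + 1)); first by rewrite !divr_gt0.
have [|C Cg] := gt 1; first exact: ltr01.
exists (A `|` B `|` C)%fset => D; rewrite !fsubUset -andbA.
move=> /and3P[/Af hA /Bg hB /Cg hC].
have -> : f D * g D - s * t = (f D - s) * g D + s * (g D - t) by ring.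
apply: le_lt_trans (ler_normD _ _) _; rewrite !normrM [e]splitr.
have gD : `|g D| <= `|t| + 1.
  rewrite -[g D](subrK t) addrC; apply: le_trans (ler_normD _ _) _.
  by rewrite lerD2l ltW.
apply: ltr_leD.
  apply: le_lt_trans (_ : `|f D - s| * (`|t| + 1) < _); last first.
    by rewrite -ltr_pdivlMr.
  by rewrite ler_wpM2l.
apply: le_trans (_ : (`|s| + 1) * `|g D - t| <= _).
  by rewrite ler_wpM2r // lerDl ler01.
by rewrite mulrC -ler_pdivlMr // ltW.
Qed.

Lemma tends_prod T (I : Type) (r : seq I) (f : I -> {fset T} -> K) (s : I -> K) :
  (forall i, tends (f i) (s i)) ->
  tends (fun A => \prod_(i <- r) f i A) (\prod_(i <- r) s i).
Proof.
move=> fs; elim: r => [|i r IH] e e0.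
  by exists fset0 => B _; rewrite !big_nil subrr normr0.
have [A hA] := tendsM (fs i) IH e0; exists A => B /hA.
by rewrite !big_cons.
Qed.

(** Every finite set of tuples is contained in a rectangle. *)
Lemma abs_summable_prod T (X : choiceType) (I : finType) (pr : X -> I -> T)
    (mk : (I -> T) -> X) (F : I -> T -> K) :
  (forall x, mk (pr x) = x) -> (forall f i, pr (mk f) i = f i) ->
  (forall i, abs_summable (F i)) ->
  abs_summable (fun x => \prod_i F i (pr x i)).
Proof.
move=> mkpr prmk FS.
have [b bP] := choice FS.
exists (\prod_i b i) => A.
pose A' := [fset pr u.1 u.2 | u in (A `*` [fset i in enum I])%fset]%fset.
have [B [AB EB]] := box_sum (fun i t => `|F i t|) A' mkpr prmk.
have sAB : (A `<=` B)%fset.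
  apply/fsubsetP => x xA; apply: AB => i; apply/imfsetP.
  by exists (x, i) => //=; rewrite !inE /= xA mem_enum.
rewrite (eq_bigr (fun x => \prod_i `|F i (pr x i)|)); last first.
  by move=> x _; exact: normr_prod.
apply: le_trans (_ : \sum_(x <- B) \prod_i `|F i (pr x i)| <= _).
  by apply: sum_fset_le => // x; apply: prodr_ge0.
rewrite EB; apply: ler_prod => i _; rewrite bP andbT.
exact: sumr_ge0.
Qed.

(** Evaluating the sum along rectangles identifies it with the product. *)
Lemma has_sum_prod T (X : choiceType) (I : finType) (pr : X -> I -> T)
    (mk : (I -> T) -> X) (F : I -> T -> K) (s : I -> K) S :
  (forall x, mk (pr x) = x) -> (forall f i, pr (mk f) i = f i) ->
  (forall i, has_sum (F i) (s i)) ->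
  has_sum (fun x => \prod_i F i (pr x i)) S -> S = \prod_i s i.
Proof.
move=> mkpr prmk Fs FS; apply/eqP; rewrite -subr_eq0 -normr_eq0.
apply: contraT => nst; set d := `|_| in nst.
have e0 : 0 < d / 2 by rewrite divr_gt0 // lt_def nst normr_ge0.
have [A0 hS] := FS _ e0; have [A1 hs] := tends_prod (index_enum I) Fs e0.
pose A' := (A1 `|` [fset pr u.1 u.2 | u in (A0 `*` [fset i in enum I])%fset])%fset.
have [B [AB EB]] := box_sum F A' mkpr prmk.
have /hS h1 : (A0 `<=` B)%fset.
  apply/fsubsetP => x xA; apply: AB => i; rewrite inE; apply/orP; right.
  by apply/imfsetP; exists (x, i) => //=; rewrite !inE /= xA mem_enum.
have h2 := hs A' (fsubsetUl _ _).
have := ltrD h1 h2; rewrite EB -splitr distrC => /(le_lt_trans (ler_normD _ _)).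
by rewrite addrA subrK -/d ltxx.
Qed.

End HasSum.

Section Existence.
Import numFieldNormedType.Exports.
Variable R : realType.

Lemma has_sum_nonneg (T : choiceType) (f : T -> R) (b : R) :
  (forall x, 0 <= f x) -> (forall A : {fset T}, \sum_(x <- A) f x <= b) ->
  exists s, has_sum f s.
Proof.
move=> f0 fb; pose E : set R := [set \sum_(x <- A) f x | A in [set: {fset T}]].
have hE : has_sup E.
  split; first by exists (\sum_(x <- fset0) f x), fset0.
  by exists b => _ [A _ <-].
exists (sup E) => e e0; have [_ [A _ <-] hA] := sup_adherent e0 hE.
exists A => B AB; have leAB := sum_fset_le AB f0.
have leB : \sum_(x <- B) f x <= sup E by apply: ub_le_sup; [case: hE | exists B].
rewrite distrC ger0_norm ?subr_ge0 // ltrBlDr.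
by rewrite -ltrBlDl (lt_le_trans hA).
Qed.

Lemma has_sum_real (T : choiceType) (f : T -> R) :
  abs_summable f -> exists s, has_sum f s.
Proof.
move=> [b fb].
have [|A|s sP] := @has_sum_nonneg T (fun x => `|f x|) b; [by []|exact: fb|].
have [|A|t tP] := @has_sum_nonneg T (fun x => `|f x| + f x) (b + b).
- by move=> x; rewrite -lerBlDr sub0r -normrN ler_norm.
- rewrite big_split /= lerD // (le_trans _ (fb A)) //.
  by apply: ler_sum => x _; exact: ler_norm.
exists (t + -1 * s); apply: has_sum_ext (has_sumD tP (has_sumZ (-1) sP)) => x.
by rewrite mulN1r addrAC subrr add0r.
Qed.

Lemma has_sum_complex_real (T : choiceType) (f : T -> R) s :
  has_sum f s -> has_sum (fun x => (f x)%:C%C) (s%:C)%C.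
Proof.
move=> fs e e0.
have e0' : 0 < complex.Re e by move: e0; rewrite ltcE /= => /andP[].
have [A hA] := fs _ e0'; exists A => B /hA.
rewrite -rmorph_sum -rmorphB /= normc_def /= expr0n addr0 sqrtr_sqr => h.
move: e0; rewrite !ltcE /= => /andP[/eqP-> _].
by rewrite eqxx.
Qed.

Lemma abs_summable_has_sum (T : choiceType) (f : T -> R[i]) :
  abs_summable f -> exists s, has_sum f s.
Proof.
move=> [b fb].
have [s sP] : exists s, has_sum (fun x => complex.Re (f x)) s.
  apply: has_sum_real; exists (complex.Re b) => A.
  have := fb A; under eq_bigr => x _ do rewrite normc_def.
  rewrite -rmorph_sum lecE /= => /andP[_]; apply: le_trans; apply: ler_sum => x _.
  by case: (f x) => u v /=; rewrite -sqrtr_sqr ler_wsqrtr // lerDl sqr_ge0.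
have [t tP] : exists t, has_sum (fun x => complex.Im (f x)) t.
  apply: has_sum_real; exists (complex.Re b) => A.
  have := fb A; under eq_bigr => x _ do rewrite normc_def.
  rewrite -rmorph_sum lecE /= => /andP[_]; apply: le_trans; apply: ler_sum => x _.
  by case: (f x) => u v /=; rewrite -sqrtr_sqr ler_wsqrtr // lerDr sqr_ge0.
exists (s%:C + 'i * t%:C)%C.
apply: has_sum_ext (has_sumD (has_sum_complex_real sP)
  (has_sumZ 'i (has_sum_complex_real tP))) => x.
by rewrite [RHS]complexE.
Qed.

Lemma csum_has_sum (T : choiceType) (D : set T) (f : T -> R[i]) s :
  has_sum (fun x => if x \in D then f x else 0) s -> csum D f = s.
Proof.
move=> fs; rewrite /csum /summability.sum.
have pf := @summability.totally_filter T.
apply: (@cvg_lim R[i]^o) => //.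
apply/cvgrPdist_lt => e e0; have [A hA] := fs _ e0.
exists A => // B AB; rewrite distrC /summability.partial_sum.
by have := hA B AB; rewrite big_seq_fsetE.
Qed.

(** The partial sums over finite subsets of the two index types form the same
    net up to the bijection, so the limits agree whether or not they exist. *)
Lemma csum_reindex (T T' : choiceType) (h : T -> T') (h' : T' -> T)
    (f : T' -> R[i]) : cancel h h' -> cancel h' h ->
  csum setT (f \o h) = csum setT f.
Proof.
move=> hK h'K; rewrite /csum /summability.sum.
set F := fun x : T => _; set G := fun x : T' => _.
have PS (T0 : choiceType) (F0 : T0 -> R[i]^o) (A0 : {fset T0}) :
    summability.partial_sum F0 A0 = \sum_(x <- A0) F0 x.
  by rewrite big_seq_fsetE.
have FG A : summability.partial_sum (F : T -> R[i]^o) A =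
    summability.partial_sum (G : T' -> R[i]^o) [fset h x | x in A]%fset.
  rewrite !PS big_imfset /=; last first.
    by move=> x y _ _ /(can_inj hK).
  by apply: eq_bigr => x _; rewrite /F /G !in_setT.
have GF B : [fset h x | x in [fset h' y | y in B]]%fset = B.
  apply/fsetP => y; apply/imfsetP/idP => [[x /= /imfsetP[z zB ->] ->]|yB].
    by rewrite h'K.
  by exists (h' y) => //=; apply/imfsetP; exists y.
suff -> : (summability.partial_sum (F : T -> R[i]^o) @ summability.totally) =
    (summability.partial_sum (G : T' -> R[i]^o) @ summability.totally) by [].
apply/funext => P; apply/propext; split=> -[A _ hA].
  exists [fset h x | x in A]%fset => // B /= AB.
  have := hA [fset h' y | y in B]%fset; rewrite /= FG GF; apply.
  apply/fsubsetP => x xA; apply/imfsetP; exists (h x) => //=.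
  by apply: (fsubsetP AB); apply/imfsetP; exists x.
exists [fset h' y | y in A]%fset => // B /= AB; rewrite FG; apply: hA.
by rewrite /= -[A]GF; apply/fsubsetP => _ /imfsetP[x /= /(fsubsetP AB) xB ->];
  apply/imfsetP; exists x.
Qed.

End Existence.

(** * Symmetries of the string functions *)

Section StringFunctions.
Local Open Scope complex_scope.
Variables (R : realType) (p : nat) (o : 'I_p).
Hypothesis o0 : o = 0%N :> nat.
Implicit Types (n Lam lam : 'rV[int]_p) (x y : 'rV[R]_p) (d : int) (tau : R[i]).

Local Notation weight_lattice := (dual_lattice (root_lattice R p)).
Local Notation bar := (@bar R p).
Local Notation C := R[i].
Local Notation eps i := (@traceless_part R p (delta_mx 0 i)).

(** The dimensions among which mult chooses. Two multiplicities are compared by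
    transporting the representation that realizes one of these dimensions. *)
Definition occurs Lam lam d (k : nat) : Prop :=
  exists (V : lmodType C) (M : affine_rep p V),
    is_L M Lam /\ has_dim (weight_space M (toC (bar lam)) (level lam) (- d)) k.

Lemma mult_eq Lam lam d Lam' lam' d' :
  (forall k, occurs Lam lam d k <-> occurs Lam' lam' d' k) ->
  mult R Lam lam d = mult R Lam' lam' d'.
Proof.
move=> E; rewrite /mult; congr xget; apply/funext => k; apply/propext; exact: E.
Qed.

Definition dominant Lam := level Lam = p%:Z /\ forall j, 0 <= Lam 0 j.

Lemma toC_sum x : \sum_j x 0 j = 0 -> \sum_j (toC x) 0 j = 0.
Proof.
move=> sx; under eq_bigr => j _ do rewrite mxE.
by rewrite -rmorph_sum sx.
Qed.

Lemma toC_eps i : toC (eps i) = traceless_part (delta_mx 0 i).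
Proof.
apply/rowP=> j; rewrite !mxE rmorphB rmorphM fmorphV rmorph_nat /=.
congr (_ - _ / _); last by rewrite rmorph_nat.
by rewrite rmorph_sum; apply: eq_bigr => k _; rewrite !mxE /= rmorph_nat.
Qed.

Lemma intC (z : int) : real_complex R z%:~R = z%:~R.
Proof. by rewrite rmorph_int. Qed.

(** The half of the invariance under a simple reflection in which the weight is
    on the nonnegative side of the wall. *)
Lemma occurs_reflect_half Lam lam lam' d k (i j : 'I_p) : dominant Lam ->
  j = i.+1 :> nat -> level lam = level lam' ->
  bar lam' = \row_l bar lam 0 (tperm i j l) -> 0 <= lam 0 j ->
  occurs Lam lam d k <-> occurs Lam lam' d k.
Proof.
move=> [lL dom] ij El Eb lam_ge0.
have diff n : (toC (bar n)) 0 i - (toC (bar n)) 0 j = (n 0 j)%:~R.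
  by rewrite !mxE -rmorphB (bar_label _ o0 _ ij) rmorph_int.
have nat_of z : 0 <= z -> exists l : nat, z%:~R = l%:R :> C.
  by move=> z0; exists `|z|%N; rewrite -[in RHS](ger0_norm z0) ?natr_absz ?ger0_norm.
have [l0 El0] := nat_of _ (dom j); have [l Ell] := nat_of _ lam_ge0.
have -> : occurs Lam lam' d k <-> exists (V : lmodType C) (M : affine_rep p V),
    is_L M Lam /\ has_dim (weight_space M
      (toC (bar lam) - l%:R *: simple_root C i j) (level lam) (- d)) k.
  suff -> : toC (bar lam) - l%:R *: simple_root C i j = toC (bar lam').
    by rewrite El.
  apply/rowP=> x; rewrite Eb !mxE /=.
  have := diff lam; rewrite !mxE Ell => El'.
  case: tpermP => [->|->|/eqP/negPf-> /eqP/negPf->].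
  - have /negPf-> : i != j by apply/eqP => E; move: ij; rewrite E => /n_Sn.
    by rewrite eqxx subr0 mulr1 -El' opprB addrC subrK.
  - have /negPf-> : j != i by apply/eqP => E; move: ij; rewrite E => /n_Sn.
    by rewrite eqxx sub0r mulrN1 opprK -El' addrC subrK.
  by rewrite subr0 mulr0 subr0.
have refl (V : lmodType C) (M : affine_rep p V) : is_L M Lam ->
    has_dim (weight_space M (toC (bar lam)) (level lam) (- d)) k <->
    has_dim (weight_space M
      (toC (bar lam) - l%:R *: simple_root C i j) (level lam) (- d)) k.
  move=> [irr [v hw]].
  exact: (simple_reflection_dim ij (level lam) (- d) k irr hw
    (etrans (diff Lam) El0) (etrans (diff lam) Ell)).
split=> -[V [M [ML hdim]]]; exists V, M; split; [exact: ML| |exact: ML|].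
  by case: (refl V M ML) => + _; apply.
by case: (refl V M ML) => _; apply.
Qed.

Lemma occurs_reflect Lam lam lam' d k (i j : 'I_p) : dominant Lam ->
  j = i.+1 :> nat -> level lam = level lam' ->
  bar lam' = \row_l bar lam 0 (tperm i j l) ->
  occurs Lam lam d k <-> occurs Lam lam' d k.
Proof.
move=> dom ij El Eb; have [lam_ge0|lam_lt0] := leP 0 (lam 0 j).
  exact: occurs_reflect_half ij El Eb lam_ge0.
have Eb' : bar lam = \row_l bar lam' 0 (tperm i j l).
  by apply/rowP=> l; rewrite Eb !mxE tpermK.
apply: iff_sym; apply: (occurs_reflect_half _ _ dom ij (esym El) Eb').
have : (lam' 0 j)%:~R = - (lam 0 j)%:~R :> R.
  by rewrite -!(bar_label _ o0 _ ij) Eb !mxE tpermL tpermR opprB.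
rewrite -rmorphN => /intr_inj ->; rewrite oppr_ge0; exact: ltW.
Qed.

(** Necessary for lam to be a weight of the representation with highest weight
    Lam, by weight_class. *)
Definition same_class Lam lam := forall j, bar lam 0 j - bar Lam 0 j \is a Num.int.

Lemma occurs_class Lam lam d k : ~ same_class Lam lam -> occurs Lam lam d k ->
  k = 0%N.
Proof.
move=> /existsNP[j nint] [V [M [[irr [v hw]]]]]; apply: has_dim_eq0 => w Ww.
apply: contrapT => w0; apply: nint.
have [z] := weight_class j irr hw (toC_sum (bar_sum _ o Lam)) (toC_sum (bar_sum _ o lam)) Ww w0.
rewrite !mxE -rmorphB -intC => /complexI ->; exact: intr_int.
Qed.

Lemma mult_class Lam lam d : ~ same_class Lam lam -> mult R Lam lam d = 0%N.
Proof.
move=> nc; rewrite /mult; case: xgetP => [k _ /= kP|//].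
exact: occurs_class nc kP.
Qed.

Definition last_coord n : R := bar n 0 (ord_pred o).

(** The twist by the rotation of the Dynkin diagram keeps the highest weight
    vector and shifts the degrees by a difference of last coordinates. *)
Lemma occurs_current_half Lam lam d d' k : level Lam = p%:Z -> level lam = p%:Z ->
  d'%:~R = d%:~R + last_coord lam - last_coord Lam ->
  occurs Lam lam d k -> occurs (current 1 Lam) (current 1 lam) d' k.
Proof.
move=> lL ll Ed [V [M [[irr [v hw]] hdim]]].
(* The constant makes d vanish on the highest weight vector. *)
pose g := perm (@ordS_inj p); pose M1 := perm_twist M g.
pose M2 := flow M1 o (last_coord Lam)%:C.
have wt n dd dd' : level n = p%:Z -> dd'%:~R = dd%:~R - last_coord n + last_coord Lam ->
    weight_space M2 (toC (bar (current 1 n))) (level (current 1 n)) dd' =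
    weight_space M (toC (bar n)) (level n) dd.
  move=> ln Edd; rewrite (bar_current R o0 n) level_current ln.
  have -> : toC (\row_j bar n 0 (ord_pred j) + p%:Z%:~R *: eps o) =
      toC (\row_j bar n 0 (ord_pred j)) + p%:Z%:~R *: traceless_part (delta_mx 0 o).
    by rewrite -toC_eps -intC; apply/rowP=> l; rewrite !mxE rmorphD rmorphM.
  rewrite (@flow_weight _ _ _ _ _ _ _ _ dd).
  - have Er : \row_j toC (\row_l bar n 0 (ord_pred l)) 0 (g j) = toC (bar n).
      by apply/rowP=> j; rewrite !mxE permE ordSK.
    by rewrite perm_twist_weight Er.
  - rewrite -[RHS](toC_sum (bar_sum _ o n)) [RHS](reindex_inj (@ord_pred_inj p)).
    by apply: eq_bigr => j _; rewrite !mxE.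
  - by rewrite !mxE -!intC Edd rmorphD rmorphB.
exists V, M2; split; last first.
  by rewrite (wt lam (- d)) // !rmorphN /= Ed !opprD opprK.
split; first by apply: flow_irreducible; exact: perm_twist_irreducible.
have [v0 vwt pos up] := hw.
have gE (x : 'I_p) : g x != o -> g x = x.+1 :> nat.
  rewrite -val_eqE /= o0 permE /=; have := ltn_ord x.
  by rewrite leq_eqVlt => /orP[/eqP->|lt]; rewrite ?modnn // modn_small.
have g_o (x : 'I_p) : g x = o -> x.+1 = p.
  move=> /(congr1 val); rewrite /= o0 permE /=; have := ltn_ord x.
  by rewrite leq_eqVlt => /orP[/eqP//|lt]; rewrite modn_small.
have loop2E a m : \tr a = 0 -> loop M2 a m v =
    loop M (mxsub g g (piece o 0 a)) (m - 1) v +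
    loop M (mxsub g g (piece o 1 a)) m v +
    loop M (mxsub g g (piece o 2 a)) (m + 1) v +
    (if m == 0 then a o o else 0) *: actK M v by [].
have tp a l : \tr a = 0 -> \tr (mxsub g g (piece o l a)) = 0.
  by move=> ta; rewrite mxsub_tr piece_tr0.
(* The only matrix units whose power of t decreases have their column at o, and
   the permutation turns this column into the last one. *)
exists v; split; [exact: v0 | by rewrite (wt Lam 0) // addrNK | |].
- move=> a m ta m0; rewrite loop2E // (gt_eqF m0) scale0r addr0.
  rewrite [X in _ + _ + X]pos ?tp // ?addr0; last by lia.
  rewrite [X in _ + X]pos ?tp // addr0.
  have [m1|m1] := eqVneq m 1; last by rewrite pos ?tp //; lia.
  rewrite m1 subrr; apply: up => x y le_yx; rewrite !mxE.
  have [Ex|Ex] := eqVneq (g x) o; have [Ey|Ey] := eqVneq (g y) o => //=.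
  by have := g_o _ Ey; have := gE _ Ex; have := ltn_ord (g x); lia.
move=> a ua.
have ta : \tr a = 0 by rewrite /mxtrace big1 // => x _; exact: ua.
rewrite loop2E // eqxx ua // scale0r addr0.
rewrite [X in _ + _ + X]pos ?tp // addr0.
have -> : mxsub g g (piece o 0 a) = 0.
  apply/matrixP=> x y; rewrite !mxE.
  have [Ex|Ex] := eqVneq (g x) o; have [Ey|Ey] := eqVneq (g y) o => //=.
  by rewrite Ey ua // o0.
rewrite loop0 add0r; apply: up => x y le_yx; rewrite !mxE.
have [Ex|Ex] := eqVneq (g x) o; have [Ey|Ey] := eqVneq (g y) o => //=.
  by rewrite Ex Ey ua.
by rewrite ua // (gE _ Ex) (gE _ Ey).
Qed.

Lemma sqnorm_current n : sqnorm R (current 1 n) =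
  sqnorm R n + 2 * (level n)%:~R * last_coord n +
  (level n)%:~R ^+ 2 * dot (eps o) (eps o).
Proof.
rewrite /sqnorm (bar_current R o0); set l := (level n)%:~R.
set x := \row_j _.
have sx : \sum_j x 0 j = 0.
  rewrite -[RHS](bar_sum R o n) [RHS](reindex_inj (@ord_pred_inj p)).
  by apply: eq_bigr => j _; rewrite mxE.
have dZ (y z : 'rV[R]_p) : dot (l *: y) z = l * dot y z.
  by rewrite /dot -scalemxAl linearZ.
rewrite dotDl dZ dotC dotDl dZ [dot (eps o) (x + _)]dotC dotDl dZ.
rewrite [dot (eps o) x]dotC (dot_traceless_delta o sx) mxE -/(last_coord n).
have -> : dot x x = dot (bar n) (bar n).
  rewrite !dotE [RHS](reindex_inj (@ord_pred_inj p)).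
  by apply: eq_bigr => j _; rewrite !mxE.
by ring.
Qed.

Lemma level_rho : level (rho p) = p%:Z.
Proof.
rewrite /level; under eq_bigr => j _ do rewrite mxE.
by rewrite sumr_const card_ord natz.
Qed.

Lemma current_rho a : current a (rho p) = rho p.
Proof. by apply/rowP=> j; rewrite !mxE. Qed.

Lemma current_add a n n' : current a (n + n') = current a n + current a n'.
Proof. by apply/rowP=> j; rewrite !mxE. Qed.

(** The norm of rho being unchanged by the current fixes its last coordinate,
    which cancels the translation terms. *)
Lemma anomaly_current Lam lam : level Lam = p%:Z -> level lam = p%:Z ->
  anomaly R (current 1 Lam) (current 1 lam) =
  anomaly R Lam lam + (last_coord Lam - last_coord lam).
Proof.
move=> lL ll; rewrite /anomaly.
have -> : current 1 Lam + rho p = current 1 (Lam + rho p).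
  by rewrite current_add current_rho.
have := sqnorm_current (rho p); rewrite current_rho => Erho.
rewrite !sqnorm_current level_add lL ll level_rho in Erho *.
have lastD : last_coord (Lam + rho p) = last_coord Lam + last_coord (rho p).
  by rewrite /last_coord bar_add mxE.
rewrite lastD; move: Erho; set e2 := dot _ _; rewrite -!pmulrn natrM !natrD => Erho.
have p0 : p%:R != 0 :> R by rewrite pnatr_eq0; case: (p) o => [[]|].
have Er : 2 * last_coord (rho p) + p%:R * e2 = 0.
  apply: (mulfI p0); apply: (addrI (sqnorm R (rho p))).
  by rewrite mulr0 addr0 [RHS]Erho; ring.
have -> : last_coord (rho p) = - (p%:R * e2) / 2.
  have <- : 2 * last_coord (rho p) = - (p%:R * e2) by apply/eqP; rewrite -addr_eq0 Er.
  by rewrite mulrAC divff ?mul1r // pnatr_eq0.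
have pp0 : p%:R + p%:R != 0 :> R by rewrite -mulr2n mulrn_eq0.
by rewrite addr0; field.
Qed.

Lemma currentK a n : (a <= p)%N -> current (p - a) (current a n) = n.
Proof.
move=> le_ap; rewrite currentD subnKC // -(current_modn o) modnn.
by apply/rowP=> j; rewrite mxE.
Qed.

Lemma same_class_current Lam lam : level Lam = level lam ->
  same_class Lam lam <-> same_class (current 1 Lam) (current 1 lam).
Proof.
move=> El; have E j : bar (current 1 lam) 0 j - bar (current 1 Lam) 0 j =
    bar lam 0 (ord_pred j) - bar Lam 0 (ord_pred j).
  by rewrite !(bar_current R o0) El !mxE opprD addrACA subrr addr0.
split=> sc j; first by rewrite E.
by have := sc (ordS j); rewrite E ordSK.
Qed.

(** The quantity that is conserved is the exponent of the string function; as
    the current has order p, going around once brings the degree back. *)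
Lemma occurs_iter a Lam lam d k : level Lam = p%:Z -> level lam = p%:Z ->
  same_class Lam lam -> occurs Lam lam d k ->
  exists d', [/\ occurs (current a Lam) (current a lam) d' k,
    same_class (current a Lam) (current a lam) &
    anomaly R (current a Lam) (current a lam) + d'%:~R =
    anomaly R Lam lam + d%:~R].
Proof.
move=> lL ll sc oc; elim: a => [|a [d' [oc' sc' E]]].
  exists d; have c0 n : current 0 n = n by apply/rowP=> j; rewrite mxE.
  by rewrite !c0.
have lL' : level (current a Lam) = p%:Z by rewrite level_current.
have ll' : level (current a lam) = p%:Z by rewrite level_current.
have /intrP[z Ez] := sc' (ord_pred o).
exists (d' + z); rewrite -addn1 -!currentD; split.
- apply: occurs_current_half oc' => //.
  by rewrite rmorphD /= -Ez addrA.
- by rewrite -same_class_current // lL'.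
- by rewrite anomaly_current // -E rmorphD /= -Ez /last_coord; ring.
Qed.

Lemma occurs_current Lam lam d d' k : level Lam = p%:Z -> level lam = p%:Z ->
  same_class Lam lam -> d'%:~R = d%:~R + last_coord lam - last_coord Lam ->
  occurs Lam lam d k <-> occurs (current 1 Lam) (current 1 lam) d' k.
Proof.
move=> lL ll sc Ed; split; first exact: occurs_current_half.
have p0 : (0 < p)%N by case: (p) o => [[]|].
have lL' : level (current 1 Lam) = p%:Z by rewrite level_current.
have ll' : level (current 1 lam) = p%:Z by rewrite level_current.
(* The inverse of the current is its power p - 1. *)
move=> /(occurs_iter (p - 1) lL' ll').
case; first by rewrite -same_class_current // lL.
move=> d2; rewrite !currentK // anomaly_current // => -[oc _ E].
suff -> : d = d2 by [].
apply: (@intr_inj R); apply: (addrI (anomaly R Lam lam)).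
by rewrite E Ed; ring.
Qed.

Lemma string_function_current1 Lam lam tau :
  level Lam = p%:Z -> level lam = p%:Z ->
  string_function (current 1 Lam) (current 1 lam) tau =
  string_function Lam lam tau.
Proof.
move=> lL ll; rewrite /string_function.
have [sc|nsc] := pselect (same_class Lam lam); last first.
  have nsc' : ~ same_class (current 1 Lam) (current 1 lam).
    by rewrite -same_class_current // lL.
  congr (csum _ _); apply/funext => d.
  by rewrite !mult_class // !mul0r.
have /intrP[z Ez] := sc (ord_pred o).
have h1 : cancel (fun d : int => d + z) (fun d => d - z) by move=> d; rewrite addrK.
have h2 : cancel (fun d : int => d - z) (fun d => d + z) by move=> d; rewrite subrK.
rewrite -(csum_reindex _ h1 h2); congr (csum _ _); apply/funext => d /=.
have Ed : (d + z)%:~R = d%:~R + last_coord lam - last_coord Lam.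
  by rewrite rmorphD /= -Ez addrA.
rewrite -(mult_eq (fun k => occurs_current k lL ll sc Ed)).
have -> : (anomaly R (current 1 Lam) (current 1 lam))%:C + (d + z)%:~R =
    (anomaly R Lam lam)%:C + d%:~R.
  rewrite (anomaly_current lL ll) -!intC -!rmorphD; congr (real_complex _ _).
  by rewrite rmorphD /= -Ez /last_coord; ring.
by [].
Qed.

Lemma string_function_current a Lam lam tau :
  level Lam = p%:Z -> level lam = p%:Z ->
  string_function (current a Lam) (current a lam) tau =
  string_function Lam lam tau.
Proof.
move=> lL ll; elim: a => [|a IH].
  by have c0 n : current 0 n = n by [apply/rowP=> j; rewrite mxE]; rewrite !c0.
by rewrite -addn1 -!currentD string_function_current1 ?level_current.
Qed.

Lemma sqnorm_perm lam lam' (g : {perm 'I_p}) :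
  bar lam' = \row_l bar lam 0 (g l) -> sqnorm R lam' = sqnorm R lam.
Proof.
move=> Eb; rewrite /sqnorm Eb !dotE [RHS](reindex_inj (@perm_inj _ g)).
by apply: eq_bigr => j _; rewrite !mxE.
Qed.

Lemma string_function_reflect Lam lam lam' tau (i j : 'I_p) : dominant Lam ->
  j = i.+1 :> nat -> level lam = level lam' ->
  bar lam' = \row_l bar lam 0 (tperm i j l) ->
  string_function Lam lam' tau = string_function Lam lam tau.
Proof.
move=> dom ij El Eb; rewrite /string_function; congr (csum _ _).
apply/funext => d; rewrite /anomaly (sqnorm_perm Eb); congr (_%:R * _).
by apply/esym/mult_eq => k; apply: (occurs_reflect _ _ dom ij El Eb).
Qed.

Definition string_at Lam x tau : C := string_function Lam (weight_of x) tau.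

Lemma string_atE Lam x tau :
  string_at Lam x tau = string_function Lam (weight_of x) tau.
Proof. by []. Qed.

(** Simple reflections act as adjacent transpositions, which generate the
    symmetric group. *)
Lemma string_at_perm Lam x tau (g : {perm 'I_p}) : dominant Lam ->
  weight_lattice x -> string_at Lam (\row_j x 0 (g j)) tau = string_at Lam x tau.
Proof.
move=> dom; pose good (g : {perm 'I_p}) := forall x, weight_lattice x ->
  string_at Lam (\row_j x 0 (g j)) tau = string_at Lam x tau.
move: x; rewrite -/(good g).
have good1 : good 1%g.
  move=> x _; have -> : \row_j x 0 ((1%g : {perm 'I_p}) j) = x.
    by apply/rowP=> j; rewrite mxE perm1.
  by [].
have goodM g1 g2 : good g1 -> good g2 -> good (g1 * g2)%g.
  move=> G1 G2 x wx; have wx2 := weight_lattice_perm o g2 wx.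
  have -> : \row_j x 0 ((g1 * g2)%g j) = \row_j (\row_l x 0 (g2 l)) 0 (g1 j).
    by apply/rowP=> j; rewrite !mxE permM.
  by rewrite (G1 _ wx2) (G2 x wx).
have good_adj (i j : 'I_p) : j = i.+1 :> nat -> good (tperm i j).
  move=> ij x wx; have wx' := weight_lattice_perm o (tperm i j) wx.
  have [l1 b1] := weight_ofP o0 wx; have [l2 b2] := weight_ofP o0 wx'.
  apply: (string_function_reflect _ dom ij); first by rewrite l1 l2.
  by rewrite b1 b2.
have good_lt (n : nat) : forall i j : 'I_p, (i + n.+1)%N = j -> good (tperm i j).
  elim: n => [|n IH] i j ij; first by apply: good_adj; rewrite -ij addn1.
  have lt : (j.-1 < p)%N by rewrite (leq_ltn_trans (leq_pred _)).
  pose j' := Ordinal lt.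
  have Ej : j = j'.+1 :> nat by rewrite /=; lia.
  (* Conjugation by an adjacent transposition shortens the distance. *)
  have -> : tperm i j = (tperm j' j * tperm i j' * tperm j' j)%g.
    rewrite -[X in (X * _ * _)%g]tpermV -mulgA -conjgE tpermJ tpermL tpermD //.
      by apply/eqP=> E; move: Ej ij; rewrite -E /=; lia.
    by apply/eqP=> E; move: ij; rewrite -E; lia.
  have gij' : good (tperm i j') by apply: IH; rewrite /=; lia.
  exact: (goodM _ _ (goodM _ _ (good_adj _ _ Ej) gij') (good_adj _ _ Ej)).
have good_tperm (i j : 'I_p) : good (tperm i j).
  have [lt|lt|E] := ltngtP i j.
  - by apply: (good_lt (j - i).-1); lia.
  - by rewrite tpermC; apply: (good_lt (i - j).-1); lia.
  - by rewrite (ord_inj E) tperm1.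
have [ts -> _] := prod_tpermP g.
by apply: (big_ind good good1 goodM) => t _; exact: good_tperm.
Qed.

Lemma dominant_current a Lam : dominant Lam -> dominant (current a Lam).
Proof. by case=> lL dom; split=> [|j]; rewrite ?level_current // mxE. Qed.

Lemma eps_weight i : weight_lattice (eps i).
Proof.
apply/weight_latticeP => //; split=> [|j k]; first exact: traceless_part_sum.
by rewrite !epsE opprB addrA subrK rpredB // natr_int.
Qed.

Lemma weight_latticeMn x (m : nat) : weight_lattice x -> weight_lattice (m%:R *: x).
Proof.
move=> /(weight_latticeP o)[sx dx]; apply/weight_latticeP => //; split=> [|i j].
  by under eq_bigr => j _ do rewrite mxE; rewrite -mulr_sumr sx mulr0.
by rewrite !mxE -mulrBr rpredM // natr_int.
Qed.

(** The current translates by p eps_o after a rotation; a transposition of the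
    coordinates moves the translation to eps_i. *)
Lemma string_at_eps Lam x i tau : dominant Lam -> weight_lattice x ->
  string_at (current 1 Lam) (x + p%:R *: eps i) tau = string_at Lam x tau.
Proof.
move=> dom wx; have dom1 := dominant_current 1 dom.
have wxe : weight_lattice (x + p%:R *: eps i).
  by apply: weight_latticeD => //; apply: weight_latticeMn; exact: eps_weight.
rewrite -(string_at_perm tau (tperm o i) dom1 wxe).
pose g := (perm (@ordS_inj p) * tperm o i)%g.
have wg := weight_lattice_perm o g wx.
have [ll bl] := weight_ofP o0 wg; have [lL _] := dom.
have -> : \row_j (x + p%:R *: eps i) 0 (tperm o i j) =
    bar (current 1 (weight_of (\row_j x 0 (g j)))).
  rewrite (bar_current R o0) bl ll; apply/rowP=> j.
  have addE (u v : 'rV[R]_p) l : (u + v) 0 l = u 0 l + v 0 l by rewrite mxE.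
  have scaleE c (u : 'rV[R]_p) l : (c *: u) 0 l = c * u 0 l by rewrite mxE.
  have rowE' (f : 'I_p -> R) l : (\row_j f j) 0 l = f l by rewrite mxE.
  rewrite rowE' !addE !scaleE !epsE !rowE' permM.
  rewrite [perm (@ordS_inj p) _]permE ord_predK.
  congr (_ + _ * (_%:R - _)).
  by case: tpermP => [->|->|/eqP/negPf-> /eqP/negPf->]; rewrite ?eqxx // eq_sym.
have Ew := weight_of_bar R o0 (etrans (level_current 1 _) ll).
have -> : string_at (current 1 Lam)
    (bar (current 1 (weight_of (\row_j x 0 (g j))))) tau =
    string_at Lam (\row_j x 0 (g j)) tau.
  by rewrite /string_at Ew; exact: string_function_current1.
exact: string_at_perm.
Qed.

Definition shifts_by y a := weight_lattice y /\ forall Lam x tau,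
  dominant Lam -> weight_lattice x ->
  string_at (current a Lam) (x + p%:R *: y) tau = string_at Lam x tau.

Lemma shifts_by0 : shifts_by 0 0.
Proof.
split=> [|Lam x tau _ _].
  by apply/weight_latticeP => //; split=> [|i j];
    [apply: big1 => j _; rewrite mxE | rewrite !mxE subrr rpred0].
have -> : current 0 Lam = Lam by apply/rowP=> j; rewrite mxE.
by rewrite scaler0 addr0.
Qed.

Lemma shifts_byD y a y' a' : shifts_by y a -> shifts_by y' a' ->
  shifts_by (y + y') (a + a').
Proof.
move=> [wy Ty] [wy' Ty']; split=> [|Lam x tau dom wx].
  exact: weight_latticeD.
rewrite -currentD scalerDr addrA Ty' ?Ty //; first exact: dominant_current.
by apply: weight_latticeD => //; exact: weight_latticeMn.
Qed.

Lemma shifts_by_eps i : shifts_by (eps i) 1.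
Proof. by split=> [|Lam x tau]; [exact: eps_weight | exact: string_at_eps]. Qed.

Lemma shifts_by_fundamental a : (a <= p)%N ->
  shifts_by (fundamental_weight R p a) a.
Proof.
elim: a => [_|a IH lt_ap].
  have -> : fundamental_weight R p 0 = 0.
    by apply/rowP=> j; rewrite !mxE ltn0 mul0r subrr.
  exact: shifts_by0.
have -> : fundamental_weight R p a.+1 =
    fundamental_weight R p a + eps (Ordinal lt_ap).
  apply/rowP=> j; rewrite [RHS]mxE epsE !mxE addrACA -natrD -opprD.
  congr (_%:R - _); last by rewrite -natr1 mulrDl mul1r.
  by rewrite -val_eqE /= ltnS leq_eqVlt; case: ltngtP.
by have := shifts_byD (IH (ltnW lt_ap)) (shifts_by_eps (Ordinal lt_ap)); rewrite addn1.
Qed.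

Lemma weight_latticeN y : weight_lattice y -> weight_lattice (- y).
Proof.
move=> /(weight_latticeP o)[sy dy]; apply/weight_latticeP => //.
split=> [|i j]; first by under eq_bigr => j _ do rewrite mxE; rewrite sumrN sy oppr0.
by rewrite !mxE -opprD rpredN.
Qed.

Lemma shifts_byN y : shifts_by y 0 -> shifts_by (- y) 0.
Proof.
have c0 n : current 0 n = n by apply/rowP=> j; rewrite mxE.
move=> [wy Ty]; have wNy := weight_latticeN wy.
split; [exact: wNy | move=> Lam x tau dom wx].
have wxy : weight_lattice (x + p%:R *: - y).
  by apply: weight_latticeD => //; exact: weight_latticeMn.
have := Ty Lam _ tau dom wxy.
have -> : x + p%:R *: - y + p%:R *: y = x by rewrite scalerN subrK.
by rewrite (c0 Lam) => ->.
Qed.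

(** The root lattice is generated by the eps_i - eps_o, and shifts by eps_i and
    by eps_o have the same effect. This is the periodicity of the string
    functions modulo p times the root lattice. *)
Lemma shifts_by_root y : root_lattice R p y -> shifts_by y 0.
Proof.
move=> [ty iy]; have sy : \sum_j y 0 j = 0 by exact: ty.
have subE (u v : 'rV[R]_p) l : (u - v) 0 l = u 0 l - v 0 l by rewrite !mxE.
have scaleE c (u : 'rV[R]_p) l : (c *: u) 0 l = c * u 0 l by rewrite mxE.
have diff i : shifts_by (eps i - eps o) 0.
  have wd : weight_lattice (eps i - eps o).
    apply/weight_latticeP => //; split=> [|j k].
      under eq_bigr => j _ do rewrite subE.
      by rewrite sumrB !traceless_part_sum subrr.
    have := eps_weight i => /(weight_latticeP o)[_ /(_ j k)].
    have := eps_weight o => /(weight_latticeP o)[_ /(_ j k)].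
    move: (eps i) (eps o) => u v iv iu; rewrite !mxE.
    have -> : u 0 j - v 0 j - (u 0 k - v 0 k) = (u 0 j - u 0 k) - (v 0 j - v 0 k).
      by ring.
    exact: rpredB.
  split; [exact: wd | move=> Lam x tau dom wx]; have p0 : (0 < p)%N by case: (p) o => [[]|].
  pose Lam' := current (p - 1) Lam.
  have dom' : dominant Lam' by exact: dominant_current.
  have EL : Lam = current 1 Lam'.
    rewrite /Lam' currentD subnK // -(current_modn o) modnn.
    by apply/rowP=> j; rewrite mxE.
  have c0 n : current 0 n = n by apply/rowP=> j; rewrite mxE.
  pose x' := x - p%:R *: eps o.
  have wx' : weight_lattice x'.
    rewrite /x' -scalerN; apply: weight_latticeD => //; apply: weight_latticeMn.
    exact: weight_latticeN (eps_weight o).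
  rewrite (c0 Lam) EL.
  have -> : x + p%:R *: (eps i - eps o) = x' + p%:R *: eps i.
    by rewrite scalerBr addrA addrAC.
  rewrite (string_at_eps _ _ dom' wx').
  rewrite -(string_at_eps o _ dom' wx').
  by rewrite /x' subrK.
have dn i (m : nat) : shifts_by (m%:R *: (eps i - eps o)) 0.
  elim: m => [|m IH]; first by rewrite scale0r; exact: shifts_by0.
  by rewrite -natr1 scalerDl scale1r; exact: (shifts_byD IH (diff i)).
have dz i (m : int) : shifts_by (m%:~R *: (eps i - eps o)) 0.
  case: m => m; first exact: dn.
  by rewrite NegzE rmorphN scaleNr; apply: shifts_byN; exact: dn.
have -> : y = \sum_i y 0 i *: (eps i - eps o).
  apply/rowP=> j; rewrite summxE.
  under eq_bigr => i _ do
    rewrite scaleE subE !epsE opprB addrA subrK mulrBr.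
  rewrite sumrB -mulr_suml sy mul0r subr0 (bigD1 j) //= eqxx mulr1.
  by rewrite big1 ?addr0 // => i; rewrite eq_sym => /negPf->; rewrite mulr0.
apply: (big_ind (fun y => shifts_by y 0)) => [|u v su sv|i _].
- exact: shifts_by0.
- exact: shifts_byD su sv.
by have /intrP[m ->] := iy i; exact: dz.
Qed.

Lemma shifts_by_class y a : (a <= p)%N ->
  root_lattice R p (y - fundamental_weight R p a) -> shifts_by y a.
Proof.
move=> le_ap /shifts_by_root sr.
by have := shifts_byD (shifts_by_fundamental le_ap) sr; rewrite addn0 addrC subrK.
Qed.

End StringFunctions.

(** * The listed highest weights *)

Definition label_sum (p : nat) (t : seq nat) : nat := (\sum_(j < p) nth 0 t j)%N.
(** The class modulo the root lattice, up to multiples of p. *)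
Definition label_class (p : nat) (t : seq nat) : nat :=
  (\sum_(j < p) nth 0 t j * j)%N.

Lemma label_sumE p t :
  label_sum p t = foldr (fun j a => nth 0 t j + a)%N 0%N (iota 0 p).
Proof.
rewrite /label_sum -(big_mkord xpredT (fun j => nth 0%N t j)) /index_iota subn0.
by rewrite unlock.
Qed.

Lemma label_classE p t :
  label_class p t = foldr (fun j a => nth 0 t j * j + a)%N 0%N (iota 0 p).
Proof.
rewrite /label_class -(big_mkord xpredT (fun j => nth 0 t j * j)%N) /index_iota subn0.
by rewrite unlock.
Qed.

Section Labels.
Variables (p r : nat).

Definition admissible (s : seq (seq nat)) : Prop :=
  (forall i : 'I_r, label_sum p (nth [::] s i) = p) /\
  forall g, g \in glue_code r p ->
    \sum_(i < r) (label_class p (nth [::] s i))%:R * g 0 i = 0 :> 'F_p.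

Lemma admissible_const (k : nat) s :
  (forall i : 'I_r, label_sum p (nth [::] s i) == p) ->
  (forall i : 'I_r, (label_class p (nth [::] s i))%:R = k%:R :> 'F_p) ->
  (forall g, g \in glue_code r p -> \sum_i g 0 i = 0) \/ k = 0%N ->
  admissible s.
Proof.
move=> hl hk gk; split=> [i|g gG]; first exact/eqP.
rewrite (eq_bigr (fun i => k%:R * g 0 i)) => [|i _]; last by rewrite hk.
rewrite -mulr_sumr; case: gk => [->//|->]; first by rewrite mulr0.
by rewrite mul0r.
Qed.

Definition label_check (k : nat) (t : seq nat) : bool :=
  (foldr (fun j a => nth 0 t j + a) 0 (iota 0 p) == p)%N &&
  (foldr (fun j a => nth 0 t j * j + a) 0 (iota 0 p) == k %[mod p])%N.

Lemma admissible_all (k : nat) s :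
  all (fun i => label_check k (nth [::] s i)) (iota 0 r) ->
  prime p ->
  (forall g, g \in glue_code r p -> \sum_i g 0 i = 0) \/ k = 0%N ->
  admissible s.
Proof.
move=> /allP h pp gk; apply: (admissible_const (k := k)) => // i.
  have /h/andP[+ _] : (i : nat) \in iota 0 r by rewrite mem_iota /=.
  by rewrite label_sumE.
have /h/andP[_ /eqP E] : (i : nat) \in iota 0 r by rewrite mem_iota /=.
by rewrite label_classE -(Fp_nat_mod pp) E (Fp_nat_mod pp).
Qed.

End Labels.

Ltac admissible_by k :=
  apply: (@admissible_all _ _ k);
  [by vm_compute | by [] | ].

Lemma representative_admissible p r m s :
  (p \in [:: 2; 3; 5; 7])%N -> r = (48 %/ (p.-1 * p.+1))%N ->
  representative r p m s -> admissible p r s.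
Proof.
rewrite !inE => /or4P[]/eqP -> /= ->.
- have -> : (48 %/ (1 * 3) = 16)%N by [].
  have gsum g : g \in glue_code 16 2 -> \sum_i g 0 i = 0.
    by rewrite /glue_code /= inE => /andP[/eqP].
  case.
    rewrite !inE => /orP[]/eqP[_ ->].
      by admissible_by 0%N; right.
    by admissible_by 1%N; left.
  move=> [_ [h [hdual _ _ hs _]]].
  have hF (x : 'F_2) : x != 0 -> x = 1.
    by case: x => [[|[|]]] // lt _; apply: val_inj.
  split=> [i|g gG].
    have := hs i; case: ifP => _; last by move/eqP->; rewrite label_sumE.
    by rewrite !inE => /orP[]/eqP->; rewrite label_sumE.
  move: hdual; rewrite inE => /forallP/(_ g)/implyP/(_ gG)/eqP hg.
  rewrite -[RHS]hg.
  apply: eq_bigr => i _; rewrite mulrC; congr (_ * _).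
  have := hs i; case: eqP => [->|/eqP/hF->].
    by rewrite !inE => /orP[]/eqP->; rewrite label_classE /=; apply: val_inj.
  by move/eqP->; rewrite label_classE; apply: val_inj.
- have -> : (48 %/ (2 * 4) = 6)%N by [].
  have gsum g : g \in glue_code 6 3 -> \sum_i g 0 i = 0.
    by rewrite /glue_code /= inE => /eqP.
  case.
    rewrite !inE => /or4P[]/eqP[_ ->].
    + by admissible_by 0%N; right.
    + by admissible_by 2%N; left.
    + by admissible_by 1%N; left.
    + by admissible_by 0%N; right.
  move=> [_ perm]; have sz : size s = 6%N by rewrite (perm_size perm).
  have mem i : (i < 6)%N -> nth [::] s i \in [:: [:: 1; 1; 1]; [:: 3; 0; 0]]%N.
    move=> lt; have : nth [::] s i \in s by rewrite mem_nth ?sz.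
    rewrite (perm_mem perm) /= !inE.
    by case: (_ == [:: 1; 1; 1]%N); case: (_ == [:: 3; 0; 0]%N).
  apply: (admissible_const (k := 0)) => [i|i|]; last by right.
    by have := mem i (ltn_ord i); rewrite !inE => /orP[]/eqP->; rewrite label_sumE.
  have := mem i (ltn_ord i); rewrite !inE => /orP[]/eqP->; rewrite label_classE;
    exact: val_inj.
- have -> : (48 %/ (4 * 6) = 2)%N by [].
  rewrite /representative !inE.
  by do ![case/orP] => /eqP[_ ->]; admissible_by 0%N; right.
have -> : (48 %/ (6 * 8) = 1)%N by [].
rewrite /representative !inE.
by do ![case/orP] => /eqP[_ ->]; admissible_by 0%N; right.
Qed.

Section Orbits.
Variables (p r : nat) (o : 'I_p).
Hypothesis o0 : o = 0%N :> nat.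
Hypothesis pp : prime p.
Implicit Types (g h : 'rV['F_p]_r) (Lam : 'M[int]_(r, p)) (n : 'rV[int]_p).

Local Notation G := (glue_code r p).

Lemma Fp_add (a b : 'F_p) : (a + b)%R = ((a + b) %% p)%N :> nat.
Proof. by rewrite /= [X in (_ %% X)%N](Fp_cast pp). Qed.

Lemma current0 n : current 0 n = n.
Proof. by apply/rowP=> j; rewrite mxE. Qed.

Lemma row_currents g Lam i : row i (currents g Lam) = current (g 0 i) (row i Lam).
Proof. by apply/rowP=> j; rewrite [LHS]mxE [LHS]mxE. Qed.

Lemma currentsD g h Lam : currents (g + h) Lam = currents g (currents h Lam).
Proof.
apply/row_matrixP => i; rewrite !row_currents [(g + h) 0 i]mxE Fp_add.
by rewrite (current_modn o) currentD addnC.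
Qed.

Lemma currents0 Lam : currents 0 Lam = Lam.
Proof. by apply/row_matrixP => i; rewrite row_currents mxE current0. Qed.

Lemma currentsK g Lam : currents (- g) (currents g Lam) = Lam.
Proof. by rewrite -currentsD addNr currents0. Qed.

Lemma currentsNK g Lam : currents g (currents (- g) Lam) = Lam.
Proof. by rewrite -currentsD subrr currents0. Qed.

Lemma glue_code_sub g h : g \in G -> h \in G -> g - h \in G.
Proof.
have subE i : (g - h) 0 i = g 0 i - h 0 i by rewrite !mxE.
rewrite /glue_code; case: (p == 2); last case: (p == 3); rewrite !inE //.
  move=> /andP[/eqP g0 /forallP gk] /andP[/eqP h0 /forallP hk].
  apply/andP; split; [|apply/forallP => k].
    by under eq_bigr => i _ do rewrite subE; rewrite sumrB g0 h0 subrr.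
  under eq_bigr => i _ do rewrite subE.
  by rewrite sumrB (eqP (gk k)) (eqP (hk k)) subrr.
move=> /eqP g0 /eqP h0.
by under eq_bigr => i _ do rewrite subE; rewrite sumrB g0 h0 subrr.
Qed.

Lemma glue_code0 : 0 \in G.
Proof.
rewrite /glue_code; case: (p == 2); last case: (p == 3); rewrite !inE //.
  apply/andP; split; [|apply/forallP => k];
    by rewrite big1 // => i _; rewrite mxE.
by rewrite big1 // => i _; rewrite mxE.
Qed.

Lemma glue_codeN g : g \in G -> - g \in G.
Proof. by move=> gG; rewrite -[- g]add0r; apply: glue_code_sub => //; exact: glue_code0. Qed.

Lemma glue_codeD g h : g \in G -> h \in G -> g + h \in G.
Proof. by move=> gG hG; rewrite -[h]opprK; apply: glue_code_sub => //; exact: glue_codeN. Qed.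

Lemma occurs_with_currents m g Lam : g \in G ->
  occurs_with m (currents g Lam) <-> occurs_with m Lam.
Proof.
have H h Lam' : h \in G -> occurs_with m Lam' -> occurs_with m (currents h Lam').
  move=> hG [s [rs [g' g'G ->]]]; exists s; split=> //.
  by exists (h + g'); [exact: glue_codeD | rewrite currentsD].
by move=> gG; split=> [/(H _ _ (glue_codeN gG))|]; [rewrite currentsK | exact: H].
Qed.

Lemma highest_weights_currents g Lam : g \in G ->
  highest_weights r p (currents g Lam) <-> highest_weights r p Lam.
Proof.
by move=> gG; split=> -[m mP]; exists m; apply/(occurs_with_currents m Lam gG).
Qed.

Lemma multiplicity_currents g Lam : g \in G ->
  multiplicity (currents g Lam) = multiplicity Lam.
Proof.
move=> gG; rewrite /multiplicity; congr xget; apply/funext => m.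
by apply/propext; exact: occurs_with_currents.
Qed.

Definition weight_cls n : int := \sum_j n 0 j * (j : nat)%:Z.

Lemma pFp : p%:R = 0 :> 'F_p.
Proof. by rewrite -(Fp_nat_mod pp) modnn. Qed.

(** Rotating the labels adds the level, which is p, up to multiples of p. *)
Lemma weight_cls_current a n : level n = p%:Z ->
  (weight_cls (current a n))%:~R = (weight_cls n)%:~R :> 'F_p.
Proof.
move=> ln; elim: a => [|a IH]; first by rewrite current0.
have -> : current a.+1 n = current 1 (current a n) by rewrite currentD addn1.
rewrite -IH; move: (current a n) (level_current a n) => n' ln'.
rewrite /weight_cls (reindex_inj (@ordS_inj p)) /= !rmorph_sum /=.
have E (j : 'I_p) : (current 1 n' 0 (ordS j) * (j.+1 %% p)%N%:Z)%:~R =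
    (n' 0 j * j%:Z)%:~R + (n' 0 j)%:~R :> 'F_p.
  rewrite mxE /= ordSK !rmorphM /= -!pmulrn (Fp_nat_mod pp) -natr1.
  by rewrite mulrDr mulr1.
rewrite (eq_bigr _ (fun j _ => E j)) big_split /= -[X in _ + X]rmorph_sum.
by rewrite -/(level n') ln' ln /= -[_%:~R]pmulrn pFp addr0.
Qed.

Hypothesis hp : (p \in [:: 2; 3; 5; 7])%N.
Hypothesis hr : r = (48 %/ (p.-1 * p.+1))%N.

Lemma weights_of_seq_level s i : (admissible p r s) ->
  dominant (row i (weights_of_seq r p s)).
Proof.
move=> [hl _]; split=> [|j]; last by rewrite !mxE.
rewrite -[in RHS](hl i) /level /label_sum -[RHS]natz natr_sum.
by apply: eq_bigr => j _; rewrite !mxE natz.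
Qed.

Lemma highest_weight_dominant Lam i : highest_weights r p Lam ->
  dominant (row i Lam).
Proof.
move=> [m [s [rs [g gG ->]]]]; rewrite row_currents.
apply: dominant_current; apply: weights_of_seq_level.
exact: representative_admissible rs.
Qed.

(** The classes of the components of a highest weight form a word of the dual
    code: this holds for the representatives by inspection, and
    currents preserve the classes. *)
Lemma highest_weight_class Lam g : highest_weights r p Lam -> g \in G ->
  \sum_i (weight_cls (row i Lam))%:~R * g 0 i = 0 :> 'F_p.
Proof.
move=> [m [s [rs [g' g'G ->]]]] gG.
have adm := representative_admissible hp hr rs; have [_ hc] := adm.
rewrite -[RHS](hc g gG); apply: eq_bigr => i _; congr (_ * _).
have [ll _] := weights_of_seq_level i adm.
rewrite row_currents weight_cls_current // /weight_cls /label_class.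
rewrite natr_sum rmorph_sum; apply: eq_bigr => j _.
by rewrite !mxE -PoszM /= -[_%:~R]pmulrn.
Qed.

Lemma highest_weights_finite : finite_set (highest_weights r p).
Proof.
pose f (x : {ffun 'I_r * 'I_p -> 'I_p.+1}) : 'M[int]_(r, p) :=
  \matrix_(i, j) (x (i, j) : nat)%:Z.
apply: (sub_finite_set (B := range f)); last exact: finite_image.
move=> Lam hL; exists [ffun u => inord `|Lam u.1 u.2|%N] => //.
apply/matrixP=> i j; rewrite mxE ffunE /=.
have [ll dom] := highest_weight_dominant i hL.
have pos l : 0 <= Lam i l by have := dom l; rewrite mxE.
have le : Lam i j <= p%:Z.
  rewrite -ll /level (bigD1 j) //= mxE lerDl; apply: sumr_ge0 => l _.
  by rewrite mxE.
rewrite inordK ?gez0_abs // ltnS; have := pos j; lia.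
Qed.

End Orbits.

(** * Convergence of the theta series *)

Lemma abs_summable_support (K : numFieldType) (T T' : choiceType) (h : T' -> T)
    (h' : T -> T') (f : T -> K) :
  (forall t, f t != 0 -> h (h' t) = t) -> abs_summable (f \o h) -> abs_summable f.
Proof.
move=> hh' [b fb]; exists b => A.
apply: le_trans (fb [fset h' t | t in [fset t in A | f t != 0]]%fset).
rewrite big_imfset /=; last first.
  move=> x y; rewrite !inE /= => /andP[_ fx] /andP[_ fy] E.
  by rewrite -(hh' x fx) -(hh' y fy) E.
rewrite (big_fsetID _ (fun t => f t != 0) A) /= [X in _ + X]big1_seq ?addr0.
  rewrite big_seq [leRHS]big_seq; apply: ler_sum => t; rewrite !inE /=.
  by move=> /andP[_ ft]; rewrite hh'.
by move=> t /andP[_]; rewrite !inE /= negbK => /andP[_ /eqP->]; rewrite normr0.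
Qed.

Section Gaussian.
Variable R : realType.

Lemma abs_summable_geometric (rho : R) : 0 <= rho -> rho < 1 ->
  abs_summable (fun n : nat => rho ^+ n).
Proof.
move=> r0 r1; exists (1 - rho)^-1 => A.
have d0 : 0 < 1 - rho by rewrite subr_gt0.
have [n An] : exists n, forall x : nat, x \in A -> (x < n)%N.
  exists (\max_(x <- A) x)%N.+1 => x xA; rewrite ltnS.
  exact: (leq_bigmax_seq (F := fun x : nat => x) x xA isT).
pose B : {fset nat} := [fset i in iota 0 n]%fset.
apply: le_trans (_ : \sum_(x <- B) rho ^+ x <= _).
  under eq_bigr => x _ do rewrite ger0_norm ?exprn_ge0 //.
  apply: sum_fset_le => [|x]; last exact: exprn_ge0.
  by apply/fsubsetP => x /An lt; rewrite !inE /= mem_iota.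
have -> : \sum_(x <- B) rho ^+ x = \sum_(i < n) rho ^+ i.
  rewrite -(big_mkord xpredT (fun i => rho ^+ i)) /index_iota subn0.
  apply: perm_big; apply: uniq_perm; [exact: fset_uniq|exact: iota_uniq|].
  by move=> x; rewrite !inE.
rewrite -[leRHS]mul1r ler_pdivlMr // mulrC -[1 - rho]opprB mulNr -subrX1.
by rewrite opprB lerBlDr lerDl exprn_ge0.
Qed.

Lemma abs_summableD (T : choiceType) (f g : T -> R) :
  abs_summable f -> abs_summable g -> abs_summable (fun t => f t + g t).
Proof.
move=> [b fb] [c gc]; exists (b + c) => A; apply: le_trans (lerD (fb A) (gc A)).
by rewrite -big_split; apply: ler_sum => t _; exact: ler_normD.
Qed.

(** On the fractions with denominator p, a Gaussian is dominated by a multiple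
    of e^(-|t|), hence by two geometric series. *)
Lemma abs_summable_gaussian (p : nat) (a b : R) : (0 < p)%N -> 0 < a ->
  abs_summable (fun t : R =>
    if p%:R * t \is a Num.int then expR (- (a * t ^+ 2 + b * t)) else 0).
Proof.
move=> p0 a0; have p0R : 0 < p%:R :> R by rewrite ltr0n.
pose rho : R := expR (- p%:R^-1).
pose f (t : R) := if (p%:R * t \is a Num.int) && (0 <= t) then expR (- t) else 0.
have fS : abs_summable f.
  apply: (abs_summable_support (h := fun n : nat => n%:R / p%:R)
    (h' := fun t => `|Num.floor (p%:R * t)|%N)) => [t|].
    rewrite /f; case: ifP => [/andP[pt t0] _|]; last by rewrite eqxx.
    rewrite natr_absz ger0_norm ?floor_ge0 ?mulr_ge0 // ?ltW //.
    by move: pt; rewrite intrEfloor => /eqP->; rewrite mulrC mulKf ?gt_eqF.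
  have : abs_summable (fun n : nat => rho ^+ n).
    by apply: abs_summable_geometric; rewrite ?expR_ge0 // expR_lt1 oppr_lt0 invr_gt0.
  move/abs_summable_le; apply => n /=; rewrite /f mulrC divfK ?gt_eqF //.
  rewrite natr_int divr_ge0 ?ler0n //=.
  by rewrite -expRM_natl mulrN mulrC.
have gS : abs_summable (fun t => f (- t)) := abs_summable_inj (@oppr_inj _) fS.
(* Completing the square in a t^2 - (1 + |b|) |t|. *)
pose c := (1 + `|b|) ^+ 2 / (4 * a).
apply: (abs_summable_le (abs_summableZ (expR c) (abs_summableD fS gS))) => t.
case: ifP => pt; last by rewrite normr0.
have f0 s : 0 <= f s by rewrite /f; case: ifP => // _; exact: expR_ge0.
rewrite [leRHS]ger0_norm ?mulr_ge0 ?addr_ge0 ?expR_ge0 //.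
rewrite ger0_norm ?expR_ge0 //.
have key : - (a * t ^+ 2 + b * t) <= c - `|t|.
  rewrite -subr_ge0.
  have : 0 <= a * (`|t| - (1 + `|b|) / (2 * a)) ^+ 2.
    by rewrite mulr_ge0 ?sqr_ge0 // ltW.
  have -> : a * (`|t| - (1 + `|b|) / (2 * a)) ^+ 2 =
      a * t ^+ 2 - (1 + `|b|) * `|t| + c.
    rewrite -[t ^+ 2]real_normK ?num_real // /c; field.
    by rewrite gt_eqF.
  have := ler_norm (- (b * t)); rewrite normrN normrM; lra.
have e : expR (- (a * t ^+ 2 + b * t)) <= expR c * expR (- `|t|).
  by rewrite -expRD ler_expR.
apply: le_trans e _; rewrite ler_wpM2l ?expR_ge0 //.
have [t0|t0] := leP 0 t.
  have -> : f t = expR (- `|t|) by rewrite /f pt t0 ger0_norm.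
  by rewrite lerDl.
have -> : f (- t) = expR (- `|t|).
  by rewrite /f mulrN rpredN pt oppr_ge0 ltW //= ltr0_norm.
by rewrite lerDr.
Qed.

End Gaussian.

Section ThetaSummable.
Local Open Scope complex_scope.
Variable R : realType.

Lemma norm_e (x : R[i]) : `|e x| = (expR (- (2 * pi * complex.Im x)))%:C.
Proof.
rewrite /e normrM [X in _ * X]normc_def /= cos2Dsin2 sqrtr1 mulr1.
by rewrite normc_def /= expr0n addr0 sqrtr_sqr ger0_norm ?expR_ge0.
Qed.

Lemma abs_summable_complex (T : choiceType) (f : T -> R[i]) (g : T -> R) :
  abs_summable g -> (forall t, `|f t| <= (`|g t|)%:C) -> abs_summable f.
Proof.
move=> [b gb] fg; exists b%:C => A.
apply: le_trans (_ : (\sum_(x <- A) `|g x|)%:C <= _).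
  by rewrite rmorph_sum; apply: ler_sum => t _; exact: fg.
by rewrite lecR; exact: gb.
Qed.

Variables (p : nat) (o : 'I_p).
Local Notation weight_lattice := (dual_lattice (root_lattice R p)).

Definition theta_term (tau : R[i]) (z : 'rV[R[i]]_p) (u : R[i])
    (v : 'rV[R]_p) : R[i] :=
  e (p%:R * u) * e (tau * (dot v v / (2 * p)%:R)%:C + dot (toC v) z).

Lemma weight_lattice_frac (v : 'rV[R]_p) j : weight_lattice v ->
  p%:R * v 0 j \is a Num.int.
Proof.
move=> /(weight_latticeP o)[sv dv].
have -> : p%:R * v 0 j = \sum_k (v 0 j - v 0 k).
  by rewrite sumrB sv subr0 sumr_const card_ord mulr_natl.
by apply: rpred_sum => k _.
Qed.

Lemma Im_sum (I : Type) (s : seq I) (f : I -> R[i]) :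
  complex.Im (\sum_(i <- s) f i) = \sum_(i <- s) complex.Im (f i).
Proof. by elim/big_rec2: _ => //= i x y _ <-; case: (f i) y => ? ? []. Qed.

Lemma Im_mulr (x : R[i]) (y : R) : complex.Im (x * y%:C) = complex.Im x * y.
Proof. by case: x => a b /=; rewrite mulr0 add0r. Qed.

Lemma theta_term_summable (tau : R[i]) z u : 0 < complex.Im tau ->
  abs_summable (fun v => if v \in weight_lattice then theta_term tau z u v else 0).
Proof.
move=> tau0; have p0 : (0 < p)%N by case: (p) o => [[]|].
have p0R : 0 < p%:R :> R by rewrite ltr0n.
pose a := pi * complex.Im tau / p%:R : R.
have a0 : 0 < a by rewrite /a divr_gt0 ?mulr_gt0 ?pi_gt0.
pose b j := 2 * pi * complex.Im (z 0 j) : R.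
pose psi j (t : R) : R :=
  if p%:R * t \is a Num.int then expR (- (a * t ^+ 2 + b j * t)) else 0.
have psiS : abs_summable (fun v : 'rV[R]_p => \prod_j psi j (v 0 j)).
  apply: (abs_summable_prod (pr := fun (v : 'rV[R]_p) j => v 0 j)
      (mk := fun f => \row_j f j)) => [v|f j|j].
  - by apply/rowP=> j; rewrite mxE.
  - by rewrite mxE.
  - exact: abs_summable_gaussian.
pose c0 := expR (- (2 * pi * complex.Im (p%:R * u))).
apply: (abs_summable_complex (abs_summableZ c0 psiS)) => v.
case: ifP => [/set_mem wv|_]; last by rewrite normr0 lecR.
rewrite /theta_term normrM !norm_e -rmorphM lecR /= normrM.
apply: ler_pM; rewrite ?expR_ge0 //; first exact: ler_norm.
apply: le_trans (ler_norm _).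
have -> : \prod_j psi j (v 0 j) =
    \prod_j expR (- (a * v 0 j ^+ 2 + b j * v 0 j)).
  by apply: eq_bigr => j _; rewrite /psi weight_lattice_frac.
rewrite -expR_sum ler_expR sumrN lerN2 le_eqVlt; apply/orP; left; apply/eqP.
rewrite raddfD /= Im_mulr (dotE (toC v)) Im_sum big_split /= -mulr_sumr mulrDr.
congr (_ + _).
  rewrite dotE /a; under eq_bigr => j _ do rewrite expr2.
  by rewrite natrM; field; rewrite gt_eqF.
rewrite mulr_sumr; apply: eq_bigr => j _.
by rewrite /b mxE [_ * z 0 j]mulrC Im_mulr; ring.
Qed.

End ThetaSummable.

(** * The lattice of the code and its dual *)

Lemma finite_set_inj_fin (T : choiceType) (I : finType) (A : set T) (f : T -> I) :
  (forall x y, A x -> A y -> f x = f y -> x = y) -> finite_set A.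
Proof.
move=> inj; pose pick_in (i : I) := [set x | A x /\ f x = i].
have [[x0]|noT] := pselect (inhabited T); last first.
  suff -> : A = set0 by exact: finite_set0.
  by apply/seteqP; split=> // x _; apply: noT.
pose g i := xget x0 (pick_in i).
apply: (sub_finite_set (B := range g)); last exact: finite_image.
move=> x Ax; exists (f x) => //; rewrite /g; case: xgetP => [y _ [Ay fy]|/(_ x)].
  exact: inj.
by case; split.
Qed.

Lemma dot_rows (F : comNzRingType) (m n : nat) (x y : 'M[F]_(m, n)) :
  dot x y = \sum_i dot (row i x) (row i y).
Proof.
rewrite /dot /mxtrace; apply: eq_bigr => i _.
rewrite mxE big_ord1 mxE; apply: eq_bigr => j _; by rewrite !mxE.
Qed.

Section Lattice.
Variables (R : realType) (p r : nat) (o : 'I_p).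
Hypothesis o0 : o = 0%N :> nat.
Hypothesis pp : prime p.

Local Notation weight_lattice := (dual_lattice (root_lattice R p)).
Local Notation G := (glue_code r p).
Local Notation L := (code_lattice R G).
Local Notation sp := (@Num.sqrt R p%:R).

Lemma p_gt0R : 0 < p%:R :> R. Proof. by rewrite ltr0n prime_gt0. Qed.
Lemma p_neq0R : p%:R != 0 :> R. Proof. by rewrite gt_eqF // p_gt0R. Qed.
Lemma sp_neq0 : sp != 0. Proof. by rewrite gt_eqF // sqrtr_gt0 p_gt0R. Qed.
Lemma sp_sq : sp * sp = p%:R. Proof. by rewrite -expr2 sqr_sqrtr // ltW ?p_gt0R. Qed.

(** Membership in the weight lattice together with a lift c of the class modulo
    the root lattice: the fundamental weight of index c has coordinates -c/p
    modulo 1. *)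
Definition in_class (x : 'rV[R]_p) (c : int) : Prop :=
  \sum_j x 0 j = 0 /\ forall j, x 0 j + c%:~R / p%:R \is a Num.int.

(** The discriminant form is minus the product of the classes over p. *)
Lemma dot_in_class (x y : 'rV[R]_p) c d : in_class x c -> in_class y d ->
  dot x y + (c * d)%:~R / p%:R \is a Num.int.
Proof.
move=> [sx ix] [sy iy].
have -> : dot x y + (c * d)%:~R / p%:R =
    \sum_j (x 0 j + c%:~R / p%:R) * (y 0 j + d%:~R / p%:R).
  under eq_bigr => j _ do rewrite mulrDl !mulrDr.
  rewrite !big_split /= -mulr_suml -mulr_sumr sx sy mul0r mulr0 addr0 add0r.
  rewrite -dotE sumr_const card_ord rmorphM -mulr_natr /=; congr (_ + _).
  by field; rewrite p_neq0R.
by apply: rpred_sum => j _; rewrite rpredM.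
Qed.

Lemma in_class_bar n : in_class (bar R n) (weight_cls n).
Proof.
split=> [|j]; first exact: bar_sum.
rewrite barE /weight_cls rmorph_sum mulr_suml -big_split /=.
apply: rpred_sum => k _; rewrite rmorphM /= -pmulrn.
have -> : (n 0 k)%:~R * ((j < k)%N%:R - k%:R / p%:R) + (n 0 k)%:~R * k%:R / p%:R =
    (n 0 k)%:~R * (j < k)%N%:R :> R by ring.
by rewrite rpredM ?intr_int ?natr_int.
Qed.

Lemma in_class_shift (x y : 'rV[R]_p) c : in_class x c -> \sum_j y 0 j = 0 ->
  (forall j, y 0 j - x 0 j \is a Num.int) -> in_class y c.
Proof.
move=> [sx ix] sy iyx; split=> // j.
by rewrite -(subrK (x 0 j) (y 0 j)) -addrA rpredD.
Qed.

Lemma in_class_fundamental a : (a < p)%N ->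
  in_class (fundamental_weight R p a) a%:Z.
Proof.
move=> lt; split=> [|j].
  under eq_bigr => j _ do rewrite mxE.
  exact: (sum_fundamental R o (Ordinal lt)).
by rewrite mxE -pmulrn subrK natr_int.
Qed.

Lemma Fp_lt (a : 'F_p) : (a < p)%N.
Proof. by have := ltn_ord a; rewrite [X in (_ < X)%N](Fp_cast pp). Qed.

Lemma code_lattice_class (y : 'M[R]_(r, p)) (g : 'rV['F_p]_r) :
  (forall i, weight_lattice (row i y)) ->
  (forall i, root_lattice R p (row i y - fundamental_weight R p (g 0 i))) ->
  forall i, in_class (row i y) (g 0 i : nat)%:Z.
Proof.
move=> wy ry i; apply: in_class_shift (in_class_fundamental (Fp_lt (g 0 i))) _ _.
  by have /(weight_latticeP o)[] := wy i.
have subE (u v : 'rV[R]_p) l : (u - v) 0 l = u 0 l - v 0 l by rewrite !mxE.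
by move=> j; have [_ /(_ j)] := ry i; rewrite subE.
Qed.

Lemma int_divp (m : int) : (m%:~R : 'F_p) = 0 -> (m%:~R / p%:R : R) \is a Num.int.
Proof.
move=> m0; suff /dvdzP[k ->] : (p%:Z %| m)%Z.
  by rewrite rmorphM /= -pmulrn mulfK ?p_neq0R // intr_int.
have E (k : nat) : (k%:R : 'F_p) = 0 -> (p %| k)%N.
  by move=> /(congr1 val) /=; rewrite val_Fp_nat // => /eqP.
case: m m0 => k; first by rewrite -pmulrn dvdzE => /E.
rewrite NegzE rmorphN /= => /eqP; rewrite oppr_eq0 -[_%:~R]pmulrn => /eqP/E.
by rewrite dvdzE. 
Qed.

Lemma dot_code (x : 'M[R]_(r, p)) (c : 'I_r -> int) y : (forall i, in_class (row i x) (c i)) -> L y ->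
  (forall g, g \in G -> \sum_i (c i)%:~R * g 0 i = 0 :> 'F_p) ->
  dot x y \is a Num.int.
Proof.
move=> xc [wy [g gG ry]] cG; have yg := code_lattice_class wy ry.
have : \sum_i (dot (row i x) (row i y) + (c i * (g 0 i : nat)%:Z)%:~R / p%:R)
    \is a Num.int.
  by apply: rpred_sum => i _; apply: dot_in_class.
rewrite big_split /= -dot_rows -mulr_suml -rmorph_sum => h.
rewrite -[dot x y](addrK ((\sum_i c i * (g 0 i : nat)%:Z)%:~R / p%:R)).
rewrite rpredB //; apply: int_divp; rewrite -[RHS](cG g gG) rmorph_sum.
apply: eq_bigr => i _; rewrite rmorphM /= -pmulrn; congr (_ * _).
exact: natr_Zp.
Qed.

Local Notation N := (scaled sp L).
Local Notation N' := (dual_lattice N).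

Lemma root_code (i : 'I_r) (x : 'rV[R]_p) : root_lattice R p x ->
  L (\matrix_(k, j) (if k == i then x 0 j else 0)).
Proof.
move=> rx; have rk k : root_lattice R p
    (row k (\matrix_(k, j) (if k == i then x 0 j else 0))).
  case: rx => tx ix; split=> [l|j]; last by rewrite !mxE; case: ifP.
  under eq_bigr => j _ do rewrite !mxE.
  by case: (k == i); [exact: tx | rewrite big1].
split=> [k|]; first exact: root_weight.
exists 0 => [|k]; first exact: glue_code0.
have -> : fundamental_weight R p ((0%R : 'rV['F_p]_r) 0%R k) = 0.
  by apply/rowP=> j; rewrite !mxE /= mul0r subr0.
by rewrite subr0.
Qed.

Lemma dual_rows (x : 'M[R]_(r, p)) i : N' x -> weight_lattice (sp *: row i x).
Proof.
move=> [tx dx]; split=> [k|y ry].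
  under eq_bigr => j _ do rewrite !mxE.
  by rewrite -mulr_sumr tx mulr0.
pose y' : 'M[R]_(r, p) := \matrix_(k, j) (if k == i then y 0 j else 0).
have := dx (sp *: y') (ex_intro2 _ _ y' (root_code i ry) erefl).
suff -> : dot x (sp *: y') = dot (sp *: row i x) y by [].
rewrite dot_rows (bigD1 i) //= [X in _ + X]big1 ?addr0 => [|k /negPf ki].
  by rewrite !dotE; apply: eq_bigr => j _; rewrite !mxE eqxx mulrCA mulrA.
by rewrite dotE big1 // => j _; rewrite !mxE ki mulr0 mulr0.
Qed.

Lemma dual_of_class (x : 'M[R]_(r, p)) (c : 'I_r -> int) :
  (forall i, in_class (row i x) (c i)) ->
  (forall g, g \in G -> \sum_i (c i)%:~R * g 0 i = 0 :> 'F_p) ->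
  N' (sp^-1 *: x).
Proof.
move=> xc cG; split=> [i|_ [y Ly <-]].
  under eq_bigr => j _ do rewrite mxE.
  rewrite -mulr_sumr; have [si _] := xc i.
  have -> : \sum_j x i j = \sum_j row i x 0 j by apply: eq_bigr => j _; rewrite mxE.
  by rewrite si mulr0.
have -> : dot (sp^-1 *: x) (sp *: y) = dot x y.
  rewrite /dot linearZ /= -scalemxAl -scalemxAr scalerA mulVf ?sp_neq0 //.
  by rewrite scale1r.
exact: dot_code xc Ly cG.
Qed.

Lemma dual_latticeD x y : N' x -> N' y -> N' (x + y).
Proof.
move=> [tx dx] [ty dy]; split=> [i|w Nw].
  under eq_bigr => j _ do rewrite mxE.
  by rewrite big_split /= tx ty addr0.
by rewrite dotDl rpredD // ?dx ?dy.
Qed.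

Lemma N_sub_dual x : N x -> N' x.
Proof.
move=> [y Ly <-]; have [wy [g gG ry]] := Ly; have yg := code_lattice_class wy ry.
split=> [i|_ [w [ww [h hG rw]] <-]].
  under eq_bigr => j _ do rewrite mxE.
  rewrite -mulr_sumr; have /(weight_latticeP o)[si _] := wy i.
  have -> : \sum_j y i j = \sum_j row i y 0 j by apply: eq_bigr => j _; rewrite mxE.
  by rewrite si mulr0.
have wh := code_lattice_class ww rw.
have -> : dot (sp *: y) (sp *: w) = p%:R * dot y w.
  rewrite /dot linearZ /= -scalemxAl -scalemxAr scalerA sp_sq.
  by rewrite linearZ.
rewrite dot_rows mulr_sumr; apply: rpred_sum => i _.
have := dot_in_class (yg i) (wh i); set d := dot _ _ => hd.
rewrite -[d](addrK (((g 0 i : nat)%:Z * (h 0 i : nat)%:Z)%:~R / p%:R)) mulrBr.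
apply: rpredB; first by apply: rpredM => //; exact: natr_int.
by rewrite mulrC divfK ?p_neq0R // intr_int.
Qed.

Lemma coset_sub_dual x y : N' x -> coset x N y -> N' y.
Proof. by move=> Nx [w Nw <-]; apply: dual_latticeD => //; exact: N_sub_dual. Qed.

(** The coordinates of a weight, as numerators of fractions over p. *)
Definition frac_num (v : 'rV[R]_p) (j : 'I_p) : int := Num.floor (p%:R * v 0 j).

Lemma weight_lattice_mod (v w : 'rV[R]_p) : weight_lattice v -> weight_lattice w ->
  (forall j, (frac_num v j = frac_num w j %[mod (p * p)%N%:Z])%Z) ->
  scaled p%:R (root_lattice R p) (v - w).
Proof.
move=> wv ww E; exists (p%:R^-1 *: (v - w)); last first.
  by rewrite scalerA divff ?p_neq0R // scale1r.
have [sv _] := (weight_latticeP o v).1 wv; have [sw _] := (weight_latticeP o w).1 ww.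
split=> [i|j].
  rewrite ord1; under eq_bigr => j _ do rewrite !mxE.
  by rewrite -mulr_sumr sumrB sv sw subrr mulr0.
have /eqP := E j; rewrite eqz_mod_dvd => /dvdzP[k Ek].
have fl (x : 'rV[R]_p) : weight_lattice x ->
    p%:R * x 0 j = (frac_num x j)%:~R.
  by move=> wx; apply/esym/eqP; rewrite -intrEfloor weight_lattice_frac.
rewrite !mxE.
have -> : v 0 j - w 0 j = p%:R^-1 * (p%:R * v 0 j - p%:R * w 0 j).
  by rewrite -mulrBr mulKf ?p_neq0R.
rewrite !fl // -rmorphB /= Ek rmorphM /= -pmulrn natrM.
have -> : p%:R^-1 * (p%:R^-1 * (k%:~R * (p%:R * p%:R))) = k%:~R :> R.
  by field; rewrite p_neq0R.
exact: intr_int.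
Qed.

(** Finitely many values, which determine a weight modulo p times the root
    lattice. *)
Definition residue (v : 'rV[R]_p) (j : 'I_p) : 'I_(p * p).+1 :=
  inord `|(frac_num v j %% (p * p)%N%:Z)%Z|%N.

Lemma residueP v w j : residue v j = residue w j ->
  (frac_num v j = frac_num w j %[mod (p * p)%N%:Z])%Z.
Proof.
have pp0 : (0 < p * p)%N by rewrite muln_gt0 prime_gt0.
have ge0 (m : int) : 0 <= (m %% (p * p)%N%:Z)%Z by rewrite modz_ge0 // gt_eqF.
have lt (m : int) : (`|(m %% (p * p)%N%:Z)%Z| < (p * p).+1)%N.
  by have := ltz_pmod m (d := (p * p)%N%:Z); have := ge0 m; lia.
move=> /(congr1 val); rewrite /residue /= !inordK // => E.
by rewrite -(gez0_abs (ge0 (frac_num v j))) E gez0_abs.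
Qed.

Lemma weight_reps_finite (Q : set 'rV[R]_p) :
  representatives weight_lattice
    (fun x y => scaled p%:R (root_lattice R p) (x - y)) Q -> finite_set Q.
Proof.
move=> [QW Qrep].
apply: (finite_set_inj_fin (f := fun v => [ffun j => residue v j])) => v w Qv Qw E.
have [y [[Qy _] uy]] := Qrep v (QW _ Qv).
have self : scaled p%:R (root_lattice R p) (v - v).
  rewrite subrr; exists 0; last by rewrite scaler0.
  by split=> [i|j]; rewrite ?mxE ?rpred0 // big1 // => j _; rewrite mxE.
have vw : scaled p%:R (root_lattice R p) (v - w).
  apply: weight_lattice_mod => [||j]; [exact: QW|exact: QW|apply: residueP].
  by have := congr1 (fun x : {ffun 'I_p -> _} => x j) E; rewrite !ffunE.
by rewrite -(uy v (conj Qv self)) -(uy w (conj Qw vw)).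
Qed.

Lemma dual_reps_finite (S : set 'M[R]_(r, p)) :
  representatives N' (fun x y => N (x - y)) S -> finite_set S.
Proof.
move=> [SN Srep].
apply: (finite_set_inj_fin (f := fun x : 'M[R]_(r, p) =>
  [ffun u : 'I_r * 'I_p => residue (sp *: row u.1 x) u.2])) => v w Sv Sw E.
have [y [[Sy _] uy]] := Srep v (SN _ Sv).
have L0 : L 0.
  split=> [i|].
    by apply: (root_weight o); split=> [k|j]; rewrite ?mxE ?rpred0 // big1 // => j _; rewrite !mxE.
  exists 0 => [|i]; first exact: glue_code0.
  by split=> [k|j]; rewrite ?mxE ?mul0r ?subrr ?rpred0 // big1 // => j _;
    rewrite !mxE /= mul0r !subrr.
have self : N (v - v) by rewrite subrr; exists 0; rewrite ?scaler0.
have vw : N (v - w).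
  exists (sp^-1 *: (v - w)); last by rewrite scalerA divff ?sp_neq0 // scale1r.
  have rt i : root_lattice R p (row i (sp^-1 *: (v - w))).
    have [z rz Ez] : scaled p%:R (root_lattice R p) (sp *: row i v - sp *: row i w).
      apply: weight_lattice_mod => [||j]; [exact: dual_rows (SN _ Sv)|
        exact: dual_rows (SN _ Sw)|apply: residueP].
      by have := congr1 (fun x : {ffun 'I_r * 'I_p -> _} => x (i, j)) E; rewrite !ffunE.
    suff -> : row i (sp^-1 *: (v - w)) = z by [].
    apply: (scalerI p_neq0R); rewrite Ez -scalerBr.
    have -> : row i (sp^-1 *: (v - w)) = sp^-1 *: (row i v - row i w).
      by apply/rowP=> j; rewrite !mxE.
    rewrite scalerA; congr (_ *: _); apply: (mulIf sp_neq0).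
    by rewrite divfK ?sp_neq0 // sp_sq.
  split=> [i|]; first exact: root_weight.
  exists 0 => [|i]; first exact: glue_code0.
  have -> : fundamental_weight R p ((0%R : 'rV['F_p]_r) 0%R i) = 0.
    by apply/rowP=> j; rewrite !mxE /= mul0r subr0.
  by rewrite subr0.
by rewrite -(uy v (conj Sv self)) -(uy w (conj Sw vw)).
Qed.

End Lattice.

(** * The coefficients of the expansion *)

Section Coefficients.
Variables (R : realType) (p r : nat) (o : 'I_p).
Hypothesis o0 : o = 0%N :> nat.
Hypothesis pp : prime p.
Hypothesis hp : (p \in [:: 2; 3; 5; 7])%N.
Hypothesis hr : r = (48 %/ (p.-1 * p.+1))%N.
Variable tau : R[i].

Local Notation weight_lattice := (dual_lattice (root_lattice R p)).
Local Notation G := (glue_code r p).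
Local Notation L := (code_lattice R G).
Local Notation sp := (@Num.sqrt R p%:R).
Local Notation N' := (dual_lattice (scaled sp L)).
Local Notation M := (highest_weights r p).
Local Notation Ms := (fset_set M).
Implicit Types (Lam : 'M[int]_(r, p)) (x y : 'M[R]_(r, p)) (g : 'rV['F_p]_r).

Lemma mem_Ms Lam : (Lam \in Ms) = `[< M Lam >].
Proof.
rewrite in_fset_set; last exact: (highest_weights_finite o0 pp hp hr).
by apply/idP/asboolP => [/set_mem|/mem_set].
Qed.

Lemma string_at_class n (x : 'rV[R]_p) : weight_lattice x ->
  string_at n x tau != 0 -> forall j, x 0 j - bar R n 0 j \is a Num.int.
Proof.
move=> wx nz; have [_ bx] := weight_ofP o0 wx.
have [sc|nsc] := pselect (same_class R n (weight_of x)).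
  by move=> j; have := sc j; rewrite bx.
case/eqP: nz; rewrite /string_at /string_function; apply: csum_has_sum.
apply: (has_sum_ext (f := fun=> 0)) => [d|]; last exact: has_sum0.
by rewrite (mult_class o _ nsc) mul0r if_same.
Qed.

Definition string_prod Lam x : R[i] :=
  \prod_i string_at (row i Lam) (row i x) tau.

Lemma string_prodE Lam x :
  string_prod Lam x = \prod_i string_at (row i Lam) (row i x) tau.
Proof. by []. Qed.

Lemma string_prod_currents g Lam x : M Lam -> (forall i, weight_lattice (row i x)) ->
  \prod_i string_function (row i Lam) (current (g 0 i) (weight_of (row i x))) tau =
  string_prod (currents (- g) Lam) x.
Proof.
move=> hL wx; apply: eq_bigr => i _; rewrite /string_at.
rewrite -[in LHS](currentsNK o pp g Lam) row_currents.
have [lw _] := weight_ofP o0 (wx i).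
have [ll _] : dominant (row i (currents (- g) Lam)).
  have [l d] := highest_weight_dominant hp hr i hL.
  by rewrite row_currents; apply: dominant_current.
exact: (string_function_current o0).
Qed.

Lemma string_prod_shift g Lam x y : M Lam -> (forall i, weight_lattice (row i x)) ->
  (forall i, root_lattice R p (row i y - fundamental_weight R p (g 0 i))) ->
  string_prod (currents g Lam) (x + p%:R *: y) = string_prod Lam x.
Proof.
move=> hL wx ry; apply: eq_bigr => i _; rewrite row_currents.
have -> : row i (x + p%:R *: y) = row i x + p%:R *: row i y.
  by apply/rowP=> j; rewrite !mxE.
have [_ sh] := shifts_by_class o0 (ltnW (Fp_lt pp (g 0 i))) (ry i).
exact: sh (highest_weight_dominant hp hr i hL) (wx i).
Qed.

Lemma string_prod_eq0 Lam x i :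
  string_at (row i Lam) (row i x) tau = 0 -> string_prod Lam x = 0.
Proof. by move=> E; rewrite /string_prod (bigD1 i) //= E mul0r. Qed.

Opaque string_prod string_at string_function.

Lemma sum_currents g (f : 'M[int]_(r, p) -> R[i]) : g \in G ->
  \sum_(Lam <- Ms) f (currents g Lam) = \sum_(Lam <- Ms) f Lam.
Proof.
move=> gG; rewrite -(big_map (currents g) xpredT f); apply: perm_big.
apply: uniq_perm; [|exact: fset_uniq|].
  rewrite map_inj_uniq ?fset_uniq // => a b E.
  by rewrite -(currentsK o pp g a) E (currentsK o pp).
move=> Lam; rewrite mem_Ms; apply/mapP/asboolP => [[a + ->]|hL].
  by rewrite mem_Ms => /asboolP ha; apply/(highest_weights_currents o pp a gG).
exists (currents (- g) Lam); last by rewrite (currentsNK o pp).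
by rewrite mem_Ms; apply/asboolP/(highest_weights_currents o pp) => //; exact: glue_codeN.
Qed.

Definition coef x : R[i] :=
  \sum_(Lam <- Ms) (multiplicity Lam)%:R * string_prod Lam x.

Lemma coefE x :
  coef x = \sum_(Lam <- Ms) (multiplicity Lam)%:R * string_prod Lam x.
Proof. by []. Qed.

(** Translation by p y acts by the currents of the code word of y, which permute
    the highest weights and preserve multiplicities. *)
Lemma coef_shift x y : (forall i, weight_lattice (row i x)) -> L y ->
  coef (x + p%:R *: y) = coef x.
Proof.
move=> wx [wy [g gG ry]]; rewrite /coef.
apply: (etrans (esym (sum_currents
  (fun Lam => (multiplicity Lam)%:R * string_prod Lam (x + p%:R *: y)) gG))).
apply: eq_big_seq => Lam; rewrite mem_Ms => /asboolP hL.
by rewrite (multiplicity_currents o pp Lam gG) (string_prod_shift hL wx ry).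
Qed.

(** A nonzero term forces x to have the classes of a highest weight, which are
    orthogonal to the code. *)
Lemma coef_class x : (forall i, weight_lattice (row i x)) -> coef x != 0 ->
  N' (sp^-1 *: x).
Proof.
move=> wx; apply: contraNP => nN; apply/eqP; rewrite /coef big_seq.
apply: big1 => Lam; rewrite mem_Ms => /asboolP hL.
have [->|nz] := eqVneq (string_prod Lam x) 0; first by rewrite mulr0.
case: nN; apply: (dual_of_class o pp (c := fun i => weight_cls (row i Lam))).
  move=> i /=; apply: (in_class_shift (in_class_bar R o (row i Lam))).
    by have /(weight_latticeP o)[] := wx i.
  apply: string_at_class => //.
  by apply: contraNneq nz => E; apply/eqP; exact: string_prod_eq0 E.
by move=> g gG; exact: (highest_weight_class pp hp hr hL gG).
Qed.

(** Each highest weight arises from the representative of its orbit as many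
    times as the order of the stabilizer. *)
Lemma orbit_sum (O : set 'M[int]_(r, p)) (f : 'M[int]_(r, p) -> R[i]) :
  representatives M (same_orbit r p) O ->
  \sum_(Lam \in O) \sum_(g in G)
    ((multiplicity Lam)%:R / #|stabilizer Lam|%:R * f (currents (- g) Lam)) =
  \sum_(Lam <- Ms) (multiplicity Lam)%:R * f Lam.
Proof.
move=> [OM Orep].
have finO : finite_set O.
  by apply: sub_finite_set OM _; exact: (highest_weights_finite o0 pp hp hr).
have stab0 Lam : #|stabilizer Lam|%:R != 0 :> R[i].
  rewrite pnatr_eq0 -lt0n; apply/card_gt0P; exists 0.
  by rewrite inE glue_code0 currents0 eqxx.
rewrite fsbig_finite //=.
(* The number of code words that carry Lam to Lam'. *)
pose hit Lam Lam' : R[i] := \sum_(g in G) (currents g Lam == Lam')%:R.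
transitivity (\sum_(Lam <- fset_set O) \sum_(Lam' <- Ms)
    (multiplicity Lam')%:R * f Lam' * (hit Lam Lam' / #|stabilizer Lam|%:R)).
  rewrite big_seq [RHS]big_seq; apply: eq_bigr => Lam.
  rewrite in_fset_set // => /set_mem OL.
  have hL := OM _ OL.
  rewrite (reindex_inj (@oppr_inj _)) /=.
  rewrite (eq_bigl (mem G)) => [|g]; last first.
    by apply/idP/idP => [/glue_codeN|/glue_codeN]; rewrite ?opprK.
  transitivity (\sum_(g in G) \sum_(Lam' <- Ms) (multiplicity Lam')%:R * f Lam' *
      ((currents g Lam == Lam')%:R / #|stabilizer Lam|%:R)).
    apply: eq_bigr => g gG; rewrite opprK.
    have hgL : M (currents g Lam) by apply/(highest_weights_currents o pp Lam gG).
    have inMs : currents g Lam \in Ms by rewrite mem_Ms; apply/asboolP.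
    rewrite (bigD1_seq (currents g Lam)) ?fset_uniq //= eqxx.
    rewrite [X in _ + X]big1 ?addr0 => [|Lam' /negPf ne]; last first.
      by rewrite [currents g Lam == _]eq_sym ne mul0r mulr0.
    by rewrite (multiplicity_currents o pp Lam gG) mul1r mulrAC.
  rewrite exchange_big; apply: eq_bigr => Lam' _ /=.
  by rewrite /hit mulr_suml mulr_sumr.
rewrite exchange_big /=; apply: eq_big_seq => Lam'.
rewrite mem_Ms => /asboolP hL'; rewrite -mulr_sumr.
have [Lam0 [[mem0 [h hG E0]] uniq0]] := Orep _ hL'.
have in0 : Lam0 \in fset_set O by rewrite in_fset_set //; apply/mem_set.
rewrite (bigD1_seq Lam0) ?fset_uniq //= [X in _ + X]big1_seq ?addr0 => [|Lam]; last first.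
  case/andP=> ne; rewrite in_fset_set // => /set_mem OL.
  rewrite /hit big1 ?mul0r // => g gG; case: eqP => // Eg.
  case/eqP: ne; apply/esym/uniq0; split=> //.
  by exists (- g); [exact: glue_codeN | rewrite -Eg (currentsK o pp)].
suff -> : hit Lam0 Lam' = #|stabilizer Lam0|%:R by rewrite divff // mulr1.
rewrite /hit (reindex_inj (addIr (- h))) /=.
rewrite (eq_bigl (mem G)) => [|g]; last first.
  apply/idP/idP => [gh|gG]; last by apply: glue_code_sub.
  by rewrite -[g](subrK h); apply: glue_codeD.
rewrite -natr_sum -sum1_card big_mkcond [in RHS]big_mkcond /=; congr (_%:R).
apply: eq_bigr => g _; rewrite inE; case: (g \in G) => //=.
rewrite E0 (currentsD o pp) (currentsK o pp).
have -> : (currents g Lam' == Lam') = (currents g (currents h Lam') == currents h Lam').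
  rewrite -!(currentsD o pp) addrC (currentsD o pp).
  by rewrite (inj_eq (can_inj (currentsK o pp h))).
by case: eqP.
Qed.

Lemma Ftilde_coef (O : set 'M[int]_(r, p)) x :
  representatives M (same_orbit r p) O -> N' x ->
  Ftilde O x tau = coef (sp *: x).
Proof.
move=> hO Nx; rewrite /coef -(orbit_sum _ hO) /Ftilde.
have row_sp i : row i (sp *: x) = sp *: row i x by apply/rowP=> j; rewrite !mxE.
have wx i : weight_lattice (row i (sp *: x)).
  by rewrite row_sp; exact: (dual_rows o i Nx).
apply: eq_fsbigr => Lam /set_mem OL.
have hL : M Lam by case: hO => + _; apply.
apply: eq_bigr => g _.
rewrite -(string_prod_currents g hL wx).
under [in RHS]eq_bigr => i _ do rewrite row_sp.
by [].
Qed.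

End Coefficients.

(** * Expansions over the weight lattice *)

Section Expansion.
Local Open Scope complex_scope.
Variables (R : realType) (p : nat) (o : 'I_p).
Hypothesis o0 : o = 0%N :> nat.
Hypothesis pp : prime p.
Variables (tau : R[i]) (htau : 0 < complex.Im tau).

Local Notation weight_lattice := (dual_lattice (root_lattice R p)).
Local Notation pA := (scaled p%:R (root_lattice R p)).

Lemma e_neq0 (x : R[i]) : e x != 0.
Proof. by rewrite -normr_eq0 norm_e eq_complex /= gt_eqF // expR_gt0. Qed.

Lemma pA_weight x : pA x -> weight_lattice x.
Proof. by move=> [y ry <-]; apply: (weight_latticeMn o); exact: root_weight. Qed.

Lemma coset_weight lam x : weight_lattice lam -> coset lam pA x -> weight_lattice x.
Proof. by move=> wl [y ry <-]; apply: (weight_latticeD o) => //; exact: pA_weight. Qed.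

Lemma has_sum_theta lam z u : weight_lattice lam ->
  has_sum (fun v => if v \in coset lam pA then theta_term tau z u v else 0)
    (theta lam tau z u).
Proof.
move=> wlam.
have S : abs_summable
    (fun v => if v \in coset lam pA then theta_term tau z u v else 0).
  apply: abs_summable_le (theta_term_summable o z u htau) _ => v.
  case: ifP => [/set_mem vc|_]; last by rewrite normr0 normr_ge0.
  by rewrite mem_set //; exact: coset_weight vc.
have [s hs] := abs_summable_has_sum S.
suff -> : theta lam tau z u = s by [].
rewrite /theta; set c := e (p%:R * u).
have -> : csum (coset lam pA)
    (fun nu => e (tau * (dot nu nu / (2 * p)%:R)%:C + dot (toC nu) z)) = c^-1 * s.
  apply: csum_has_sum; apply: has_sum_ext (has_sumZ c^-1 hs) => v.
  by case: ifP => _; rewrite ?mulr0 // /theta_term mulKf ?e_neq0.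
by rewrite mulVKf ?e_neq0.
Qed.

Variable Q : set 'rV[R]_p.
Hypothesis hQ : representatives weight_lattice (fun x y => pA (x - y)) Q.

Let finQ : finite_set Q. Proof. exact: (weight_reps_finite o0 pp hQ). Qed.

Lemma coset_diff (x y : 'rV[R]_p) : coset y pA x <-> pA (x - y).
Proof.
split=> [[w pw <-]|h]; first by rewrite addrC addKr.
by exists (x - y) => //; rewrite addrC subrK.
Qed.

Lemma string_at_coset Lam (x y : 'rV[R]_p) : dominant Lam -> weight_lattice y ->
  pA (x - y) -> string_at Lam x tau = string_at Lam y tau.
Proof.
move=> dom wy [w rw Ew]; have -> : x = y + p%:R *: w by rewrite Ew addrC subrK.
have [_ sh] := shifts_by_root o0 rw.
by have := sh Lam y tau dom wy; rewrite (current0 Lam).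
Qed.

(** The string function is constant on the cosets of p times the root lattice,
    which are disjoint and cover the weight lattice. *)
Lemma string_theta_pointwise Lam z u v : dominant Lam ->
  \sum_(lam <- fset_set Q) (string_at Lam lam tau *
     (if v \in coset lam pA then theta_term tau z u v else 0)) =
  if v \in weight_lattice then string_at Lam v tau * theta_term tau z u v else 0.
Proof.
move=> dom; case: ifP => [/set_mem wv|nv]; last first.
  rewrite big1_seq // => lam; rewrite in_fset_set // => /andP[_ /set_mem Ql].
  case: ifP => [/set_mem vc|_]; last by rewrite mulr0.
  by move: nv; rewrite mem_set //; apply: coset_weight vc; case: hQ => + _; apply.
have [QW Qrep] := hQ; have [lam [[Ql vl] uniq]] := Qrep v wv.
have inQ : lam \in fset_set Q by rewrite in_fset_set //; exact/mem_set.
rewrite (bigD1_seq lam) ?fset_uniq //= [X in _ + X]big1_seq ?addr0.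
  rewrite mem_set; last by apply/coset_diff.
  by rewrite (string_at_coset dom (QW _ Ql) vl).
move=> lam' /andP[ne]; rewrite in_fset_set // => /set_mem Ql'.
case: ifP => [/set_mem/coset_diff vl'|_]; last by rewrite mulr0.
by case/eqP: ne; apply/esym/uniq.
Qed.

Lemma has_sum_string_theta Lam z u : dominant Lam ->
  has_sum (fun v => if v \in weight_lattice
             then string_at Lam v tau * theta_term tau z u v else 0)
    (\sum_(lam \in Q) (string_function Lam (weight_of lam) tau * theta lam tau z u)).
Proof.
move=> dom; rewrite fsbig_finite //=.
apply: has_sum_ext (fun v => string_theta_pointwise z u v dom) _.
apply: has_sum_sum => lam; rewrite in_fset_set // => /set_mem Ql.
rewrite -string_atE; apply: has_sumZ; apply: has_sum_theta.
by case: hQ => + _; apply.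
Qed.

(** The string function takes finitely many values on the weight lattice. *)
Lemma abs_summable_string_theta Lam z u : dominant Lam ->
  abs_summable (fun v => if v \in weight_lattice
             then string_at Lam v tau * theta_term tau z u v else 0).
Proof.
move=> dom; pose B := \sum_(lam <- fset_set Q) `|string_at Lam lam tau|.
apply: (abs_summable_le (abs_summableZ B (theta_term_summable o z u htau))) => v.
have <- := string_theta_pointwise z u v dom.
have B0 : 0 <= B by apply: sumr_ge0.
rewrite normrM (ger0_norm B0) mulr_suml.
apply: le_trans (ler_norm_sum _ _ _) _; rewrite big_seq [leRHS]big_seq.
apply: ler_sum => lam; rewrite in_fset_set // => /set_mem Ql.
rewrite normrM; apply: ler_wpM2l => //.
case: ifP => [/set_mem vc|_]; last by rewrite normr0.
rewrite mem_set //; apply: coset_weight vc.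
by case: hQ => + _; apply.
Qed.

End Expansion.

Opaque coef.

Section Assembly.
Local Open Scope complex_scope.
Variables (R : realType) (p r : nat) (o : 'I_p).
Hypothesis o0 : o = 0%N :> nat.
Hypothesis pp : prime p.
Hypothesis hp : (p \in [:: 2; 3; 5; 7])%N.
Hypothesis hr : r = (48 %/ (p.-1 * p.+1))%N.
Variables (tau : R[i]) (htau : 0 < complex.Im tau).
Variables (z : 'M[R[i]]_(r, p)) (u : 'rV[R[i]]_r).

Local Notation weight_lattice := (dual_lattice (root_lattice R p)).
Local Notation pA := (scaled p%:R (root_lattice R p)).
Local Notation L := (code_lattice R (glue_code r p)).
Local Notation sp := (@Num.sqrt R p%:R).
Local Notation N := (scaled sp L).
Local Notation N' := (dual_lattice N).
Local Notation M := (highest_weights r p).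

Definition lattice_term (x : 'M[R]_(r, p)) : R[i] :=
  \prod_i (if row i x \in weight_lattice
           then theta_term tau (row i z) (u 0 i) (row i x) else 0).

Let pr (x : 'M[R]_(r, p)) (i : 'I_r) : 'rV[R]_p := row i x.
Let mk (f : 'I_r -> 'rV[R]_p) : 'M[R]_(r, p) := \matrix_(i, j) f i 0 j.
Let mkpr x : mk (pr x) = x. Proof. by apply/matrixP=> i j; rewrite !mxE. Qed.
Let prmk f i : pr (mk f) i = f i. Proof. by apply/rowP=> j; rewrite !mxE. Qed.

Lemma lattice_term_summable : abs_summable lattice_term.
Proof.
apply: (abs_summable_prod (pr := pr) (mk := mk)
  (F := fun i v => if v \in weight_lattice
     then theta_term tau (row i z) (u 0 i) v else 0)) => // i.
exact: (theta_term_summable o).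
Qed.

Variable Q : set 'rV[R]_p.
Hypothesis hQ : representatives weight_lattice (fun x y => pA (x - y)) Q.

Lemma has_sum_chi Lam : (forall i, dominant (row i Lam)) ->
  has_sum (fun x => string_prod tau Lam x * lattice_term x) (chi Q Lam tau z u).
Proof.
move=> dom.
pose F i v := if v \in weight_lattice
  then string_at (row i Lam) v tau * theta_term tau (row i z) (u 0 i) v else 0.
have FE x : \prod_i F i (pr x i) = string_prod tau Lam x * lattice_term x.
  rewrite string_prodE -big_split; apply: eq_bigr => i _; rewrite /F /pr /=.
  by case: ifP => _; rewrite ?mulr0.
have Fs i : has_sum (F i) (\sum_(lam \in Q)
    (string_function (row i Lam) (weight_of lam) tau * theta lam tau (row i z) (u 0 i))).
  exact: (has_sum_string_theta o0 pp htau hQ).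
have FS : abs_summable (fun x => \prod_i F i (pr x i)).
  apply: (abs_summable_prod mkpr prmk) => i.
  exact: (abs_summable_string_theta o0 pp htau hQ).
have [s hs] := abs_summable_has_sum FS.
have Es := has_sum_prod mkpr prmk Fs hs.
rewrite /chi -Es; exact: has_sum_ext FE hs.
Qed.

Lemma has_sum_character :
  has_sum (fun x => coef tau x * lattice_term x)
    (\sum_(Lam \in M) ((multiplicity Lam)%:R * chi Q Lam tau z u)).
Proof.
have finM := highest_weights_finite o0 pp hp hr.
rewrite fsbig_finite //=.
apply: (has_sum_ext (f := fun x => \sum_(Lam <- fset_set M)
    (multiplicity Lam)%:R * (string_prod tau Lam x * lattice_term x))) => [x|].
  by rewrite coefE mulr_suml; apply: eq_bigr => Lam _; rewrite mulrA.
apply: has_sum_sum => Lam; rewrite in_fset_set // => /set_mem hL.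
apply: has_sumZ; apply: has_sum_chi => i.
exact: (highest_weight_dominant hp hr).
Qed.

Lemma scaled_theta_term zi ui (v : 'rV[R]_p) :
  theta_term tau zi ui (sp *: v) =
  e (p%:R * ui) * e (tau * (dot v v / 2)%:C + dot (toC v) (sp%:C *: zi)).
Proof.
have Edot : dot (sp *: v) (sp *: v) / (2 * p)%:R = dot v v / 2.
  have -> : dot (sp *: v) (sp *: v) = p%:R * dot v v.
    by rewrite /dot linearZ /= -scalemxAl -scalemxAr scalerA sp_sq linearZ.
  by rewrite natrM; field; exact: p_neq0R.
have EtoC : dot (toC (sp *: v)) zi = dot (toC v) (sp%:C *: zi).
  have -> : toC (sp *: v) = sp%:C *: toC v.
    by apply/rowP=> j; rewrite !mxE rmorphM.
  by rewrite /dot linearZ /= -scalemxAl -scalemxAr.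
by rewrite /theta_term Edot EtoC.
Qed.

(** The variable of summation is rescaled from N to weights of level p. *)
Lemma has_sum_vartheta lam : N' lam ->
  has_sum (fun x => if sp^-1 *: x \in coset lam N then lattice_term x else 0)
    (vartheta N lam tau z u).
Proof.
move=> Nlam; have s0 := sp_neq0 R pp.
have h1 : cancel (fun x : 'M[R]_(r, p) => sp *: x) (fun x => sp^-1 *: x).
  by move=> x; rewrite scalerA mulVf // scale1r.
have h2 : cancel (fun x : 'M[R]_(r, p) => sp^-1 *: x) (fun x => sp *: x).
  by move=> x; rewrite scalerA mulfV // scale1r.
apply: (has_sum_reindex h1 h2).
pose F mu := if mu \in coset lam N then lattice_term (sp *: mu) else 0.
have FS : abs_summable F.
  apply: abs_summable_le (abs_summable_inj (can_inj h1) lattice_term_summable) _ => mu.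
  by rewrite /F /=; case: ifP => // _; rewrite normr0.
have [s hs] := abs_summable_has_sum FS.
suff -> : vartheta N lam tau z u = s.
  by apply: has_sum_ext hs => mu; rewrite /F /= h1.
rewrite /vartheta; apply: csum_has_sum; apply: has_sum_ext hs => mu; rewrite /F.
case: ifP => // /set_mem cmu; apply: eq_bigr => i _.
have Nmu : N' mu := coset_sub_dual o pp Nlam cmu.
have -> : row i (sp *: mu) = sp *: row i mu by apply/rowP=> j; rewrite !mxE.
rewrite mem_set; last exact: (dual_rows o i Nmu).
exact: scaled_theta_term.
Qed.

Variable S : set 'M[R]_(r, p).
Hypothesis hS : representatives N' (fun x y => N (x - y)) S.
Variable O : set 'M[int]_(r, p).
Hypothesis hO : representatives M (same_orbit r p) O.

Lemma lattice_term_rows x : lattice_term x != 0 ->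
  forall i, weight_lattice (row i x).
Proof.
move=> nz i; apply: contrapT => nw; case/eqP: nz.
have /negPf nmem : row i x \notin weight_lattice by apply/negP => /set_mem.
by rewrite /lattice_term (bigD1 i) //= nmem mul0r.
Qed.

Lemma coset_N (x y : 'M[R]_(r, p)) : coset y N x <-> N (x - y).
Proof.
split=> [[w pw <-]|h]; first by rewrite addrC addKr.
by exists (x - y) => //; rewrite addrC subrK.
Qed.

(** At a term that is not zero, at most one coset contributes, and its
    coefficient can be evaluated at any of its points by coef_shift. *)
Lemma has_sum_expansion :
  has_sum (fun x => coef tau x * lattice_term x)
    (\sum_(lam \in S) (Ftilde O lam tau * vartheta N lam tau z u)).
Proof.
have finS : finite_set S := dual_reps_finite o0 pp hS.
have [SN Srep] := hS; have s0 := sp_neq0 R pp.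
rewrite fsbig_finite //=.
apply: (has_sum_ext (f := fun x => \sum_(lam <- fset_set S) Ftilde O lam tau *
    (if sp^-1 *: x \in coset lam N then lattice_term x else 0))) => [x|]; last first.
  apply: has_sum_sum => lam; rewrite in_fset_set // => /set_mem Sl.
  by apply: has_sumZ; apply: has_sum_vartheta; exact: SN.
have [->|nz] := eqVneq (lattice_term x) 0.
  by rewrite mulr0 big1 // => lam _; rewrite if_same mulr0.
have wx := lattice_term_rows nz.
have [Nx|nN] := pselect (N' (sp^-1 *: x)); last first.
  have -> : coef tau x = 0.
    apply: contrapT => /eqP c0; apply: nN.
    exact: (coef_class o0 pp hp hr wx c0).
  rewrite mul0r big1_seq // => lam /andP[_]; rewrite in_fset_set // => /set_mem Sl.
  case: ifP => [/set_mem cx|_]; last by rewrite mulr0.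
  by case: nN; exact: (coset_sub_dual o pp (SN _ Sl) cx).
have [lam [[Sl xl] uniq]] := Srep _ Nx.
have inS : lam \in fset_set S by rewrite in_fset_set //; exact/mem_set.
rewrite (bigD1_seq lam) ?fset_uniq //= [X in _ + X]big1_seq ?addr0; last first.
  move=> lam' /andP[ne]; rewrite in_fset_set // => /set_mem Sl'.
  case: ifP => [/set_mem/coset_N xl'|_]; last by rewrite mulr0.
  by case/eqP: ne; apply/esym/uniq.
rewrite mem_set; last by apply/coset_N.
congr (_ * _); rewrite (Ftilde_coef o0 pp hp hr tau hO (SN _ Sl)).
have [y Ly Ey] := xl.
have -> : x = sp *: lam + p%:R *: y.
  have -> : p%:R *: y = sp *: (sp *: y) by rewrite scalerA sp_sq.
  by rewrite Ey -scalerDr addrC subrK scalerA mulfV // scale1r.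
symmetry; apply: (coef_shift o0 pp hp hr tau) => // i.
have -> : row i (sp *: lam) = sp *: row i lam by apply/rowP=> j; rewrite !mxE.
exact: (dual_rows o i (SN _ Sl)).
Qed.

End Assembly.

Unset Implicit Arguments.
Local Open Scope complex_scope.

(* Q, S and O are arbitrary sets of representatives of A_q'/pA_q, of N'/N and
   of the orbits of the code on the highest weights. *)
Theorem proposition5p4 (R : realType) (p q r : nat)
  (hp : (p \in [:: 2; 3; 5; 7])%N)
  (hq : q = p.-1)
  (hr : r = (48 %/ (q * p.+1))%N)
  (N : set 'M[R]_(r, p))
  (hN : N = scaled (Num.sqrt p%:R) (code_lattice R (glue_code r p)))
  (Q : set 'rV[R]_p)
  (hQ : representatives (dual_lattice (root_lattice R p))
          (fun x y => scaled p%:R (root_lattice R p) (x - y)) Q)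
  (S : set 'M[R]_(r, p))
  (hS : representatives (dual_lattice N) (fun x y => N (x - y)) S)
  (O : set 'M[int]_(r, p))
  (hO : representatives (highest_weights r p) (same_orbit r p) O)
  (tau : R[i]) (htau : 0 < complex.Im tau)
  (z : 'M[R[i]]_(r, p)) (hz : traceless_rows z)
  (u : 'rV[R[i]]_r) :
  \sum_(Lam \in highest_weights r p)
     ((multiplicity Lam)%:R * chi Q Lam tau z u)
  = \sum_(lam \in S) (Ftilde O lam tau * vartheta N lam tau z u).
Proof.
have pp : prime p by move: hp; rewrite !inE => /or4P[]/eqP->.
subst N q.
pose o : 'I_p := Ordinal (prime_gt0 pp); have o0 : o = 0%N :> nat by [].
apply: has_sum_unique.
  exact: (has_sum_character o0 pp hp hr htau z u hQ).
exact: (has_sum_expansion o0 pp hp hr htau z u hS hO).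
Qed.
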